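(* Let $\mathcal T=\{T_s\}_{s\ge 0}$ be a semigroup of Dunford-Schwartz operators that is strongly continuous in $\mathcal L^1$, and let $\beta:\mathbb R_+\to\mathbb C$ be a bounded Besicovitch function with $\|\beta\|_\infty<C<\infty$. Then, given $1\le p<\infty$ and $f\in\mathcal L^p$, the averages $M_t(\mathcal T,\beta)(f)=\frac1t\int_0^t\beta(s)T_s(f)\,ds$, $t>0$, converge almost uniformly as $t\to\infty$ to some $\widehat f\in\mathcal L^p$.
   Context: Let $(\Omega,\mathcal A,\mu)$ be a $\sigma$-finite measure space with $\mu(\Omega)=\infty$. $\mathcal L^0$ is the algebra of equivalence classes of a.e. finite complex-valued measurable functions on $\Omega$, and $\mathcal L^p=\mathcal L^p(\Omega,\mu)\subset\mathcal L^0$ ($1\le p\le\infty$) is the usual space with norm $\|\cdot\|_p$. A Dunford-Schwartz operator ($T\in DS$) is a linear operator $T:\mathcal L^1\to\mathcal L^1$ with $\|T(f)\|_1\le\|f\|_1$ for all $f\in\mathcal L^1$ and $\|T(f)\|_\infty\le\|f\|_\infty$ for all $f\in\mathcal L^1\cap\mathcal L^\infty$. Such $T$ is identified with its unique linear extension to $\mathcal L^1+\mathcal L^\infty$ that contracts $\mathcal L^\infty$ and whose restriction to $\mathcal L^\infty$ is $\sigma(\mathcal L^\infty,\mathcal L^1)$-continuous; the extension also contracts every $\mathcal L^p$, $1<p<\infty$. A semigroup $\{T_s\}_{s\ge0}\subset DS$ satisfies $T_0=I$ and $T_{r+s}=T_rT_s$ for $r,s\ge0$. It is strongly continuous in $\mathcal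 L^1$ if $\|T_s(f)-T_{s_0}(f)\|_1\to0$ whenever $s\to s_0$, for all $f\in\mathcal L^1$. For $f\in\mathcal L^p$, $1\le p<\infty$, and $\beta:\mathbb R_+\to\mathbb C$ Lebesgue measurable with $\|\beta\|_\infty<\infty$, the integral $\int_0^t\beta(s)T_s(f)\,ds$ is a Bochner integral in $\mathcal L^p$. A net $\{f_\alpha\}\subset\mathcal L^0$ converges almost uniformly (a.u.) to $f\in\mathcal L^0$ if for every $\varepsilon>0$ there is a measurable set $G\subset\Omega$ with $\mu(\Omega\setminus G)\le\varepsilon$ and $\|(f-f_\alpha)\chi_G\|_\infty\to0$. Let $\mathbb C_1=\{z\in\mathbb C:|z|=1\}$. A trigonometric polynomial is a function $p:\mathbb R_+\to\mathbb C$ of the form $p(s)=\sum_{j=1}^nw_j\lambda_j^s$ with $n\in\mathbb N$, $w_j\in\mathbb C$, $\lambda_j\in\mathbb C_1$, where $\lambda_j^s=e^{i\theta_js}$ for a real number $\theta_j$ with $e^{i\theta_j}=\lambda_j$ (any real $\theta_j$ allowed). A Lebesgue measurable function $\beta:\mathbb R_+\to\mathbb C$ is a bounded Besicovitch function if $\|\beta\|_\infty<\infty$ and for every $\varepsilon>0$ there is a trigonometric polynomial $p_\varepsilon$ such that $\limsup_{t\to\infty}\frac1t\int_0^t|\beta(s)-p_\varepsilon(s)|\,ds<\varepsilon$. *)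

(* Defs.v *)
From HB Require Import structures.
From mathcomp Require Import all_boot all_order all_algebra.
From mathcomp Require Import complex.
From mathcomp Require Import all_classical all_reals all_analysis.

Set Implicit Arguments.
Unset Strict Implicit.
Unset Printing Implicit Defensive.

Import Order.TTheory GRing.Theory Num.Theory.
Import numFieldNormedType.Exports.

Local Open Scope classical_set_scope.
Local Open Scope ring_scope.

Notation cnorm := ComplexField.Normc.normc.

(* The real line with the sigma-algebra of Lebesgue measurable sets, which is
   the domain of [completed_lebesgue_measure]; [measurableTypeR R] would only
   provide the Borel sets.  As a type it is convertible to [R]. *)
Notation lebesgueTypeR R := (caratheodory_type (@wlength R idfun)^*%mu).

Notation leb := (completed_lebesgue_measure).

Section complex_Lp.
Context {d : measure_display} {T : measurableType d} {R : realType}.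

Definition cmeasurable (D : set T) (f : T -> R[i]) : Prop :=
  measurable_fun D (fun x => complex.Re (f x)) /\
  measurable_fun D (fun x => complex.Im (f x)).

Variable mu : {measure set T -> \bar R}.

Definition cLnorm (p : \bar R) (f : T -> R[i]) : \bar R :=
  Lnorm mu p (fun x => (cnorm (f x))%:E).

(* Elements of L^p are represented by functions; equality of elements of L^p
   is equality mu-almost everywhere. *)
Definition cLp (p : \bar R) : set (T -> R[i]) :=
  [set f | cmeasurable [set: T] f /\ (cLnorm p f < +oo)%E].

Definition cL1Loo : set (T -> R[i]) :=
  [set f | exists g h, [/\ cLp 1%E g, cLp +oo%E h &
                           forall x, f x = g x + h x]].

Definition cpairing (f g : T -> R[i]) : R[i] :=
  Complex (Rintegral mu [set: T] (fun x => complex.Re (f x * g x)))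
          (Rintegral mu [set: T] (fun x => complex.Im (f x * g x))).

(* Continuity of the restriction of A to L^oo for the topology sigma(L^oo, L^1),
   in terms of the subbasic neighbourhoods {f : |<f - f0, h>| < e}. *)
Definition weak_star_continuous (A : (T -> R[i]) -> (T -> R[i])) : Prop :=
  forall f0, cLp +oo%E f0 -> forall g, cLp 1%E g -> forall e : R, 0 < e ->
  exists (n : nat) (h : 'I_n -> T -> R[i]) (dl : R),
    [/\ forall i, cLp 1%E (h i), 0 < dl &
      forall f, cLp +oo%E f ->
        (forall i, cnorm (cpairing (fun x => f x - f0 x) (h i)) < dl) ->
        cnorm (cpairing (fun x => A f x - A f0 x) g) < e].

Record dunford_schwartz (A : (T -> R[i]) -> (T -> R[i])) : Prop := {
  ds_ae : forall f g, cLp 1%E f -> cLp 1%E g ->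
    f = g %[ae mu] -> A f = A g %[ae mu] ;
  ds_L1 : forall f, cLp 1%E f -> cLp 1%E (A f) ;
  ds_linear : forall (a : R[i]) f g, cLp 1%E f -> cLp 1%E g ->
    A (fun x => a * f x + g x) = (fun x => a * A f x + A g x) %[ae mu] ;
  ds_contract1 : forall f, cLp 1%E f -> (cLnorm 1%E (A f) <= cLnorm 1%E f)%E ;
  ds_contractoo : forall f, cLp 1%E f -> cLp +oo%E f ->
    (cLnorm +oo%E (A f) <= cLnorm +oo%E f)%E }.

(* The operator A, on L^1 + L^oo, is the canonical extension of its own
   restriction to L^1. *)
Record ds_extended (A : (T -> R[i]) -> (T -> R[i])) : Prop := {
  dse_ae : forall f g, cL1Loo f -> cL1Loo g ->
    f = g %[ae mu] -> A f = A g %[ae mu] ;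
  dse_L1Loo : forall f, cL1Loo f -> cL1Loo (A f) ;
  dse_linear : forall (a : R[i]) f g, cL1Loo f -> cL1Loo g ->
    A (fun x => a * f x + g x) = (fun x => a * A f x + A g x) %[ae mu] ;
  dse_Loo : forall f, cLp +oo%E f -> cLp +oo%E (A f) ;
  dse_contractoo : forall f, cLp +oo%E f ->
    (cLnorm +oo%E (A f) <= cLnorm +oo%E f)%E ;
  dse_weak_star : weak_star_continuous A }.

Record ds_semigroup (A : R -> (T -> R[i]) -> (T -> R[i])) : Prop := {
  dsg_ds : forall s, 0 <= s -> dunford_schwartz (A s) ;
  dsg_ext : forall s, 0 <= s -> ds_extended (A s) ;
  dsg0 : forall f, cLp 1%E f -> A 0 f = f %[ae mu] ;
  dsgD : forall r s f, 0 <= r -> 0 <= s -> cLp 1%E f ->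
    A (r + s) f = A r (A s f) %[ae mu] }.

Definition strongly_continuous_L1
    (A : R -> (T -> R[i]) -> (T -> R[i])) : Prop :=
  forall f, cLp 1%E f -> forall s0, 0 <= s0 ->
  cLnorm 1%E (fun x => A s f x - A s0 f x)
    @[s --> within `[0, +oo[ (nbhs s0)] --> (0 : \bar R).

(* A simple function [0, t] -> L^p, s |-> \sum_i 1_{E_i}(s) g_i. *)
Record Lp_simple (p : \bar R) (t : R) := LpSimple {
  lps_size : nat ;
  lps_set : 'I_lps_size -> set (lebesgueTypeR R) ;
  lps_val : 'I_lps_size -> T -> R[i] ;
  lps_measurable : forall i, measurable (lps_set i) ;
  lps_sub : forall i, lps_set i `<=` `[0, t] ;
  lps_Lp : forall i, cLp p (lps_val i) }.

Arguments lps_set {p t} l _ _.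
Arguments lps_val {p t} l _ _.

Definition lps_fun p t (S : Lp_simple p t) (s : R) (x : T) : R[i] :=
  \sum_i (\1_(lps_set S i) s : R)%:C%C * lps_val S i x.

Definition lps_integral p t (S : Lp_simple p t) (x : T) : R[i] :=
  \sum_i (fine (leb (lps_set S i)))%:C%C * lps_val S i x.

(* g is the Bochner integral over [0, t] of F : [0, t] -> L^p. *)
Definition is_bochner_integral (p : \bar R) (t : R)
    (F : R -> T -> R[i]) (g : T -> R[i]) : Prop :=
  [/\ forall s, 0 <= s <= t -> cLp p (F s),
      cLp p g &
      exists S : nat -> Lp_simple p t,
      [/\ {ae leb, forall s : lebesgueTypeR R, 0 <= (s : R) <= t ->
            cLnorm p (fun x => F s x - lps_fun (S n) s x)
              @[n --> \oo] --> (0 : \bar R)},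
          (\int[leb]_(s in (`[0%R, t] : set (lebesgueTypeR R)))
            cLnorm p (fun x => F s x - lps_fun (S n) s x)%R)%E
              @[n --> \oo] --> (0 : \bar R) &
          cLnorm p (fun x => g x - lps_integral (S n) x)
              @[n --> \oo] --> (0 : \bar R)]].

Definition bochner_integrable (p : \bar R) (t : R) (F : R -> T -> R[i]) :=
  exists g, is_bochner_integral p t F g.

(* A representative of the Bochner integral (0 if F is not integrable). *)
Definition bochner_integral (p : \bar R) (t : R) (F : R -> T -> R[i]) :
    T -> R[i] :=
  xget (fun=> 0) [set g | is_bochner_integral p t F g].

Definition ergodic_average (p : \bar R) (A : R -> (T -> R[i]) -> (T -> R[i]))
    (beta : R -> R[i]) (f : T -> R[i]) (t : R) : T -> R[i] :=
  fun x => (t^-1)%:C%C * bochner_integral p t (fun s y => beta s * A s f y) x.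

Definition au_cvg (I : Type) (F : set_system I) (u : I -> T -> R[i])
    (f : T -> R[i]) : Prop :=
  forall e : R, 0 < e -> exists G : set T,
    [/\ measurable G, (mu (~` G) <= e%:E)%E &
        cLnorm +oo%E (fun x => (f x - u i x) * (\1_G x : R)%:C%C)
          @[i --> F] --> (0 : \bar R)].

End complex_Lp.

Section besicovitch.
Context {R : realType}.

Definition expi (x : R) : R[i] := Complex (cos x) (sin x).

(* With lambda_j = expi (theta_j), the power lambda_j^s is expi (theta_j s). *)
Definition trig_poly (q : R -> R[i]) : Prop :=
  exists (n : nat) (w : 'I_n -> R[i]) (theta : 'I_n -> R),
    forall s, q s = \sum_j w j * expi (theta j * s).

(* The L^oo norm of beta on [0, +oo[. *)
Definition Rplus_norm (beta : R -> R[i]) : \bar R :=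
  cLnorm leb +oo%E (fun s : lebesgueTypeR R =>
    beta s * (\1_(`[0, +oo[ : set R) s : R)%:C%C).

Definition bounded_besicovitch (beta : R -> R[i]) : Prop :=
  [/\ cmeasurable (`[0, +oo[ : set (lebesgueTypeR R)) beta,
      (Rplus_norm beta < +oo)%E &
      forall e : R, 0 < e -> exists2 q, trig_poly q &
        (limf_esup (fun t : R => (t^-1)%:E *
            \int[leb]_(s in (`[0%R, t] : set (lebesgueTypeR R)))
              (cnorm (beta s - q s)%R)%:E) (pinfty_nbhs R) < e%:E)%E].

End besicovitch.

(* Main.v *)
(* It suffices to prove that the averages are almost uniformly Cauchy for [f] in a
   dense subclass of L^p and to have a maximal inequality.

   The maximal inequality comes from Chacon's filling scheme for one operator
   [P = T_h]: the mass of [f] above a level [a] is moved forward by [P] and poured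
   into the capacity left below [a].  Truncating complex values radially makes
   this work without the linear modulus of [P].  It applies to all weighted sums
   of [P^j f] with decreasing bounds on the weights, in particular to the Riemann
   sums of the integral of [beta(s) T_s(f)], and passes to the limit [h -> 0].

   The dense subclass consists of [g = 1/r \int_0^r T_s(g0) ds] with [g0] bounded
   and integrable.  Then [s |-> T_s(g)] is Lipschitz for the L^oo norm, so that the
   averages of [beta(s) T_s(g)] are approximated, uniformly in large [t], by
   averages of [q(jh) T_h^j(g)] over [jh <= t], with a fixed mesh [h] and a
   trigonometric polynomial [q].  These are combinations of averages of
   [lambda^j T_h^j(g)], which are Cauchy in L^2 by the parallelogram law and hence,
   by the maximal inequality, almost uniformly Cauchy. *)
From HB Require Import structures.
Require Import Defs.
From mathcomp Require Import all_boot all_order all_algebra.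
From mathcomp Require Import complex.
From mathcomp Require Import all_classical all_reals all_analysis.
From mathcomp Require Import measurable_realfun ess_sup_inf.
From mathcomp Require Import ring lra.

Set Implicit Arguments.
Unset Strict Implicit.
Unset Printing Implicit Defensive.

Import Order.TTheory GRing.Theory Num.Theory.
Import numFieldNormedType.Exports.

Local Open Scope classical_set_scope.
Local Open Scope ring_scope.

(** * Complex norms and L^p spaces *)

(** The L^p estimates for a single operator come from one inequality: a Dunford-Schwartz operator
    does not increase the integral of [(|f| - l)^+], whatever the level [l > 0]. Summed over dyadic
    levels it bounds the operators on L^p, [p > 1], with a constant depending only on [p]; summed
    over a fine arithmetic grid it gives the constant 1 on L^2 for bounded integrable functions,
    which the parallelogram argument requires.

    Operator values and integrals are known only almost everywhere and [t] is a real parameter, so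
    null sets cannot be collected over all [t]. The uniform statements therefore have an exceptional
    set of small measure chosen before [t], and a null set that may depend on [t]. This suffices,
    since almost uniform convergence is measured by an L^oo norm for each [t] separately.

    Smoothing is what permits a mesh independent of [t]: strong continuity controls Riemann sums
    only in norm, whereas an orbit that is Lipschitz in L^oo gives an almost everywhere error
    proportional to the mesh times [t], which stays small after division by [t]. *)

Section cnorm_theory.
Context {R : realType}.
Implicit Types z w : R[i].

Lemma cnormE z : cnorm z = Num.sqrt (complex.Re z ^+ 2 + complex.Im z ^+ 2).
Proof. by case: z. Qed.

Lemma cnorm_ge0 z : 0 <= cnorm z.
Proof. by rewrite cnormE sqrtr_ge0. Qed.

Lemma cnormD z w : cnorm (z + w) <= cnorm z + cnorm w.
Proof. exact: le_normcD. Qed.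

Lemma cnormN z : cnorm (- z) = cnorm z.
Proof. exact: normcN. Qed.

Lemma cnorm0 : cnorm (0 : R[i]) = 0.
Proof. exact: ComplexField.Normc.normc0. Qed.

Lemma cnorm1 : cnorm (1 : R[i]) = 1.
Proof. exact: ComplexField.Normc.normc1. Qed.

Lemma cnormM z w : cnorm (z * w) = cnorm z * cnorm w.
Proof. exact: ComplexField.Normc.normcM. Qed.

Lemma cnormB z w : cnorm (z - w) <= cnorm z + cnorm w.
Proof. by rewrite -(cnormN w) cnormD. Qed.

Lemma cnorm_distC z w : cnorm (z - w) = cnorm (w - z).
Proof. by rewrite -cnormN opprB. Qed.

Lemma cnorm_triangle z w v : cnorm (z - w) <= cnorm (z - v) + cnorm (v - w).
Proof. by rewrite (_ : z - w = (z - v) + (v - w)) ?cnormD//; ring. Qed.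

Lemma cnorm_real (x : R) : cnorm (x%:C%C) = `|x|.
Proof. by rewrite cnormE /= expr0n addr0 sqrtr_sqr. Qed.

Lemma cnorm_eq0 z : (cnorm z == 0) = (z == 0).
Proof.
by apply/eqP/eqP => [/ComplexField.Normc.eq0_normc//|->]; rewrite cnorm0.
Qed.

Lemma le_Re_cnorm z : `|complex.Re z| <= cnorm z.
Proof. by rewrite cnormE -sqrtr_sqr ler_wsqrtr// lerDl sqr_ge0. Qed.

Lemma le_Im_cnorm z : `|complex.Im z| <= cnorm z.
Proof. by rewrite cnormE -sqrtr_sqr ler_wsqrtr// lerDr sqr_ge0. Qed.

Lemma cnorm_le_ReIm z : cnorm z <= `|complex.Re z| + `|complex.Im z|.
Proof.
rewrite cnormE -[leRHS]ger0_norm ?addr_ge0// -sqrtr_sqr ler_wsqrtr//.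
rewrite sqrrD !real_normK ?num_real// lerD2r lerDl.
by rewrite mulrn_wge0// mulr_ge0.
Qed.

Lemma cnorm_sum (I : Type) (s : seq I) (P : pred I) (F : I -> R[i]) :
  cnorm (\sum_(i <- s | P i) F i) <= \sum_(i <- s | P i) cnorm (F i).
Proof.
elim/big_ind2 : _ => //; first by rewrite cnorm0.
by move=> x1 x2 y1 y2 h1 h2; rewrite (le_trans (cnormD _ _))// lerD.
Qed.

Lemma cnorm_parallelogram z w :
  cnorm (z + w) ^+ 2 + cnorm (z - w) ^+ 2
  = 2 * cnorm z ^+ 2 + 2 * cnorm w ^+ 2.
Proof.
case: z w => [a b] [c d]; rewrite !cnormE /=.
by rewrite !sqr_sqrtr ?addr_ge0 ?sqr_ge0//; ring.
Qed.

Lemma ReD z w : complex.Re (z + w) = complex.Re z + complex.Re w.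
Proof. by case: z w => [? ?] [? ?]. Qed.

Lemma ImD z w : complex.Im (z + w) = complex.Im z + complex.Im w.
Proof. by case: z w => [? ?] [? ?]. Qed.

Lemma ReN z : complex.Re (- z) = - complex.Re z.
Proof. by case: z => [? ?]. Qed.

Lemma ImN z : complex.Im (- z) = - complex.Im z.
Proof. by case: z => [? ?]. Qed.

Lemma ReM z w : complex.Re (z * w) =
  complex.Re z * complex.Re w - complex.Im z * complex.Im w.
Proof. by case: z w => [? ?] [? ?]. Qed.

Lemma ImM z w : complex.Im (z * w) =
  complex.Re z * complex.Im w + complex.Im z * complex.Re w.
Proof. by case: z w => [? ?] [? ?]. Qed.

Lemma cnorm_expi (x : R) : cnorm (expi x) = 1.
Proof. by rewrite cnormE /= cos2Dsin2 sqrtr1. Qed.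

Lemma expiD (x y : R) : expi (x + y) = expi x * expi y.
Proof. by rewrite /expi cosD sinD; apply/eqP; rewrite eq_complex /= addrC eqxx/=; apply/eqP; ring. Qed.

Lemma expi0 : expi (0 : R) = 1.
Proof. by rewrite /expi cos0 sin0. Qed.

End cnorm_theory.

Section cmeasurable_theory.
Context {d : measure_display} {T : measurableType d} {R : realType}.
Variable D : set T.
Implicit Types f g : T -> R[i].

Lemma cmeasurable_cst (c : R[i]) : cmeasurable D (fun=> c).
Proof. by split; exact: measurable_cst. Qed.

Lemma cmeasurableD f g : cmeasurable D f -> cmeasurable D g ->
  cmeasurable D (fun x => f x + g x).
Proof.
move=> [rf jf] [rg jg]; split.
- by under eq_fun do rewrite ReD; exact: measurable_funD.
- by under eq_fun do rewrite ImD; exact: measurable_funD.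
Qed.

Lemma cmeasurableN f : cmeasurable D f -> cmeasurable D (fun x => - f x).
Proof.
move=> [rf jf]; split.
- by under eq_fun do rewrite ReN; exact: measurableT_comp.
- by under eq_fun do rewrite ImN; exact: measurableT_comp.
Qed.

Lemma cmeasurableB f g : cmeasurable D f -> cmeasurable D g ->
  cmeasurable D (fun x => f x - g x).
Proof. by move=> mf mg; apply: cmeasurableD => //; exact: cmeasurableN. Qed.

Lemma cmeasurableM f g : cmeasurable D f -> cmeasurable D g ->
  cmeasurable D (fun x => f x * g x).
Proof.
move=> [rf jf] [rg jg]; split.
- under eq_fun do rewrite ReM.
  by apply: measurable_funB; exact: measurable_funM.
- under eq_fun do rewrite ImM.
  by apply: measurable_funD; exact: measurable_funM.
Qed.

Lemma cmeasurableZ (c : R[i]) f : cmeasurable D f ->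
  cmeasurable D (fun x => c * f x).
Proof. by move=> mf; apply: cmeasurableM => //; exact: cmeasurable_cst. Qed.

Lemma cmeasurable_real (f : T -> R) : measurable_fun D f ->
  cmeasurable D (fun x => (f x)%:C%C).
Proof. by move=> mf; split => //=; exact: measurable_cst. Qed.

Lemma cmeasurable_sum (I : Type) (s : seq I) (P : pred I) (F : I -> T -> R[i]) :
  (forall i, P i -> cmeasurable D (F i)) ->
  cmeasurable D (fun x => \sum_(i <- s | P i) F i x).
Proof.
move=> mF; elim: s => [|i s ih].
  by under eq_fun do rewrite big_nil; exact: cmeasurable_cst.
under eq_fun do rewrite big_cons.
by case: (P i) (mF i) => // /(_ isT) mFi; exact: cmeasurableD.
Qed.

Lemma measurable_cnorm f : cmeasurable D f ->
  measurable_fun D (fun x => cnorm (f x)).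
Proof.
move=> [rf jf].
under eq_fun do rewrite cnormE.
apply: (@measurableT_comp _ _ _ _ _ _ (@Num.sqrt R)).
  by apply: continuous_measurable_fun; exact: sqrt_continuous.
by apply: measurable_funD; exact: measurable_funX.
Qed.

Lemma measurable_cnormE f : cmeasurable D f ->
  measurable_fun D (fun x => (cnorm (f x))%:E).
Proof. by move=> mf; apply/measurable_EFinP; exact: measurable_cnorm. Qed.

End cmeasurable_theory.

Section Lp_theory.
Context {d : measure_display} {T : measurableType d} {R : realType}.
Variable mu : {measure set T -> \bar R}.
Implicit Types (f g h : T -> R[i]) (p : R).

Local Notation N p f := (cLnorm mu p f).

Definition pint p f : \bar R := (\int[mu]_x ((cnorm (f x)) `^ p)%:E)%E.

Lemma pint_ge0 p f : (0 <= pint p f)%E.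
Proof. by apply: integral_ge0 => x _; rewrite lee_fin powR_ge0. Qed.

Lemma measurable_cnorm_pow p f : cmeasurable setT f ->
  measurable_fun setT (fun x => ((cnorm (f x)) `^ p)%:E).
Proof.
move=> mf; apply/measurable_EFinP.
apply: (@measurableT_comp _ _ _ _ _ _ (fun x : R => x `^ p)) => //.
exact: measurable_cnorm.
Qed.

Lemma cLnormE p f : N p%:E f = ((pint p f) `^ p^-1)%E.
Proof.
rewrite /cLnorm unlock; congr poweR; apply: eq_integral => x _.
by rewrite abse_EFin ger0_norm ?cnorm_ge0// poweR_EFin.
Qed.

Lemma pintE p f : p != 0 -> pint p f = (N p%:E f `^ p)%E.
Proof. by move=> p0; rewrite cLnormE -poweRrM mulVf// poweRe1// pint_ge0. Qed.

Lemma cLnorm_ge0 (p : \bar R) f : (0 <= N p f)%E.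
Proof. exact: Lnorm_ge0. Qed.

Lemma cLnorm1E f : N 1%E f = (\int[mu]_x (cnorm (f x))%:E)%E.
Proof.
rewrite /cLnorm Lnorm1; apply: eq_integral => x _.
by rewrite abse_EFin ger0_norm ?cnorm_ge0.
Qed.

Lemma pint_lty p f : p != 0 -> (pint p f < +oo)%E = (N p%:E f < +oo)%E.
Proof.
move=> p0; apply/idP/idP => h; first by rewrite cLnormE poweR_lty.
by rewrite pintE// poweR_lty.
Qed.

Lemma le_pint p f g : 0 <= p -> cmeasurable setT f -> cmeasurable setT g ->
  {ae mu, forall x, cnorm (f x) <= cnorm (g x)} -> (pint p f <= pint p g)%E.
Proof.
move=> p0 mf mg fg; apply: ae_ge0_le_integral => //.
- by move=> x _; rewrite lee_fin powR_ge0.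
- exact: measurable_cnorm_pow.
- by move=> x _; rewrite lee_fin powR_ge0.
- exact: measurable_cnorm_pow.
- apply: filterS fg => x fg _; rewrite lee_fin ge0_ler_powR// nnegrE cnorm_ge0//.
Qed.

Lemma le_cLnorm p f g : 0 <= p -> cmeasurable setT f -> cmeasurable setT g ->
  {ae mu, forall x, cnorm (f x) <= cnorm (g x)} -> (N p%:E f <= N p%:E g)%E.
Proof.
move=> p0 mf mg fg; rewrite !cLnormE gt0_ler_poweR ?invr_ge0//.
- by rewrite in_itv/= pint_ge0 leey.
- by rewrite in_itv/= pint_ge0 leey.
- exact: le_pint.
Qed.

Lemma ae_cLnorm p f g : 0 <= p -> cmeasurable setT f -> cmeasurable setT g ->
  f = g %[ae mu] -> N p%:E f = N p%:E g.
Proof.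
move=> p0 mf mg fg; apply/eqP; rewrite eq_le; apply/andP; split;
  by apply: le_cLnorm => //; apply: filterS fg => x /(_ Logic.I) ->.
Qed.

Lemma cLnormD p f g : 1 <= p -> cmeasurable setT f -> cmeasurable setT g ->
  (N p%:E (fun x => f x + g x)%R <= N p%:E f + N p%:E g)%E.
Proof.
move=> p1 mf mg.
pose u x := (cnorm (f x))%:C%C; pose v x := (cnorm (g x))%:C%C.
have mcf := measurable_cnorm mf; have mcg := measurable_cnorm mg.
apply: (@le_trans _ _ (N p%:E (fun x => u x + v x))).
  apply: le_cLnorm; first exact: le_trans p1.
  - exact: cmeasurableD.
  - by apply: cmeasurableD; exact: cmeasurable_real.
  - apply: aeW => x; rewrite /u /v -rmorphD cnorm_real.
    by rewrite ger0_norm ?addr_ge0 ?cnorm_ge0// cnormD.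
have -> : N p%:E (fun x => u x + v x) =
    Lnorm mu p%:E (EFin \o ((fun x => cnorm (f x)) \+ (fun x => cnorm (g x)))).
  rewrite /cLnorm; congr Lnorm; apply/funext => x.
  by rewrite /u /v -rmorphD cnorm_real ger0_norm ?addr_ge0 ?cnorm_ge0.
exact: minkowski_EFin.
Qed.

Lemma cLnormZ p c f : 1 <= p -> cmeasurable setT f ->
  N p%:E (fun x => c * f x) = ((cnorm c)%:E * N p%:E f)%E.
Proof.
move=> p1 mf; have p0 : 0 < p by exact: lt_le_trans p1.
rewrite !cLnormE.
have -> : pint p (fun x => c * f x) = (((cnorm c) `^ p)%:E * pint p f)%E.
  rewrite /pint -ge0_integralZl_EFin//.
  - by apply: eq_integral => x _; rewrite cnormM powRM ?cnorm_ge0.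
  - by move=> x _; rewrite lee_fin powR_ge0.
  - exact: measurable_cnorm_pow.
  - by rewrite powR_ge0.
rewrite poweRM ?lee_fin ?powR_ge0 ?pint_ge0// poweR_EFin -powRrM mulfV ?gt_eqF//.
by rewrite powRr1// cnorm_ge0.
Qed.

Lemma cLnormN (p : \bar R) f : N p (fun x => - f x) = N p f.
Proof. by rewrite /cLnorm; congr Lnorm; apply/funext => x; rewrite cnormN. Qed.

Lemma cLnorm_distC (p : \bar R) f g : N p (fun x => f x - g x) = N p (fun x => g x - f x).
Proof.
by rewrite /cLnorm; congr Lnorm; apply/funext => x; rewrite cnorm_distC.
Qed.

Lemma cLnorm0 p : 0 < p -> N p%:E (fun=> 0) = 0%E.
Proof.
move=> p0; rewrite cLnormE /pint.
under eq_integral do rewrite cnorm0 powR0 ?gt_eqF//.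
by rewrite integral0 poweR0r// invr_neq0 ?gt_eqF.
Qed.

Lemma cLnormB p f g : 1 <= p -> cmeasurable setT f -> cmeasurable setT g ->
  (N p%:E (fun x => f x - g x)%R <= N p%:E f + N p%:E g)%E.
Proof.
move=> p1 mf mg; rewrite -(cLnormN _ g); apply: cLnormD => //.
exact: cmeasurableN.
Qed.

Lemma cLnorm_triangle p f g h : 1 <= p -> cmeasurable setT f ->
  cmeasurable setT g -> cmeasurable setT h ->
  (N p%:E (fun x => (f x - g x)%R) <=
   N p%:E (fun x => (f x - h x)%R) + N p%:E (fun x => (h x - g x)%R))%E.
Proof.
move=> p1 mf mg mh.
rewrite [X in (N _ X <= _)%E](_ : _ = fun x => (f x - h x) + (h x - g x)).
  by apply: cLnormD => //; exact: cmeasurableB.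
by apply/funext => x; ring.
Qed.

Lemma cLnorm_sum p (I : Type) (s : seq I) (F : I -> T -> R[i]) : 1 <= p ->
  (forall i, cmeasurable setT (F i)) ->
  (N p%:E (fun x => \sum_(i <- s) F i x)%R <= \sum_(i <- s) N p%:E (F i))%E.
Proof.
move=> p1 mF; elim: s => [|i s ih].
  under eq_fun do rewrite big_nil.
  by rewrite big_nil cLnorm0// (lt_le_trans ltr01).
rewrite big_cons; under eq_fun do rewrite big_cons.
apply: le_trans (cLnormD p1 _ _) _ => //; last by rewrite leeD2l.
exact: cmeasurable_sum.
Qed.

Lemma measurable_cnorm_gt (a : R) f : cmeasurable setT f ->
  measurable [set x | a < cnorm (f x)].
Proof.
move=> mf; rewrite -[X in measurable X]setTI.
have -> : [set x | a < cnorm (f x)] = (fun x => cnorm (f x)) @^-1` `]a, +oo[.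
  by apply/seteqP; split => x /=; rewrite in_itv/= andbT.
by apply: (measurable_cnorm mf).
Qed.

Lemma chebyshev p (a : R) f : 0 < a -> 0 <= p -> cmeasurable setT f ->
  ((a `^ p)%:E * mu [set x | (a < cnorm (f x))%R] <= pint p f)%E.
Proof.
move=> a0 p0 mf; set A := [set x | _].
have mA : measurable A by exact: measurable_cnorm_gt.
rewrite -(@integral_cst _ _ _ _ A)//.
apply: (@le_trans _ _ (\int[mu]_(x in A) ((cnorm (f x)) `^ p)%:E)%E).
  apply: ge0_le_integral => //.
  - by move=> x _; rewrite lee_fin powR_ge0.
  - apply: measurable_funTS; exact: measurable_cnorm_pow.
  - move=> x /ltW ax; rewrite lee_fin ge0_ler_powR// nnegrE ?cnorm_ge0//.
    exact: ltW.
apply: ge0_subset_integral => //; first exact: measurable_cnorm_pow.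
by move=> x _; rewrite lee_fin powR_ge0.
Qed.

Lemma pint_interp p (B : R) f : 1 <= p -> cmeasurable setT f -> 0 <= B ->
  {ae mu, forall x, cnorm (f x) <= B} ->
  (pint p f <= (B `^ (p - 1))%:E * N 1%E f)%E.
Proof.
move=> p1 mf B0 fB; rewrite cLnorm1E.
rewrite -ge0_integralZl_EFin//; last 3 first.
- by move=> x _; rewrite lee_fin cnorm_ge0.
- exact: measurable_cnormE.
- by rewrite powR_ge0.
apply: ae_ge0_le_integral => //.
- by move=> x _; rewrite lee_fin powR_ge0.
- exact: measurable_cnorm_pow.
- by move=> x _; rewrite -EFinM lee_fin mulr_ge0 ?powR_ge0 ?cnorm_ge0.
- by apply: measurable_funeM; exact: measurable_cnormE.
apply: filterS fB => x fB _; rewrite -EFinM lee_fin.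
rewrite -mulr_powRB1 ?cnorm_ge0//; last exact: lt_le_trans p1.
rewrite mulrC ler_wpM2r ?cnorm_ge0// ge0_ler_powR ?nnegrE ?cnorm_ge0//.
by rewrite subr_ge0.
Qed.

Lemma cLp_measurable (p : \bar R) f : cLp mu p f -> cmeasurable setT f.
Proof. by case. Qed.

Lemma cLpD p f g : 1 <= p -> cLp mu p%:E f -> cLp mu p%:E g ->
  cLp mu p%:E (fun x => f x + g x).
Proof.
move=> p1 [mf lf] [mg lg]; split; first exact: cmeasurableD.
by rewrite (le_lt_trans (cLnormD p1 mf mg))// lte_add_pinfty.
Qed.

Lemma cLpZ p c f : 1 <= p -> cLp mu p%:E f -> cLp mu p%:E (fun x => c * f x).
Proof.
move=> p1 [mf lf]; split; first exact: cmeasurableZ.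
by rewrite cLnormZ// lte_mul_pinfty// lee_fin cnorm_ge0.
Qed.

Lemma cLp0 p : 1 <= p -> cLp mu p%:E (fun=> 0).
Proof.
move=> p1; split; first exact: cmeasurable_cst.
by rewrite cLnorm0// (lt_le_trans ltr01).
Qed.

Lemma cLp_sum p (I : Type) (s : seq I) (P : pred I) (F : I -> T -> R[i]) :
  1 <= p -> (forall i, P i -> cLp mu p%:E (F i)) ->
  cLp mu p%:E (fun x => \sum_(i <- s | P i) F i x).
Proof.
move=> p1 lF; elim: s => [|i s ih].
  by under eq_fun do rewrite big_nil; exact: cLp0.
under eq_fun do rewrite big_cons.
by case: (P i) (lF i) => // /(_ isT) lFi; exact: cLpD.
Qed.

Lemma cLpN (p : \bar R) f : cLp mu p f -> cLp mu p (fun x => - f x).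
Proof. by move=> [mf lf]; split; [exact: cmeasurableN|rewrite cLnormN]. Qed.

Lemma cLpB p f g : 1 <= p -> cLp mu p%:E f -> cLp mu p%:E g ->
  cLp mu p%:E (fun x => f x - g x).
Proof. by move=> p1 lf lg; apply: cLpD => //; exact: cLpN. Qed.

Lemma cLp_dom p f g : 0 <= p -> cmeasurable setT f -> cLp mu p%:E g ->
  {ae mu, forall x, cnorm (f x) <= cnorm (g x)} -> cLp mu p%:E f.
Proof.
move=> p0 mf [mg lg] fg; split => //.
exact: le_lt_trans (le_cLnorm p0 mf mg fg) lg.
Qed.

Lemma cLp_interp p (B : R) f : 1 <= p -> cLp mu 1%E f ->
  {ae mu, forall x, cnorm (f x) <= B} -> cLp mu p%:E f.
Proof.
move=> p1 [mf lf] fB; split => //.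
have fB' : {ae mu, forall x, cnorm (f x) <= `|B|}.
  by apply: filterS fB => x /le_trans; apply; exact: ler_norm.
rewrite -pint_lty ?gt_eqF//; last exact: lt_le_trans p1.
apply: le_lt_trans (pint_interp p1 mf _ fB') _ => //.
by rewrite lte_mul_pinfty// lee_fin powR_ge0.
Qed.

Section Loo.
Hypothesis mu0 : (0 < mu setT)%E.

(** [Lnorm] at infinity is the essential supremum under the guard that the whole space has positive
    measure, hence [mu0]. L^oo bounds are used below in this pointwise form. *)
Lemma cLnormooP (B : R) f :
  (N +oo%E f <= B%:E)%E <-> {ae mu, forall x, cnorm (f x) <= B}.
Proof.
rewrite /cLnorm unlock mu0; split => [/ess_supP|fB].
  apply: filterS => x /=.
  by rewrite ger0_norm ?cnorm_ge0// lee_fin.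
apply/ess_supP; apply: filterS fB => x /=.
by rewrite ger0_norm ?cnorm_ge0// lee_fin.
Qed.

Lemma cLpooP f : cLp mu +oo%E f <->
  cmeasurable setT f /\ exists B : R, {ae mu, forall x, cnorm (f x) <= B}.
Proof.
split=> [[mf lf]|[mf [B fB]]]; split => //; last first.
  by rewrite (le_lt_trans ((cLnormooP _ _).2 fB))// ltry.
exists (fine (N +oo%E f)); apply/cLnormooP.
by rewrite fineK// ge0_fin_numE// cLnorm_ge0.
Qed.
End Loo.

End Lp_theory.

(** * Powers of 1/2, Borel-Cantelli and almost uniform limits *)

Section half_powers.
Context {R : realType}.

Local Notation h k := (2^-1 ^+ k : R).

Lemma half_gt0 k : 0 < h k. Proof. by rewrite exprn_gt0// invr_gt0. Qed.

Lemma half_ge0 k : 0 <= h k. Proof. exact: ltW (half_gt0 k). Qed.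

Lemma sum_half (K m : nat) : \sum_(i < m) h (K + i) <= 2 * h K.
Proof.
suff -> : \sum_(i < m) h (K + i) = 2 * h K - 2 * h (K + m).
  by rewrite gerBl mulr_ge0// half_ge0.
elim: m => [|m ih]; first by rewrite big_ord0 addn0 subrr.
by rewrite big_ord_recr /= ih addnS exprS; lra.
Qed.

Lemma half_small (e : R) : 0 < e -> exists K : nat, h K < e.
Proof.
move=> e0; have : (fun n => h n) @ \oo --> (0 : R).
  by apply: cvg_expr; rewrite ger0_norm ?invr_ge0// invf_lt1// ltr1n.
move/cvgrPdist_lt/(_ e e0) => -[K _ /(_ K (leqnn K))].
by rewrite sub0r normrN ger0_norm ?half_ge0// => ?; exists K.
Qed.

Lemma half_mono (k m : nat) : (k <= m)%N -> h m <= h k.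
Proof. by move=> km; apply: ler_wiXn2l => //; rewrite ?invr_ge0// invf_le1// ler1n. Qed.

Lemma le_of_forall_eps (x y : R) : (forall e, 0 < e -> x <= y + e) -> x <= y.
Proof.
by move=> xy; apply/ler_addgt0Pr => e e0; exact: xy.
Qed.

Lemma cnorm_dist (z w : R[i]) : `|cnorm z - cnorm w| <= cnorm (z - w).
Proof.
rewrite ler_norml; apply/andP; split.
  rewrite lerBrDr addrC lerBlDl cnorm_distC.
  by rewrite -[X in cnorm X <= _](subrK z) cnormD.
by rewrite lerBlDr -[X in cnorm X <= _](subrK w) cnormD.
Qed.

Lemma tail_cauchy_cvg (x : nat -> R) (b : nat -> R) (K : nat) :
  (forall k m, (K <= k <= m)%N -> `|x m - x k| <= b k) ->
  (forall e, 0 < e -> exists2 k, (K <= k)%N & b k < e) ->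
  cvgn x.
Proof.
move=> xb b0; apply/cauchy_cvgP/cauchy_exP => e e0.
have [k Kk bk] := b0 e e0; exists (x k); exists k => // m /= km.
by rewrite /ball/= distrC (le_lt_trans _ bk)// xb// Kk.
Qed.

End half_powers.

Section measure_bounds.
Context {d : measure_display} {T : measurableType d} {R : realType}.
Variable mu : {measure set T -> \bar R}.

Lemma mu_bigcup_nondecreasing_le (F : nat -> set T) (B : \bar R) :
  (forall n, measurable (F n)) -> nondecreasing_seq F ->
  (forall n, (mu (F n) <= B)%E) -> (mu (\bigcup_n F n) <= B)%E.
Proof.
move=> mF ndF FB.
have Fcvg : mu \o F @ \oo --> mu (\bigcup_n F n).
  by apply: nondecreasing_cvg_mu => //; exact: bigcupT_measurable.
by apply: (cvge_le _ Fcvg); exact: nearW.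
Qed.

Lemma mu_tail_half (E : nat -> set T) (K : nat) :
  (forall n, measurable (E n)) ->
  (forall n, (mu (E n) <= (2^-1 ^+ n)%:E)%E) ->
  (mu (\bigcup_(k in [set k | (K <= k)%N]) E k) <= (2 * 2^-1 ^+ K)%:E)%E.
Proof.
move=> mE E2.
have -> : \bigcup_(k in [set k | (K <= k)%N]) E k = \bigcup_k E (K + k)%N.
  apply/seteqP; split => x [k /= Kk Ekx]; last first.
    by exists (K + k)%N => //=; rewrite leq_addr.
  by exists (k - K)%N => //; rewrite subnKC.
apply: (@le_trans _ _ (\sum_(0 <= k <oo) mu (E (K + k)%N))%E).
  apply: measure_sigma_subadditive => //.
  by apply: bigcupT_measurable => k.
apply: lime_le; first exact: is_cvg_nneseries.
apply: nearW => n; rewrite big_mkord.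
apply: (@le_trans _ _ (\sum_(i < n) (2^-1 ^+ (K + i) : R)%:E)%E).
  by apply: lee_sum => i _; exact: E2.
by rewrite sumEFin lee_fin sum_half.
Qed.

(** Borel-Cantelli: the points lying in infinitely many [E k] belong to every tail union, whose
    measure is at most [2 * 2^-K]. *)
Lemma ae_eventually_notin (E : nat -> set T) :
  (forall n, measurable (E n)) ->
  (forall n, (mu (E n) <= (2^-1 ^+ n)%:E)%E) ->
  {ae mu, forall x, exists K, forall k, (K <= k)%N -> ~ E k x}.
Proof.
move=> mE E2.
exists (\bigcap_K (\bigcup_(k in [set k | (K <= k)%N]) E k)); split.
- by apply: bigcapT_measurable => K; apply: bigcup_measurable.
- apply/eqP; rewrite -measure_le0; apply/lee_addgt0Pr => e e0.
  have [K hK] := half_small (divr_gt0 e0 (ltr0n _ 2)).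
  rewrite add0e; apply: (@le_trans _ _ (2 * 2^-1 ^+ K)%:E); last first.
    by rewrite lee_fin mulrC -ler_pdivlMr// ltW.
  apply: le_trans (mu_tail_half K mE E2).
  apply: le_measure; rewrite ?inE.
  + by apply: bigcapT_measurable => k; apply: bigcup_measurable.
  + by apply: bigcup_measurable.
  + by move=> x; apply.
- move=> x /= nx K _; apply: contrapT => nE; apply: nx; exists K => k Kk Ek.
  by apply: nE; exists k.
Qed.

(** The increments are summable at each point that is eventually outside the [E k]. The hypothesis
    is asked at every point off [E k], so the estimate on the limit involves no null set. *)
Lemma au_limit (u : nat -> T -> R[i]) (E : nat -> set T) :
  (forall k, cmeasurable setT (u k)) -> (forall k, measurable (E k)) ->
  (forall k x, ~ E k x -> cnorm (u k.+1 x - u k x) <= 2^-1 ^+ k) ->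
  exists2 g : T -> R[i], cmeasurable setT g &
    forall K x, (forall k, (K <= k)%N -> ~ E k x) ->
    forall k, (K <= k)%N -> cnorm (g x - u k x) <= 2 * 2^-1 ^+ k.
Proof.
move=> mu_ mE uE.
pose A := \bigcup_K (\bigcap_(k in [set k | (K <= k)%N]) ~` E k).
have mA : measurable A.
  apply: bigcupT_measurable => K; apply: bigcap_measurable.
    by exists K => /=.
  by move=> k _; exact: measurableC.
(* Off [A] the sequence is replaced by 0: it then converges at every point, which makes its limit
   measurable. *)
pose v k x := u k x * ((\1_A x : R)%:C%C).
have mv k : cmeasurable setT (v k).
  by apply: cmeasurableM => //; apply: cmeasurable_real; exact: measurable_indic.
have vA k x : A x -> v k x = u k x.
  by move=> Ax; rewrite /v indicE mem_set//= mulr1.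
have vNA k x : ~ A x -> v k x = 0.
  by move=> Ax; rewrite /v indicE memNset//= mulr0.
have ub K x : (forall k, (K <= k)%N -> ~ E k x) ->
    forall k m, (K <= k <= m)%N -> cnorm (u m x - u k x) <= 2 * 2^-1 ^+ k.
  move=> nE k m /andP[Kk km]; rewrite -(subnKC km).
  apply: le_trans (sum_half k (m - k)).
  elim: (m - k)%N => [|n ih]; first by rewrite addn0 subrr cnorm0 big_ord0.
  rewrite addnS big_ord_recr/= addrC; apply: le_trans (cnorm_triangle _ _ (u (k + n)%N x)) _.
  by rewrite lerD// uE//; apply: nE; rewrite (leq_trans Kk)// leq_addr.
have cvg_of (P : R[i] -> R) : P 0 = 0 -> (forall z w, `|P z - P w| <= cnorm (z - w)) ->
    forall x, cvgn (fun k => P (v k x)).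
  move=> P0 Plip x; have [[K _ AK]|nA] := pselect (A x); last first.
    rewrite (_ : (fun k => _) = cst 0); first exact: is_cvg_cst.
    by apply/funext => k /=; rewrite vNA.
  have Ax : A x by exists K.
  apply: (@tail_cauchy_cvg _ _ (fun k => 2 * 2^-1 ^+ k) K) => [k m Kkm|e e0].
    by rewrite !vA// (le_trans (Plip _ _))// (ub K).
  have [k hk] := half_small (divr_gt0 e0 (ltr0n _ 2)).
  exists (maxn K k); first exact: leq_maxl.
  rewrite mulrC -ltr_pdivlMr// (le_lt_trans _ hk)// half_mono//.
  exact: leq_maxr.
have rl (z w : R[i]) : `|complex.Re z - complex.Re w| <= cnorm (z - w).
  by rewrite -ReN -ReD le_Re_cnorm.
have il (z w : R[i]) : `|complex.Im z - complex.Im w| <= cnorm (z - w).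
  by rewrite -ImN -ImD le_Im_cnorm.
have cr := cvg_of (@complex.Re R) erefl rl.
have ci := cvg_of (@complex.Im R) erefl il.
pose g x := Complex (limn (fun k => complex.Re (v k x)))
  (limn (fun k => complex.Im (v k x))).
exists g.
  split; rewrite /g /=.
  - apply: (@measurable_fun_cvg _ _ _ _ (fun k x => complex.Re (v k x))).
      by move=> k; case: (mv k).
    by move=> x _; exact: cr.
  - apply: (@measurable_fun_cvg _ _ _ _ (fun k x => complex.Im (v k x))).
      by move=> k; case: (mv k).
    by move=> x _; exact: ci.
move=> K x nE k Kk; have Ax : A x by exists K.
apply: le_of_forall_eps => e e0.
have e20 : 0 < e / 2 by rewrite divr_gt0.
have /cvgrPdist_lt/(_ _ e20)[M1 _ M1P] := cr x.
have /cvgrPdist_lt/(_ _ e20)[M2 _ M2P] := ci x.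
pose m := maxn k (maxn M1 M2).
apply: le_trans (cnorm_triangle _ _ (u m x)) _; rewrite addrC lerD//.
  by apply: (ub K) => //; rewrite Kk /= leq_maxl.
apply: le_trans (cnorm_le_ReIm _) _; rewrite (splitr e) ReD ReN ImD ImN /g /=.
rewrite -(vA m x Ax) lerD//; apply: ltW.
  by apply: M1P => /=; rewrite (leq_trans (leq_maxl M1 M2))// leq_maxr.
by apply: M2P => /=; rewrite (leq_trans (leq_maxr M1 M2))// leq_maxr.
Qed.

End measure_bounds.

(** * Fatou's lemma and completeness of L^p *)

Section fatou_completeness.
Context {d : measure_display} {T : measurableType d} {R : realType}.
Variable mu : {measure set T -> \bar R}.

Lemma powR_cvg_base (p l : R) (a : nat -> R) : 0 < l ->
  a @ \oo --> l -> (fun k => a k `^ p) @ \oo --> l `^ p.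
Proof.
move=> l0 al; apply: (@continuous_cvg _ _ _ _ _ _ (fun x : R => x `^ p)) al.
apply: differentiable_continuous; apply/derivable1_diffP.
by apply: derivable_powR; rewrite in_itv/= l0.
Qed.

Lemma fatou_pint (p : R) (u : nat -> T -> R[i]) (g : T -> R[i]) (M : \bar R) :
  0 < p -> (forall k, cmeasurable setT (u k)) -> cmeasurable setT g ->
  {ae mu, forall x, (fun k => cnorm (g x - u k x)) @ \oo --> (0 : R)} ->
  (forall k, (pint mu p (u k) <= M)%E) -> (pint mu p g <= M)%E.
Proof.
move=> p0 mu_ mg ug uM.
pose F k x := ((cnorm (u k x)) `^ p)%:E.
have F0 k x : [set: T] x -> (0 <= F k x)%E by rewrite lee_fin powR_ge0.
have mF k : measurable_fun setT (F k) by exact: measurable_cnorm_pow.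
apply: (@le_trans _ _ (limn_einf (fun k => \int[mu]_x F k x)%E)); last first.
  rewrite limn_einf_lim; apply: lime_le; first exact: is_cvg_einfs.
  apply: nearW => n; apply: le_trans (uM n).
  by apply: ereal_inf_lbound => /=; exists n => /=.
apply: le_trans (fatou mu measurableT mF F0).
apply: ae_ge0_le_integral => //.
- by move=> x _; rewrite lee_fin powR_ge0.
- exact: measurable_cnorm_pow.
- move=> x _; rewrite limn_einf_lim; apply: lime_ge; first exact: is_cvg_einfs.
  apply: nearW => n; apply: le_ereal_inf_tmp => _ /= [k _ <-].
  by rewrite lee_fin powR_ge0.
- have -> : (fun x => limn_einf (F ^~ x)) =
      (fun x => - limn_esup (fun n => - F n x))%E.
    apply/funext => x; rewrite -limn_einfN; congr limn_einf.
    by apply/funext => n; rewrite /comp oppeK.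
  apply: measurableT_comp => //.
  apply: (@measurable_fun_limn_esup _ _ _ _ (fun n x => - F n x)%E) => n.
  exact: measurableT_comp.
apply: filterS ug => x ugx _.
(* [powR_cvg_base] asks for a positive limit; where [g] vanishes the left-hand side is 0. *)
have [g0|g0] := eqVneq (g x) 0.
  rewrite g0 cnorm0 powR0 ?gt_eqF//.
  rewrite limn_einf_lim; apply: lime_ge; first exact: is_cvg_einfs.
  apply: nearW => n; apply: le_ereal_inf_tmp => _ /= [k _ <-].
  by rewrite lee_fin powR_ge0.
have /cvg_limn_einf_sup[-> _] // : (fun k => F k x) @ \oo --> ((cnorm (g x)) `^ p)%:E.
apply: cvg_EFin; first exact: nearW.
rewrite /F /comp/=; apply: powR_cvg_base.
  by rewrite lt_neqAle eq_sym cnorm_eq0 g0 cnorm_ge0.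
apply/cvgrPdist_lt => e e0; move/cvgrPdist_lt/(_ e e0) : ugx.
apply: filterS => k; rewrite sub0r normrN (ger0_norm (cnorm_ge0 _)).
by apply: le_lt_trans; exact: cnorm_dist.
Qed.

End fatou_completeness.

Section completeness.
Context {d : measure_display} {T : measurableType d} {R : realType}.
Variable mu : {measure set T -> \bar R}.
Implicit Types (u : nat -> T -> R[i]) (p : R).

Local Notation N p f := (cLnorm mu p f).

Lemma cvg0_half (a : nat -> R) (c : R) (K : nat) : 0 <= c ->
  (forall k, (K <= k)%N -> `|a k| <= c * 2^-1 ^+ k) -> a @ \oo --> (0 : R).
Proof.
move=> c0 aP; apply/cvgr0Pnorm_lt => e e0.
have c1 : 0 < c + 1 by rewrite ltr_wpDl.
have [m hm] := half_small (divr_gt0 e0 c1).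
exists (maxn K m) => // k /=; rewrite geq_max => /andP[Kk mk].
apply: le_lt_trans (aP _ Kk) _; move: hm; rewrite ltr_pdivlMr// mulrC.
apply: le_lt_trans; apply: ler_pM => //; rewrite ?half_ge0 ?lerDl//.
exact: half_mono.
Qed.

(** With [h = 2^-k], Chebyshev at level [h] gives measure at most [(h * h / h)^p = h^p], and
    [h^p <= h] because [h <= 1 <= p]. Hence the squares of [2^-k] in the norm bounds below. *)
Lemma chebyshev_half p (k : nat) (f : T -> R[i]) : 1 <= p ->
  cmeasurable setT f ->
  (N p%:E f <= (2^-1 ^+ k * 2^-1 ^+ k)%:E)%E ->
  (mu [set x | (2^-1 ^+ k < cnorm (f x))%R] <= (2^-1 ^+ k)%:E)%E.
Proof.
move=> p1 mf fk; set h := 2^-1 ^+ k in fk *.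
have h0 : 0 < h by exact: half_gt0.
have p0 : 0 < p by exact: lt_le_trans p1.
have h1 : h <= 1 by rewrite /h exprn_ile1 ?invr_ge0// invf_le1// ler1n.
have hp0 : 0 < h `^ p by exact: powR_gt0.
have : ((h `^ p)%:E * mu [set x | (h < cnorm (f x))%R] <= (h `^ p)%:E * h%:E)%E.
  apply: le_trans (chebyshev mu h0 (ltW p0) mf) _.
  rewrite pintE ?gt_eqF//.
  apply: (@le_trans _ _ ((h * h)%:E `^ p)%E).
    rewrite gt0_ler_poweR ?(ltW p0)//.
    - by rewrite in_itv/= cLnorm_ge0 leey.
    - by rewrite in_itv/= leey lee_fin mulr_ge0// ltW.
  rewrite poweR_EFin -EFinM lee_fin powRM ?(ltW h0)// ler_wpM2l ?(ltW hp0)//.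
  by rewrite ge1r_powR// h0.
by rewrite lee_pmul2l// ?lte_fin.
Qed.

Lemma ae_fast_cvg p u (g : T -> R[i]) : 1 <= p ->
  (forall k, cmeasurable setT (u k)) -> cmeasurable setT g ->
  (forall k, (N p%:E (fun x => (g x - u k x)%R) <=
              (2^-1 ^+ k * 2^-1 ^+ k)%:E)%E) ->
  {ae mu, forall x, exists K, forall k, (K <= k)%N ->
     cnorm (g x - u k x) <= 2^-1 ^+ k}.
Proof.
move=> p1 mu_ mg ug.
pose E k := [set x | 2^-1 ^+ k < cnorm (g x - u k x)].
have mE k : measurable (E k).
  by apply: measurable_cnorm_gt; exact: cmeasurableB.
have := ae_eventually_notin mE (fun k => chebyshev_half p1 (cmeasurableB mg (mu_ k)) (ug k)).
apply: filterS => x [K xK]; exists K => k /xK /negP.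
by rewrite -leNgt.
Qed.

Lemma riesz_fischer p u : 1 <= p -> (forall k, cLp mu p%:E (u k)) ->
  (forall e, 0 < e -> exists K, forall m n, (K <= m)%N -> (K <= n)%N ->
     (N p%:E (fun x => (u m x - u n x)%R) <= e%:E)%E) ->
  exists2 g, cLp mu p%:E g &
    forall e, 0 < e -> exists K, forall n, (K <= n)%N ->
     (N p%:E (fun x => (g x - u n x)%R) <= e%:E)%E.
Proof.
move=> p1 lu cu; have p0 : 0 < p by exact: lt_le_trans p1.
have mu_ k : cmeasurable setT (u k) by case: (lu k).
have h20 k : 0 < 2^-1 ^+ k * 2^-1 ^+ k :> R by rewrite mulr_gt0// half_gt0.
pose phi k := sval (cid (cu _ (h20 k))).
have phiP k := svalP (cid (cu _ (h20 k))).
(* Partial sums make [psi] monotone and at least [phi]; the [.+1] also forces [psi k > k], so that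
   [psi] tends to infinity. *)
pose psi k := (\sum_(i < k.+1) (phi i).+1)%N.
have phi_psi k : (phi k <= psi k)%N by rewrite /psi big_ord_recr (leq_trans (leqnSn _))//= leq_addl.
have psiS k : (psi k <= psi k.+1)%N by rewrite /psi [leqRHS]big_ord_recr leq_addr.
pose v k := u (psi k).
have mv k : cmeasurable setT (v k) by exact: mu_.
pose E k := [set x | 2^-1 ^+ k < cnorm (v k.+1 x - v k x)].
have mE k : measurable (E k).
  by apply: measurable_cnorm_gt; exact: cmeasurableB.
have muE k : (mu (E k) <= (2^-1 ^+ k)%:E)%E.
  apply: (@chebyshev_half p) => //; first exact: cmeasurableB.
  by apply: phiP; [exact: leq_trans (phi_psi k) (psiS k)|exact: phi_psi].
have [k x|g mg gP] := au_limit (fun k => mu_ (psi k)) mE.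
  by move=> /negP; rewrite -leNgt.
have vg : {ae mu, forall x, (fun k => cnorm (g x - v k x)) @ \oo --> (0 : R)}.
  apply: filterS (ae_eventually_notin mE muE) => x [K xK].
  apply: (@cvg0_half _ 2 K) => // k Kk.
  by rewrite ger0_norm ?cnorm_ge0//; apply: (gP K).
have gu e : 0 < e -> exists K, forall n, (K <= n)%N ->
     (N p%:E (fun x => (g x - u n x)%R) <= e%:E)%E.
  move=> e0; have [K KP] := cu e e0; exists K => n Kn.
  have [K2 K2P] : exists K2, forall k, (K2 <= k)%N -> (K <= psi k)%N.
    exists K => k /leq_trans; apply; rewrite (leq_trans (leqnSn k))//.
    rewrite /psi -[X in (X <= _)%N]card_ord -sum1_card.
    by apply: leq_sum.
  (* Fatou along the subsequence with [n] fixed controls the whole sequence, not only [v]. *)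
  have : (pint mu p (fun x => g x - u n x)%R <= (e `^ p)%:E)%E.
    apply: (@fatou_pint _ _ _ _ p (fun k x => v (k + K2)%N x - u n x)) => //.
    - by move=> k; exact: cmeasurableB.
    - exact: cmeasurableB.
    - apply: filterS vg => x vgx.
      under eq_fun do rewrite opprB addrA subrK.
      by move: vgx; rewrite -(cvg_shiftn K2).
    - move=> k; rewrite pintE ?gt_eqF// -poweR_EFin gt0_ler_poweR ?(ltW p0)//.
      + by rewrite in_itv/= cLnorm_ge0 leey.
      + by rewrite in_itv/= leey lee_fin ltW.
      + by apply: KP => //; apply: K2P; rewrite leq_addl.
  move=> h; rewrite cLnormE; apply: le_trans (_ : ((e `^ p)%:E `^ p^-1 <= _)%E).
    rewrite gt0_ler_poweR ?invr_ge0 ?(ltW p0)//.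
    - by rewrite in_itv/= pint_ge0 leey.
    - by rewrite in_itv/= leey lee_fin powR_ge0.
  by rewrite poweR_EFin -powRrM mulfV ?gt_eqF// powRr1// ltW.
exists g => //; split => //.
have [K /(_ K (leqnn K)) gK] := gu 1 ltr01.
rewrite [X in N _ X](_ : _ = fun x => (g x - u K x) + u K x); last first.
  by apply/funext => x; rewrite subrK.
apply: (le_lt_trans (cLnormD mu p1 (cmeasurableB mg (mu_ K)) (mu_ K))).
by rewrite lte_add_pinfty ?(lu K).2// (le_lt_trans gK)// ltry.
Qed.

End completeness.

(** * Truncations and operators on L^1 + L^oo *)

Section excess.
Context {R : realType}.
Implicit Types (x l c : R).

(** The positive part [(x - l)^+]; the form with [min] matches the truncation [cclip], which removes
    this much from the modulus. *)
Definition excess l x : R := x - Num.min l x.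

Lemma excess_ge0 l x : 0 <= excess l x.
Proof. by rewrite subr_ge0 ge_min lexx orbT. Qed.

Lemma excess_max l x : excess l x = Num.max (x - l) 0.
Proof. by rewrite /excess; case: leP => h; case: ltP => h2; lra. Qed.

Lemma excess_le l x : 0 <= l -> 0 <= x -> excess l x <= x.
Proof. by move=> l0 x0; rewrite gerBl le_min l0. Qed.

Lemma excess_mono l x y : x <= y -> excess l x <= excess l y.
Proof.
by move=> xy; rewrite !excess_max ge_max !le_max lerB//= lexx orbT.
Qed.

Lemma excess_addl l x y : 0 <= y -> excess l (x + y) <= excess l x + y.
Proof. by move=> y0; rewrite !excess_max; case: (ltP (x + y - l) 0) => ?; case: (ltP (x - l) 0) => ?; lra. Qed.

Lemma excess_small l x : x <= l -> excess l x = 0.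
Proof. by move=> xl; rewrite excess_max; case: ltP => ?; lra. Qed.

Lemma measurable_excess l : measurable_fun [set: R] (excess l).
Proof.
apply: measurable_funB => //; apply: measurable_minr => //.
Qed.

Lemma excess_pow p l x : 1 <= p -> 0 < l -> 0 <= x ->
  l `^ (p - 1) * excess l x <= x `^ p.
Proof.
move=> p1 l0 x0; rewrite excess_max; case: (ltP (x - l) 0) => h.
  by rewrite mulr0 powR_ge0.
rewrite -[leRHS]mulr_powRB1//; last exact: lt_le_trans p1.
rewrite mulrC ler_pM ?powR_ge0//; first lra.
by rewrite ge0_ler_powR ?nnegrE ?subr_ge0//; lra.
Qed.

(* The bounds telescope in [k], so that [x^2] is a Riemann sum of excesses up to
   [h x]; an operator that does not increase the integral of any excess is
   therefore a contraction of L^2. *)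
Lemma sqr_excess_step (h x : R) (k : nat) : 0 < h -> 0 <= x ->
  let a := excess (k%:R * h) x in let b := excess (k.+1%:R * h) x in
  2 * h * b <= a ^+ 2 - b ^+ 2 /\ a ^+ 2 - b ^+ 2 <= 2 * h * b + h * (a - b).
Proof.
move=> h0 x0; rewrite !excess_max -natr1 mulrDl mul1r opprD addrA.
set y := x - _.
by case: (ltP y 0) => hy; case: (ltP (y - h) 0) => hb; split; nra.
Qed.

Lemma sqr_excess_sum (h x : R) (n : nat) : 0 < h -> 0 <= x ->
  \sum_(k < n) (2 * h * excess (k.+1%:R * h) x) <= x ^+ 2 /\
  (x <= n%:R * h ->
   x ^+ 2 <= \sum_(k < n) (2 * h * excess (k.+1%:R * h) x) + h * x).
Proof.
move=> h0 x0; pose q k := excess (k%:R * h) x.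
have q0 : q 0 = x by rewrite /q mul0r excess_max subr0; case: ltP => ?; lra.
have q_ge0 k : 0 <= q k by exact: excess_ge0.
suff [H1 H2] : \sum_(k < n) (2 * h * q k.+1) <= x ^+ 2 - q n ^+ 2 /\
    x ^+ 2 - q n ^+ 2 <= \sum_(k < n) (2 * h * q k.+1) + h * (x - q n).
  split; first by apply: le_trans H1 _; rewrite gerBl sqr_ge0.
  move=> xn; have qn : q n = 0 by apply: excess_small.
  by move: H2; rewrite qn expr0n/= !subr0.
elim: n => [|n [ih1 ih2]]; first by rewrite big_ord0 q0 !subrr mulr0 addr0.
rewrite big_ord_recr/=; have [] := sqr_excess_step n h0 x0.
rewrite -/(q n) -/(q n.+1) => s1 s2; split; lra.
Qed.

Section dyadic.
Variable p : R.
Hypothesis p1 : 1 < p.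

Let l (n i : nat) : R := 2^-1 ^+ n * 2 ^+ i.
Let w n i := (l n i) `^ (p - 1).

(** A discretisation, up to constants, of [x^p = p (p - 1) \int_0^oo l^(p-2) (x - l)^+ dl] over the
    levels [2^-n, ..., 2^(n-1)]: the spacing of the levels is comparable to [l], which turns
    [l^(p-2)] into [l^(p-1)]. *)
Definition dyadic_sum n x : R := \sum_(i < n + n) w n i * excess (l n i) x.

Let l_gt0 n i : 0 < l n i.
Proof. by rewrite mulr_gt0// ?exprn_gt0. Qed.

(** The factor in [l^(p-1) - (l/2)^(p-1) = c * l^(p-1)]. *)
Let c : R := 1 - 2^-1 `^ (p - 1).

Lemma dyadic_const_gt0 : 0 < c.
Proof.
have one_pow : (1 : R) `^ (p - 1) = 1 by rewrite powR1.
rewrite subr_gt0 -[ltRHS]one_pow gt0_ltr_powR ?subr_gt0// ?nnegrE//.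
by rewrite invf_lt1// ltr1n.
Qed.

Let lS n i : l n i.+1 = 2 * l n i.
Proof. by rewrite /l exprS mulrCA. Qed.

(** A level [l >= x] contributes nothing; a level [l < x] contributes at most [x] times the
    increment of [t |-> min(x, t)^(p-1)] from [l/2] to [l]. As the levels double, these increments
    telescope to at most [x^(p-1)]. *)
Lemma dyadic_sum_le n x : 0 <= x -> c * dyadic_sum n x <= x `^ p.
Proof.
move=> x0; rewrite /dyadic_sum.
have pm1 : 0 <= p - 1 by rewrite subr_ge0 ltW.
pose m (t : R) := (Num.min x t) `^ (p - 1).
have m_mono s t : 0 <= s -> s <= t -> m s <= m t.
  move=> s0 st; have mst : Num.min x s <= Num.min x t.
    by rewrite le_min !ge_min lexx/= st orbT.
  have ms0 : 0 <= Num.min x s by rewrite le_min x0.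
  by apply: ge0_ler_powR; rewrite ?nnegrE// (le_trans ms0).
have step n' i : c * (w n' i * excess (l n' i) x) <=
    x * (m (l n' i) - m (l n' i / 2)).
  have l0 := l_gt0 n' i.
  have [xl|lx] := leP x (l n' i).
    rewrite excess_small// !mulr0 mulr_ge0// subr_ge0 m_mono//; lra.
  have -> : m (l n' i) - m (l n' i / 2) = c * w n' i.
    rewrite /m !(min_idPr _); [|lra|exact: ltW].
    by rewrite powRM//; [rewrite /c /w; lra|exact: ltW].
  rewrite mulrA (mulrC x) ler_wpM2l// ?excess_le//; last exact: ltW.
  by rewrite mulr_ge0 ?powR_ge0// ltW// dyadic_const_gt0.
suff : c * \sum_(i < n + n) w n i * excess (l n i) x <=
    x * (m (l n (n + n) / 2) - m (l n 0 / 2)).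
  move/le_trans; apply; rewrite -[leRHS]mulr_powRB1//; last exact: lt_trans p1.
  rewrite ler_wpM2l// lerBlDr ler_wpDr ?powR_ge0// /m.
  rewrite ge0_ler_powR ?nnegrE// ?le_min ?x0 ?divr_ge0 ?(ltW (l_gt0 _ _))//.
  by rewrite ge_min lexx.
elim: (n + n)%N => [|k ih]; first by rewrite big_ord0 mulr0 subrr mulr0.
rewrite big_ord_recr/= mulrDr.
have -> : l n k.+1 / 2 = l n k by rewrite lS mulrC mulKf.
have := step n k; lra.
Qed.

(** A single level is enough: if [2 l <= x < 4 l], the excess is at least [x / 2] and the weight at
    least [(x / 4)^(p-1)]. Large [n] guarantees that the grid contains such a level; it is the first
    one with [x < 4 l]. *)
Lemma dyadic_sum_ge x : 0 < x -> exists K, forall n, (K <= n)%N ->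
  (x / 2) * (x / 4) `^ (p - 1) <= dyadic_sum n x.
Proof.
move=> x0.
have [K1 hK1] := half_small (divr_gt0 x0 (ltr0n _ 2)).
have x10 : 0 < x^-1 by rewrite invr_gt0.
have [K2 hK2] := half_small x10.
exists (maxn K1 K2).+1 => n; case: n => // n.
rewrite ltnS geq_max => /andP[K1n K2n].
have xlo : 2 * l n.+1 0 <= x.
  rewrite /l expr0 mulr1 exprS mulVKf//.
  have := half_mono K1n (R := R); have := half_gt0 n (R := R); lra.
have xhi : x < 4 * l n.+1 (n + n.+1).
  have -> : 4 * l n.+1 (n + n.+1) = 4 * 2 ^+ n.
    by congr (_ * _); rewrite /l exprD exprVn mulrCA mulVf ?mulr1// expf_neq0.
  have h1 : (2^-1 ^+ n : R) < x^-1 by exact: le_lt_trans (half_mono K2n) hK2.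
  have : x < 2 ^+ n.
    by rewrite -ltf_pV2 ?posrE ?exprn_gt0// -exprVn.
  have : 0 < 2 ^+ n :> R by rewrite exprn_gt0.
  lra.
have ex_i : exists i, x < 4 * l n.+1 i by exists (n + n.+1)%N.
pose i := ex_minn ex_i.
have [xi imin] : x < 4 * l n.+1 i /\ forall j, x < 4 * l n.+1 j -> (i <= j)%N.
  by rewrite /i; case: ex_minnP.
have ilt : (i < n.+1 + n.+1)%N by rewrite addSn ltnS; exact: imin.
have xlo' : 2 * l n.+1 i <= x.
  case: (i) imin => [//|j] jmin; rewrite lS.
  have : ~ (x < 4 * l n.+1 j) by move=> /jmin; rewrite ltnn.
  by move=> /negP; rewrite -leNgt; lra.
rewrite /dyadic_sum (bigD1 (Ordinal ilt))//= ler_wpDr//.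
  by apply: sumr_ge0 => j _; rewrite mulr_ge0 ?powR_ge0 ?excess_ge0.
have li := l_gt0 n.+1 i.
rewrite mulrC; apply: ler_pM; rewrite ?powR_ge0 ?divr_ge0 ?(ltW x0)//.
  by apply: ge0_ler_powR; rewrite ?nnegrE ?subr_ge0 ?(ltW p1)//; lra.
by rewrite excess_max; case: (ltP (x - l n.+1 i) 0) => ?; lra.
Qed.

End dyadic.
End excess.

Section cclip.
Context {R : realType}.
Implicit Types (c : R) (w : R[i]).

(** Radial truncation to the disc of radius [c]; at [w = 0] the quotient is immaterial, being
    multiplied by 0. *)
Definition cclip c w : R[i] := (Num.min c (cnorm w) / cnorm w)%:C%C * w.

Lemma cnorm_cclip c w : 0 <= c -> cnorm (cclip c w) = Num.min c (cnorm w).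
Proof.
move=> c0; rewrite /cclip cnormM cnorm_real.
have m0 : 0 <= Num.min c (cnorm w) by rewrite le_min c0 cnorm_ge0.
rewrite ger0_norm ?divr_ge0 ?cnorm_ge0//.
have [->|w0] := eqVneq w 0; first by rewrite cnorm0 !mulr0 (min_idPr _).
by rewrite divfK// cnorm_eq0.
Qed.

Lemma cnorm_sub_cclip c w : 0 <= c -> cnorm (w - cclip c w) = excess c (cnorm w).
Proof.
move=> c0; rewrite /cclip /excess.
have [->|w0] := eqVneq w 0.
  by rewrite mulr0 subrr cnorm0 (min_idPr _)// subrr.
have w1 : 0 < cnorm w by rewrite lt_neqAle cnorm_ge0 eq_sym cnorm_eq0 w0.
set s := _ / _.
have -> : w - s%:C%C * w = (1 - s)%:C%C * w.
  by rewrite rmorphB/= rmorph1 mulrBl mul1r.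
have s1 : s <= 1 by rewrite ler_pdivrMr// mul1r ge_min lexx orbT.
rewrite cnormM cnorm_real ger0_norm ?subr_ge0// mulrBl mul1r divfK//.
by rewrite gt_eqF.
Qed.

Lemma measurable_cclip d (T : measurableType d) (D : set T) (c : T -> R) (f : T -> R[i]) :
  measurable_fun D c -> cmeasurable D f ->
  cmeasurable D (fun x => cclip (c x) (f x)).
Proof.
move=> mc mf; apply: cmeasurableM => //; apply: cmeasurable_real.
have mcf := measurable_cnorm mf.
apply: measurable_funM; first exact: measurable_minr.
under eq_fun do rewrite -powR_inv1 ?cnorm_ge0//.
exact: (@measurableT_comp _ _ _ _ _ _ (fun x : R => x `^ (-1))).
Qed.

End cclip.

Section excess_domination.
Context {d : measure_display} {T : measurableType d} {R : realType}.
Variable mu : {measure set T -> \bar R}.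
Implicit Types (u v : T -> R[i]) (p : R).

Definition eint (l : R) u : \bar R := (\int[mu]_x (excess l (cnorm (u x)))%:E)%E.

Lemma measurable_excess_cnorm (l : R) u : cmeasurable setT u ->
  measurable_fun setT (fun x => (excess l (cnorm (u x)))%:E).
Proof.
move=> mu_; apply/measurable_EFinP.
apply: (@measurableT_comp _ _ _ _ _ _ (excess l)).
  exact: measurable_excess.
exact: measurable_cnorm.
Qed.

Lemma le_limn_einf_near (a : \bar R) (F : nat -> \bar R) (K : nat) :
  (forall n, (K <= n)%N -> (a <= F n)%E) -> (a <= limn_einf F)%E.
Proof.
move=> aF; rewrite limn_einf_lim; apply: lime_ge; first exact: is_cvg_einfs.
exists K => // n /= Kn; apply: le_ereal_inf_tmp => _ /= [k /= nk <-].
by apply: aF; exact: leq_trans nk.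
Qed.

(** Both p-th powers are compared with [dyadic_sum], whose integral is a positive combination of the
    [eint l]. The lower bound on [dyadic_sum] holds only for [n] large depending on the point, hence
    Fatou. *)
Lemma pint_le_of_eint p : 1 < p -> exists2 K : R, 0 < K &
  forall u v, cmeasurable setT u -> cmeasurable setT v ->
  (forall l, 0 < l -> (eint l u <= eint l v)%E) ->
  (pint mu p u <= K%:E * pint mu p v)%E.
Proof.
move=> p1; have p0 : 0 < p by exact: lt_trans p1.
set c : R := 1 - 2^-1 `^ (p - 1).
have c0 : 0 < c by exact: dyadic_const_gt0.
(* So that [a * x^p = (x / 2) * (x / 4)^(p-1)], the bound of [dyadic_sum_ge]. *)
set a : R := 2^-1 * 4^-1 `^ (p - 1).
have a0 : 0 < a by rewrite mulr_gt0 ?invr_gt0// powR_gt0// invr_gt0.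
exists (a^-1 * c^-1); first by rewrite mulr_gt0 ?invr_gt0.
move=> u v mu_ mv uv.
have mS (f : T -> R[i]) n : cmeasurable setT f ->
    measurable_fun setT (fun x => (dyadic_sum p n (cnorm (f x)))%:E).
  move=> mf; rewrite /dyadic_sum; apply/measurable_EFinP.
  apply: measurable_sum => i; apply: measurable_funM; first exact: measurable_cst.
  exact/measurable_EFinP/measurable_excess_cnorm.
have S0 n x : 0 <= dyadic_sum p n x.
  by apply: sumr_ge0 => i _; rewrite mulr_ge0 ?powR_ge0// excess_ge0.
have intS (f : T -> R[i]) n : cmeasurable setT f ->
    (\int[mu]_x (dyadic_sum p n (cnorm (f x)))%:E = \sum_(i < n + n)
      ((2^-1 ^+ n * 2 ^+ i) `^ (p - 1))%:E * eint (2^-1 ^+ n * 2 ^+ i) f)%E.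
  move=> mf; rewrite /dyadic_sum.
  under eq_integral do rewrite -sumEFin.
  rewrite ge0_integral_sum//.
  - apply: eq_bigr => i _; rewrite /eint -ge0_integralZl_EFin//.
    + by move=> x _; rewrite lee_fin excess_ge0.
    + exact: measurable_excess_cnorm.
  - move=> i; apply/measurable_EFinP; apply: measurable_funM; first exact: measurable_cst.
    exact/measurable_EFinP/measurable_excess_cnorm.
  - by move=> i x _; rewrite lee_fin mulr_ge0 ?powR_ge0// excess_ge0.
have bound n : (\int[mu]_x (dyadic_sum p n (cnorm (u x)))%:E <=
    (c^-1)%:E * pint mu p v)%E.
  apply: (@le_trans _ _ (\int[mu]_x (dyadic_sum p n (cnorm (v x)))%:E)%E).
    rewrite !intS//; apply: lee_sum => i _; rewrite lee_wpmul2l//.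
    by apply: uv; rewrite mulr_gt0 ?exprn_gt0// invr_gt0.
  rewrite /pint -ge0_integralZl_EFin//; last 3 first.
  - by move=> x _; rewrite lee_fin powR_ge0.
  - exact: measurable_cnorm_pow.
  - by rewrite invr_ge0 ltW.
  apply: ge0_le_integral => //; first by move=> x _; rewrite lee_fin.
  - exact: mS.
  - apply: measurable_funeM; exact: measurable_cnorm_pow.
  move=> x _; rewrite -EFinM lee_fin -ler_pdivrMl ?invr_gt0// invrK.
  exact: dyadic_sum_le (cnorm_ge0 _).
rewrite EFinM -muleA -lee_pdivrMl ?invr_gt0// invrK.
have -> : (a%:E * pint mu p u = \int[mu]_x (a * (cnorm (u x)) `^ p)%:E)%E.
  rewrite /pint -ge0_integralZl_EFin//.
  - by move=> x _; rewrite lee_fin powR_ge0.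
  - exact: measurable_cnorm_pow.
  - exact: ltW.
have bound' : (limn_einf (fun n =>
    \int[mu]_x (dyadic_sum p n (cnorm (u x)))%:E) <= (c^-1)%:E * pint mu p v)%E.
  rewrite limn_einf_lim; apply: lime_le; first exact: is_cvg_einfs.
  apply: nearW => n; apply: le_trans (bound n).
  by apply: ereal_inf_lbound => /=; exists n => /=.
apply: le_trans bound'.
have F0 n x : [set: T] x -> (0 <= (dyadic_sum p n (cnorm (u x)))%:E)%E.
  by rewrite lee_fin.
apply: le_trans (fatou mu measurableT (fun n => mS u n mu_) F0).
apply: ge0_le_integral => //.
- by move=> x _; rewrite lee_fin mulr_ge0 ?powR_ge0// ltW.
- under eq_fun do rewrite EFinM.
  by apply: measurable_funeM; exact: measurable_cnorm_pow.
- pose F n x := (dyadic_sum p n (cnorm (u x)))%:E.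
  have -> : (fun x => limn_einf (F ^~ x)) =
      (fun x => - limn_esup (fun n => - F n x))%E.
    apply/funext => x; rewrite -limn_einfN; congr limn_einf.
    by apply/funext => n; rewrite /comp oppeK.
  apply: measurableT_comp => //.
  apply: (@measurable_fun_limn_esup _ _ _ _ (fun n x => - F n x)%E) => n.
  by apply: measurableT_comp => //; exact: mS.
move=> x _; have [u0|u0] := eqVneq (u x) 0.
  rewrite u0 cnorm0 powR0 ?gt_eqF// mulr0.
  by apply: (@le_limn_einf_near _ _ 0) => n _; rewrite lee_fin.
have ux : 0 < cnorm (u x) by rewrite lt_neqAle eq_sym cnorm_eq0 u0 cnorm_ge0.
have [K KP] := dyadic_sum_ge p1 ux.
apply: (@le_limn_einf_near _ _ K) => n /KP; rewrite lee_fin; apply: le_trans.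
rewrite -[X in _ * X]mulr_powRB1 ?(ltW ux)// powRM ?(ltW ux)// /a.
rewrite le_eqVlt; apply/orP; left; apply/eqP; ring.
Qed.

(* The grid of mesh [h] gives the exact constant [1], at the price of an error
   [h] times the L^1 norm. *)
Lemma pint2_le_of_eint (B : R) u v : 0 <= B ->
  cmeasurable setT u -> cLp mu 1%E v ->
  {ae mu, forall x, cnorm (u x) <= B} ->
  (cLnorm mu 1%E u <= cLnorm mu 1%E v)%E ->
  (forall l, 0 < l -> (eint l u <= eint l v)%E) ->
  (pint mu 2 u <= pint mu 2 v)%E.
Proof.
move=> B0 mu_ [mv lv] uB uv1 uv.
have sq (f : T -> R[i]) : pint mu 2 f = (\int[mu]_x ((cnorm (f x)) ^+ 2)%:E)%E.
  by apply: eq_integral => x _; rewrite powR_mulrn ?cnorm_ge0.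
rewrite !sq.
pose M := fine (cLnorm mu 1%E v).
have ME : cLnorm mu 1%E v = M%:E by rewrite /M fineK// ge0_fin_numE// cLnorm_ge0.
have M0 : 0 <= M by rewrite fine_ge0// cLnorm_ge0.
apply/lee_addgt0Pr => e e0.
(* The error [h] times the L^1 norm of [u] is at most [h * M <= e]. *)
pose h := e / (M + 1); have M1 : 0 < M + 1 by rewrite ltr_wpDl.
have h0 : 0 < h by rewrite divr_gt0.
(* The [n] levels reach the bound [B] of [u], so no part of [u] lies above the grid. *)
pose n := Num.bound (B / h).
have Bn : B <= n%:R * h.
  by rewrite -ler_pdivrMr// ltW// archi_boundP// divr_ge0// ltW.
pose S (f : T -> R[i]) x := \sum_(k < n) (2 * h * excess (k.+1%:R * h) (cnorm (f x))).
have mS f : cmeasurable setT f -> measurable_fun setT (fun x => (S f x)%:E).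
  move=> mf; apply/measurable_EFinP.
  apply: measurable_sum => i; apply: measurable_funM; first exact: measurable_cst.
  exact/measurable_EFinP/measurable_excess_cnorm.
have h20 : 0 <= 2 * h by rewrite mulr_ge0// ltW.
have S0 f x : 0 <= S f x.
  by apply: sumr_ge0 => i _; rewrite mulr_ge0// excess_ge0.
have intS (f : T -> R[i]) : cmeasurable setT f ->
    (\int[mu]_x (S f x)%:E = \sum_(k < n)
      (2 * h)%:E * eint (k.+1%:R * h) f)%E.
  move=> mf; rewrite /S.
  under eq_integral do rewrite -sumEFin.
  rewrite ge0_integral_sum//.
  - apply: eq_bigr => i _; rewrite /eint -ge0_integralZl_EFin//.
    + by move=> x _; rewrite lee_fin excess_ge0.
    + exact: measurable_excess_cnorm.
  - move=> i; apply/measurable_EFinP; apply: measurable_funM; first exact: measurable_cst.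
    exact/measurable_EFinP/measurable_excess_cnorm.
  - by move=> i x _; rewrite lee_fin mulr_ge0// excess_ge0.
have msq f : cmeasurable setT f -> measurable_fun setT (fun x => ((cnorm (f x)) ^+ 2)%:E).
  move=> mf; apply/measurable_EFinP; apply: measurable_funX.
  exact: measurable_cnorm.
apply: (@le_trans _ _ (\int[mu]_x (S u x + h * cnorm (u x))%:E)%E).
  apply: ae_ge0_le_integral => //.
  - by move=> x _; rewrite lee_fin sqr_ge0.
  - exact: msq.
  - by move=> x _; rewrite lee_fin addr_ge0// mulr_ge0 ?cnorm_ge0// ltW.
  - apply/measurable_EFinP; apply: measurable_funD; first exact/measurable_EFinP/mS.
    by apply: measurable_funM => //; exact: measurable_cnorm.
  apply: filterS uB => x uxB _; rewrite lee_fin.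
  by apply: (sqr_excess_sum n h0 (cnorm_ge0 (u x))).2; exact: le_trans Bn.
under eq_integral do rewrite EFinD.
rewrite ge0_integralD//; last 4 first.
- by move=> x _; rewrite lee_fin.
- exact: mS.
- by move=> x _; rewrite lee_fin mulr_ge0 ?cnorm_ge0// ltW.
- apply/measurable_EFinP; apply: measurable_funM => //.
  exact: measurable_cnorm.
apply: leeD.
  apply: (@le_trans _ _ (\int[mu]_x (S v x)%:E)%E).
    rewrite !intS//; apply: lee_sum => i _; rewrite lee_wpmul2l//.
    by apply: uv; rewrite mulr_gt0.
  apply: ge0_le_integral => //; first by move=> x _; rewrite lee_fin.
  - exact: mS.
  - exact: msq.
  by move=> x _; rewrite lee_fin; exact: (sqr_excess_sum n h0 (cnorm_ge0 (v x))).1.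
under eq_integral do rewrite EFinM.
rewrite ge0_integralZl_EFin//; last 3 first.
- by move=> x _; rewrite lee_fin cnorm_ge0.
- exact: measurable_cnormE.
- exact: ltW.
rewrite -cLnorm1E; apply: (@le_trans _ _ (h%:E * M%:E)%E).
  by rewrite lee_wpmul2l ?lee_fin ?(ltW h0)// -ME.
rewrite -EFinM lee_fin /h mulrAC ler_pdivrMr// ler_wpM2l ?lerDl//.
exact: ltW.
Qed.

End excess_domination.

(** * Bounds for one Dunford-Schwartz operator *)

Section operators.
Context {d : measure_display} {T : measurableType d} {R : realType}.
Variable mu : {measure set T -> \bar R}.
Hypothesis mu0 : (0 < mu setT)%E.
Implicit Types (f g h : T -> R[i]) (p l : R).

Local Notation N p f := (cLnorm mu p f).

Lemma cLp_oo f (B : R) : cmeasurable setT f ->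
  {ae mu, forall x, cnorm (f x) <= B} -> cLp mu +oo%E f.
Proof. by move=> mf fB; apply/cLpooP => //; split => //; exists B. Qed.

Lemma cmeasurable_cclip l f : cmeasurable setT f ->
  cmeasurable setT (fun x => cclip l (f x)).
Proof. by move=> mf; apply: measurable_cclip. Qed.

Lemma cLp_cclip p l f : 1 <= p -> 0 <= l -> cLp mu p%:E f ->
  cLp mu p%:E (fun x => cclip l (f x)).
Proof.
move=> p1 l0 [mf lf]; apply: (@cLp_dom _ _ _ _ _ _ f) => //.
- exact: le_trans p1.
- exact: cmeasurable_cclip.
- by apply: aeW => x; rewrite cnorm_cclip// ge_min lexx orbT.
Qed.

Lemma cnorm1_excess p l f : 1 <= p -> 0 < l -> cmeasurable setT f ->
  ((l `^ (p - 1))%:E * N 1%E (fun x => (f x - cclip l (f x))%R) <= pint mu p f)%E.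
Proof.
move=> p1 l0 mf.
have mg : cmeasurable setT (fun x => f x - cclip l (f x)).
  by apply: cmeasurableB => //; exact: cmeasurable_cclip.
rewrite cLnorm1E -ge0_integralZl_EFin ?powR_ge0//; last 2 first.
- by move=> x _; rewrite lee_fin cnorm_ge0.
- exact: measurable_cnormE.
apply: ge0_le_integral => //.
- by move=> x _; rewrite -EFinM lee_fin mulr_ge0 ?powR_ge0 ?cnorm_ge0.
- by apply: measurable_funeM; exact: measurable_cnormE.
- exact: measurable_cnorm_pow.
move=> x _; rewrite -EFinM lee_fin (cnorm_sub_cclip _ (ltW l0)).
by rewrite excess_pow// cnorm_ge0.
Qed.

Lemma cLp1_excess p l f : 1 <= p -> 0 < l -> cLp mu p%:E f ->
  cLp mu 1%E (fun x => f x - cclip l (f x)).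
Proof.
move=> p1 l0 [mf lf]; split.
  by apply: cmeasurableB => //; exact: cmeasurable_cclip.
have lp : 0 < l `^ (p - 1) by exact: powR_gt0.
have : ((l `^ (p - 1))%:E * N 1%E (fun x => (f x - cclip l (f x))%R) < +oo)%E.
  apply: le_lt_trans (cnorm1_excess p1 l0 mf) _.
  by rewrite pint_lty ?gt_eqF// (lt_le_trans _ p1).
by rewrite !ltey; apply: contra => /eqP ->; rewrite gt0_muley// lte_fin.
Qed.

Lemma cL1Loo_cLp p f : 1 <= p -> cLp mu p%:E f -> cL1Loo mu f.
Proof.
move=> p1 lf; exists (fun x => f x - cclip 1 (f x)), (fun x => cclip 1 (f x)).
split; [exact: cLp1_excess p1 _ lf| |by move=> x; rewrite subrK].
apply: (@cLp_oo _ 1); first by apply: cmeasurable_cclip; case: lf.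
by apply: aeW => x; rewrite cnorm_cclip// ge_min lexx.
Qed.

Lemma cL1Loo_oo f : cLp mu +oo%E f -> cL1Loo mu f.
Proof.
move=> lf; exists (fun=> 0), f; split => //; last by move=> x; rewrite add0r.
exact: cLp0.
Qed.

Lemma cL1Loo_linear (a : R[i]) f g : cL1Loo mu f -> cL1Loo mu g ->
  cL1Loo mu (fun x => a * f x + g x).
Proof.
move=> [f1 [f2 [lf1 lf2 fE]]] [g1 [g2 [lg1 lg2 gE]]].
exists (fun x => a * f1 x + g1 x), (fun x => a * f2 x + g2 x); split.
- by apply: cLpD => //; exact: cLpZ.
- move/(cLpooP mu0) : lf2 => [mf2 [B1 fB]].
  move/(cLpooP mu0) : lg2 => [mg2 [B2 gB]].
  apply: (@cLp_oo _ (cnorm a * B1 + B2)).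
    by apply: cmeasurableD => //; exact: cmeasurableZ.
  apply: filterS2 fB gB => x fB gB; apply: le_trans (cnormD _ _) _.
  by rewrite lerD// cnormM ler_wpM2l// cnorm_ge0.
- by move=> x; rewrite fE gE; ring.
Qed.

Lemma cL1Loo_measurable f : cL1Loo mu f -> cmeasurable setT f.
Proof.
move=> [f1 [f2 [[mf1 _] [mf2 _] fE]]]; have -> : f = fun x => f1 x + f2 x.
  exact/funext.
exact: cmeasurableD.
Qed.

Lemma cL1Loo0 : cL1Loo mu (fun=> 0).
Proof. by apply: (@cL1Loo_cLp 1) => //; exact: cLp0. Qed.

Section one_operator.
Variable A : (T -> R[i]) -> T -> R[i].
Hypothesis dsA : dunford_schwartz mu A.
Hypothesis dxA : ds_extended mu A.

Lemma op_measurable f : cL1Loo mu f -> cmeasurable setT (A f).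
Proof. by move=> /(dse_L1Loo dxA); exact: cL1Loo_measurable. Qed.

Lemma op0 : A (fun=> 0) = (fun=> 0) %[ae mu].
Proof.
have := dse_linear dxA 1 cL1Loo0 cL1Loo0.
rewrite [X in A X](_ : _ = fun=> 0); last by apply/funext => x; rewrite mulr0 addr0.
apply: filterS => x /[apply]; rewrite mul1r => /eqP.
by rewrite -subr_eq0 opprD addrA subrr add0r oppr_eq0 => /eqP.
Qed.

Lemma cL1Loo_sum (n : nat) (c : 'I_n -> R[i]) (F : 'I_n -> T -> R[i]) :
  (forall i, cL1Loo mu (F i)) -> cL1Loo mu (fun x => \sum_i c i * F i x).
Proof.
elim: n c F => [|n ih] c F lF.
  by under eq_fun do rewrite big_ord0; exact: cL1Loo0.
under eq_fun do rewrite big_ord_recl.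
by apply: cL1Loo_linear => //; exact: ih.
Qed.

Lemma op_sum (n : nat) (c : 'I_n -> R[i]) (F : 'I_n -> T -> R[i]) :
  (forall i, cL1Loo mu (F i)) ->
  A (fun x => \sum_i c i * F i x) = (fun x => \sum_i c i * A (F i) x) %[ae mu].
Proof.
elim: n c F => [|n ih] c F lF.
  have -> : (fun x => \sum_(i < 0) c i * F i x) = fun=> 0.
    by apply/funext => x; rewrite big_ord0.
  by have := op0; apply: filterS => x h xT; rewrite h// big_ord0.
have -> : (fun x => \sum_i c i * F i x) = fun x => c ord0 * F ord0 x +
    \sum_i c (lift ord0 i) * F (lift ord0 i) x.
  by apply/funext => x; rewrite big_ord_recl.
have := dse_linear dxA (c ord0) (lF ord0)
  (cL1Loo_sum (fun i => c (lift ord0 i)) (fun i => lF (lift ord0 i))).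
have := ih (fun i => c (lift ord0 i)) _ (fun i => lF (lift ord0 i)).
by apply: filterS2 => x h1 h2 xT; rewrite h2// h1// big_ord_recl.
Qed.

Lemma opD f g : cL1Loo mu f -> cL1Loo mu g ->
  A (fun x => f x + g x) = (fun x => A f x + A g x) %[ae mu].
Proof.
move=> lf lg; have := dse_linear dxA 1 lf lg.
rewrite [X in A X](_ : _ = fun x => f x + g x); last first.
  by apply/funext => x; rewrite mul1r.
by apply: filterS => x /[apply]; rewrite mul1r.
Qed.

Lemma opZ (a : R[i]) f : cL1Loo mu f ->
  A (fun x => a * f x) = (fun x => a * A f x) %[ae mu].
Proof.
move=> lf; have := dse_linear dxA a lf cL1Loo0.
rewrite [X in A X](_ : _ = fun x => a * f x); last first.
  by apply/funext => x; rewrite addr0.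
move=> h; have h0 := op0; apply: filterS2 h h0 => x h h0 xT.
by rewrite h// h0// addr0.
Qed.

Lemma opB f g : cL1Loo mu f -> cL1Loo mu g ->
  A (fun x => f x - g x) = (fun x => A f x - A g x) %[ae mu].
Proof.
move=> lf lg; have := dse_linear dxA (-1) lg lf.
rewrite [X in A X](_ : _ = fun x => f x - g x); last first.
  by apply/funext => x; ring.
by apply: filterS => x /[apply] ->; ring.
Qed.

Lemma op_oo f (B : R) : cmeasurable setT f ->
  {ae mu, forall x, cnorm (f x) <= B} -> {ae mu, forall x, cnorm (A f x) <= B}.
Proof.
move=> mf fB; apply/cLnormooP => //.
apply: le_trans (dse_contractoo dxA _) _; first exact: cLp_oo fB.
exact/cLnormooP.
Qed.

(** Split [f = g + h] with [h] the truncation at [l]. Since [|A h| <= l], the excess of [|A f|] over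
    [l] is at most [|A g|], and the L^1 norm of [A g] is at most that of [g], which is the integral
    of the excess of [|f|]. *)
Lemma op_excess p l f : 1 <= p -> 0 < l -> cLp mu p%:E f ->
  (eint mu l (A f) <= eint mu l f)%E.
Proof.
move=> p1 l0 lf; have [mf _] := lf.
set g := fun x => f x - cclip l (f x); pose h x := cclip l (f x).
have lg : cLp mu 1%E g by exact: cLp1_excess lf.
have mh : cmeasurable setT h by exact: cmeasurable_cclip.
have hl : {ae mu, forall x, cnorm (h x) <= l}.
  by apply: aeW => x; rewrite (cnorm_cclip _ (ltW l0)) ge_min lexx.
have lh := cLp_oo mh hl.
have fE : f = fun x => g x + h x by apply/funext => x; rewrite subrK.
have Af : A f = (fun x => A g x + A h x) %[ae mu].
  have := opD (@cL1Loo_cLp 1 _ (lexx 1) lg) (cL1Loo_oo lh).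
  by rewrite -fE.
have lAg := ds_L1 dsA lg.
apply: (@le_trans _ _ (N 1%E (A g))).
  rewrite cLnorm1E; apply: ae_ge0_le_integral => //.
  - by move=> x _; rewrite lee_fin excess_ge0.
  - apply: measurable_excess_cnorm; apply: op_measurable.
    exact: cL1Loo_cLp lf.
  - by move=> x _; rewrite lee_fin cnorm_ge0.
  - by apply: measurable_cnormE; case: lAg.
  have Ahl := op_oo mh hl.
  apply: filterS2 Af Ahl => x Af Ahl _; rewrite lee_fin Af//.
  apply: le_trans (excess_mono _ (cnormD _ _)) _; rewrite addrC.
  apply: le_trans (excess_addl _ _ (cnorm_ge0 _)) _.
  by rewrite excess_small// add0r.
apply: le_trans (ds_contract1 dsA lg) _.
rewrite cLnorm1E /eint; apply: ge0_le_integral => //.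
- by move=> x _; rewrite lee_fin cnorm_ge0.
- by apply: measurable_cnormE; case: lg.
- exact: measurable_excess_cnorm.
by move=> x _; rewrite lee_fin (cnorm_sub_cclip _ (ltW l0)).
Qed.

(** Here the constant is exactly 1, as the Hilbert space argument for the discrete averages
    requires. *)
Lemma op_contract2 f (B : R) : 0 <= B -> cLp mu 1%E f ->
  {ae mu, forall x, cnorm (f x) <= B} -> (pint mu 2 (A f) <= pint mu 2 f)%E.
Proof.
move=> B0 lf fB; apply: (pint2_le_of_eint B0) => //.
- by apply: op_measurable; exact: (@cL1Loo_cLp 1).
- by apply: op_oo fB; case: lf.
- exact: ds_contract1.
- by move=> l l0; exact: (@op_excess 1).
Qed.

End one_operator.

(** The constant is chosen before the operator, hence uniform along a semigroup. The case [p = 1] is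
    separate because [1 - 2^-(p-1)] vanishes there. *)
Lemma op_bounded p : 1 <= p -> exists2 K : R, 0 < K &
  forall A, dunford_schwartz mu A -> ds_extended mu A ->
  forall f, cLp mu p%:E f ->
    cLp mu p%:E (A f) /\ (N p%:E (A f) <= K%:E * N p%:E f)%E.
Proof.
rewrite le_eqVlt => /predU1P[<-|p1].
  exists 1 => // A dsA dxA f lf; split; first exact: (ds_L1 dsA).
  by rewrite mul1e; exact: ds_contract1.
have p0 : 0 < p by exact: lt_trans p1.
have [K K0 KP] := pint_le_of_eint mu p1.
exists (K `^ p^-1); first exact: powR_gt0.
move=> A dsA dxA f lf.
have [mf _] := lf; have mAf : cmeasurable setT (A f).
  by apply: (op_measurable dxA); exact: cL1Loo_cLp (ltW p1) lf.
have h := KP _ _ mAf mf (fun l (l0 : 0 < l) => op_excess dsA dxA (ltW p1) l0 lf).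
have h2 : (N p%:E (A f) <= (K `^ p^-1)%:E * N p%:E f)%E.
  rewrite !cLnormE -poweR_EFin -poweRM ?lee_fin ?(ltW K0) ?pint_ge0//.
  rewrite gt0_ler_poweR ?invr_ge0 ?(ltW p0)//.
  - by rewrite in_itv/= pint_ge0 leey.
  - by rewrite in_itv/= mule_ge0 ?pint_ge0 ?leey// lee_fin ltW.
split => //; split => //; apply: le_lt_trans h2 _.
by rewrite lte_mul_pinfty// ?lee_fin ?powR_ge0//; case: lf.
Qed.

End operators.

(** * Density and strong continuity in L^p *)

Section ereal_cvg0.
Context {R : realType} {I : Type} {F : set_system I} {FF : Filter F}.

Lemma ecvg0P (u : I -> \bar R) : (forall i, (0 <= u i)%E) ->
  (u @ F --> 0%E) <-> (forall e : R, 0 < e -> \forall i \near F, (u i <= e%:E)%E).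
Proof.
move=> u0; split.
  move/fine_cvgP => [ufin] /cvgrPdist_lt uc e e0; near=> i.
  have ui : u i \is a fin_num by near: i.
  rewrite -[u i]fineK// lee_fin ltW// -[fine _]ger0_norm ?fine_ge0//.
  rewrite -normrN -[- _]sub0r; near: i; exact: uc.
move=> h; apply/fine_cvgP; split.
  apply: filterS (h 1 ltr01) => i ui1.
  by rewrite ge0_fin_numE// (le_lt_trans ui1)// ltry.
apply/cvgr0Pnorm_le => e e0; apply: filterS (h e e0) => i uie.
rewrite /= ger0_norm ?fine_ge0// -lee_fin fineK//.
by rewrite ge0_fin_numE// (le_lt_trans uie)// ltry.
Unshelve. all: by end_near. Qed.

End ereal_cvg0.

Lemma ecvgn0P {R : realType} (u : nat -> \bar R) : (forall i, (0 <= u i)%E) ->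
  (u @ \oo --> 0%E) <->
  (forall e : R, 0 < e -> exists K, forall n, (K <= n)%N -> (u n <= e%:E)%E).
Proof.
move=> u0; split.
  by move/ecvg0P => /(_ u0) h e e0; have [K _ KP] := h e e0; exists K.
move=> h; apply/ecvg0P => // e e0; have [K KP] := h e e0.
by exists K => // n /= /KP.
Qed.

Section density.
Context {d : measure_display} {T : measurableType d} {R : realType}.
Variable mu : {measure set T -> \bar R}.
Implicit Types (f g h : T -> R[i]) (p l : R).

Local Notation N p f := (cLnorm mu p f).

Lemma cLnorm_le_of_pint p f (e : R) : 0 < p -> 0 <= e ->
  (pint mu p f <= (e `^ p)%:E)%E -> (N p%:E f <= e%:E)%E.
Proof.
move=> p0 e0 h; rewrite cLnormE.
apply: (@le_trans _ _ ((e `^ p)%:E `^ p^-1)%E); last first.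
  by rewrite poweR_EFin -powRrM mulfV ?gt_eqF// powRr1.
rewrite gt0_ler_poweR ?invr_ge0 ?(ltW p0)//.
- by rewrite in_itv/= pint_ge0 leey.
- by rewrite in_itv/= leey lee_fin powR_ge0.
Qed.

(** Restrict [f] to the set where [2^-n < |f| <= n]. The upper cut makes it bounded; the lower cut
    makes it integrable, since there [|f|] is at most [|f|^p] divided by [(2^-n)^(p-1)]. *)
Lemma dense_L1_bounded p f (e : R) : 1 <= p -> 0 < e -> cLp mu p%:E f ->
  exists g (B : R), [/\ cLp mu 1%E g, 0 <= B, forall x, cnorm (g x) <= B &
    (N p%:E (fun x => (f x - g x)%R) <= e%:E)%E].
Proof.
move=> p1 e0 lf; have [mf _] := lf; have p0 : 0 < p by exact: lt_le_trans p1.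
pose A (n : nat) := [set x | 2^-1 ^+ n < cnorm (f x)] `&`
  ~` [set x | n%:R < cnorm (f x)].
have mA n : measurable (A n).
  apply: measurableI; first exact: measurable_cnorm_gt.
  by apply: measurableC; exact: measurable_cnorm_gt.
pose g n x := f x * (\1_(A n) x : R)%:C%C.
have mg n : cmeasurable setT (g n).
  by apply: cmeasurableM => //; apply: cmeasurable_real; exact: measurable_indic.
have gA n x : A n x -> g n x = f x by move=> Ax; rewrite /g indicE mem_set//= mulr1.
have gNA n x : ~ A n x -> g n x = 0 by move=> Ax; rewrite /g indicE memNset//= mulr0.
have gle n x : cnorm (f x - g n x) <= cnorm (f x).
  have [Ax|Ax] := pselect (A n x); first by rewrite gA// subrr cnorm0 cnorm_ge0.
  by rewrite gNA// subr0.
have gn n x : cnorm (g n x) <= n%:R.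
  have [Ax|Ax] := pselect (A n x); last by rewrite gNA// cnorm0.
  by rewrite gA//; case: Ax => _ /negP; rewrite -leNgt.
have gL1 n : cLp mu 1%E (g n).
  split => //; have hn0 := half_gt0 n (R := R).
  have lp : 0 < (2^-1 ^+ n) `^ (p - 1) :> R by exact: powR_gt0.
  have : (((2^-1 ^+ n) `^ (p - 1))%:E * N 1%E (g n) <= pint mu p f)%E.
    rewrite cLnorm1E -ge0_integralZl_EFin ?powR_ge0//; last 2 first.
    - by move=> x _; rewrite lee_fin cnorm_ge0.
    - exact: measurable_cnormE.
    apply: ge0_le_integral => //.
    - by move=> x _; rewrite -EFinM lee_fin mulr_ge0 ?powR_ge0 ?cnorm_ge0.
    - by apply: measurable_funeM; exact: measurable_cnormE.
    - exact: measurable_cnorm_pow.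
    move=> x _; rewrite -EFinM lee_fin.
    have [Ax|Ax] := pselect (A n x); last first.
      by rewrite gNA// cnorm0 mulr0 powR_ge0.
    rewrite gA// -[leRHS]mulr_powRB1 ?cnorm_ge0// mulrC ler_wpM2l ?cnorm_ge0//.
    apply: ge0_ler_powR; rewrite ?nnegrE ?subr_ge0 ?cnorm_ge0 ?(ltW hn0)//.
    by case: Ax => /ltW.
  move=> h; have : (((2^-1 ^+ n) `^ (p - 1))%:E * N 1%E (g n) < +oo)%E.
    by apply: le_lt_trans h _; rewrite pint_lty ?gt_eqF//; case: lf.
  by rewrite !ltey; apply: contra => /eqP ->; rewrite gt0_muley// lte_fin.
have ip : mu.-integrable setT (fun x => ((cnorm (f x)) `^ p)%:E).
  apply/integrableP; split; first exact: measurable_cnorm_pow.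
  under eq_integral do rewrite abse_EFin ger0_norm ?powR_ge0//.
  by rewrite -/(pint mu p f) pint_lty ?gt_eqF//; case: lf.
have mfg n : cmeasurable setT (fun x => f x - g n x) by exact: cmeasurableB.
have := @dominated_cvg _ _ _ mu setT measurableT
  (fun n x => ((cnorm (f x - g n x)) `^ p)%:E) (cst 0%E)
  (fun x => ((cnorm (f x)) `^ p)%:E) (fun n => measurable_cnorm_pow p (mfg n)) _ _ ip _.
rewrite integral0 => h.
have {}h : (pint mu p (fun x => f x - g n x) @[n --> \oo] --> 0%E).
  apply: h => //.
  - move=> x _; apply: cvg_near_cst.
    have [f0|f0] := eqVneq (f x) 0.
      apply: nearW => n; rewrite (_ : g n x = 0) ?f0 ?subrr ?cnorm0 ?powR0 ?gt_eqF//.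
      by rewrite /g f0 mul0r.
    have fx : 0 < cnorm (f x) by rewrite lt_neqAle eq_sym cnorm_eq0 f0 cnorm_ge0.
    have [K hK] := half_small fx.
    exists (maxn K (Num.bound (cnorm (f x)))) => // n /=.
    rewrite geq_max => /andP[Kn bn]; rewrite gA ?subrr ?cnorm0 ?powR0 ?gt_eqF//.
    split => /=; first exact: le_lt_trans (half_mono Kn) hK.
    apply/negP; rewrite -leNgt; apply: (@le_trans _ _ (Num.bound (cnorm (f x)))%:R).
      by rewrite ltW// archi_boundP// cnorm_ge0.
    by rewrite ler_nat.
  - move=> n x _; rewrite abse_EFin ger0_norm ?powR_ge0// lee_fin.
    by apply: ge0_ler_powR; rewrite ?nnegrE ?cnorm_ge0// ltW.
have ep : 0 < e `^ p by exact: powR_gt0.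
have [n /(_ n (leqnn n)) hn] := (ecvgn0P (fun n => pint_ge0 mu p _)).1 h _ ep.
exists (g n), n%:R; split => //.
by apply: cLnorm_le_of_pint hn => //; exact: ltW.
Qed.

End density.

Section semigroup_continuity.
Context {d : measure_display} {T : measurableType d} {R : realType}.
Variable mu : {measure set T -> \bar R}.
Hypothesis mu0 : (0 < mu setT)%E.
Variable S : R -> (T -> R[i]) -> T -> R[i].
Hypothesis Ssg : ds_semigroup mu S.
Hypothesis Scont : strongly_continuous_L1 mu S.
Implicit Types (f g h : T -> R[i]) (p l s : R).

Local Notation N p f := (cLnorm mu p f).

(** [S s f - S s' f] is the image under the contraction [S s'] of [S (s - s') f - f]: continuity at
    0 becomes uniform continuity. *)
Lemma semigroup_diff1 f s s' : cLp mu 1%E f -> 0 <= s' -> s' <= s ->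
  (N 1%E (fun x => (S s f x - S s' f x)%R) <=
   N 1%E (fun x => (S (s - s') f x - S 0 f x)%R))%E.
Proof.
move=> lf s'0 s's; have s0 : 0 <= s by exact: le_trans s's.
have u0 : 0 <= s - s' by rewrite subr_ge0.
have lSu := ds_L1 (dsg_ds Ssg u0) lf.
have lS := ds_L1 (dsg_ds Ssg s0) lf.
have lS' := ds_L1 (dsg_ds Ssg s'0) lf.
have lS0 := ds_L1 (dsg_ds Ssg (lexx 0)) lf.
have ldiff : cLp mu 1%E (fun x => S (s - s') f x - f x) by exact: cLpB.
have inc (g : T -> R[i]) : cLp mu 1%E g -> cL1Loo mu g.
  by move=> lg; exact: (@cL1Loo_cLp _ _ _ _ mu0 1).
have e1 : S s f = S s' (S (s - s') f) %[ae mu].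
  by have := dsgD Ssg s'0 u0 lf; rewrite addrC subrK.
have e2 := opB (dsg_ext Ssg s'0) (inc _ lSu) (inc _ lf).
have e0 := dsg0 Ssg lf.
have lSd := ds_L1 (dsg_ds Ssg s'0) ldiff.
rewrite (@ae_cLnorm _ _ _ _ 1 _ (S s' (fun x => S (s - s') f x - f x)))//.
- apply: le_trans (ds_contract1 (dsg_ds Ssg s'0) ldiff) _.
  apply: le_cLnorm => //; [by case: ldiff|by case: (cLpB (lexx 1) lSu lS0)|].
  by apply: filterS e0 => x ->.
- by case: (cLpB (lexx 1) lS lS').
- by case: lSd.
- by apply: filterS2 e1 e2 => x e1 e2 _; rewrite e1// e2.
Qed.

(** For bounded integrable [g], the difference of two orbit points is bounded by [2 B], so its p-th
    power integral is at most [(2 B)^(p-1)] times its L^1 norm. Density and the uniform bound [K]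
    extend this to L^p. *)
Lemma semigroup_uniform_continuity p f (e : R) : 1 <= p -> 0 < e ->
  cLp mu p%:E f -> exists2 dl : R, 0 < dl &
  forall s s', 0 <= s -> 0 <= s' -> `|s - s'| <= dl ->
  (N p%:E (fun x => (S s f x - S s' f x)%R) <= e%:E)%E.
Proof.
move=> p1 e0 lf; have p0 : 0 < p by exact: lt_le_trans p1.
have [K K0 KP] := op_bounded mu0 p1.
have e30 : 0 < e / 3 by rewrite divr_gt0.
have [g [B [lg B0 gB fg]]] := dense_L1_bounded p1 (divr_gt0 e30 K0) lf.
have [mf _] := lf; have [mg _] := lg.
have lgp : cLp mu p%:E g by apply: cLp_interp lg _ => //; exact: aeW gB.
have lfg : cLp mu p%:E (fun x => f x - g x) by exact: cLpB.
have inc (h : T -> R[i]) : cLp mu p%:E h -> cL1Loo mu h by exact: cL1Loo_cLp.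
pose q := (B + B) `^ (p - 1) + 1.
have q0 : 0 < q by rewrite ltr_wpDl ?powR_ge0.
have eta0 : 0 < (e / 3) `^ p / q by rewrite divr_gt0// powR_gt0.
have [dl dl0 gdl] : exists2 dl, 0 < dl & forall u, 0 <= u -> u <= dl ->
    (N 1%E (fun x => (S u g x - S 0 g x)%R) <= ((e / 3) `^ p / q)%:E)%E.
  have /ecvg0P := Scont lg (lexx 0).
  move=> /(_ (fun s => cLnorm_ge0 _ _ _) _ eta0) [dl /= dl0 dlP].
  exists (dl / 2); first by rewrite divr_gt0.
  move=> u u0 udl; apply: dlP; last by rewrite /= in_itv/= u0.
  by rewrite /= sub0r normrN ger0_norm//; move: dl0 => /=; lra.
exists dl => //.
have gcont s s' : 0 <= s' -> s' <= s -> `|s - s'| <= dl ->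
    (N p%:E (fun x => (S s g x - S s' g x)%R) <= (e / 3)%:E)%E.
  move=> s'0 s's sdl; have s0 : 0 <= s by exact: le_trans s's.
  have lS := ds_L1 (dsg_ds Ssg s0) lg; have lS' := ds_L1 (dsg_ds Ssg s'0) lg.
  apply: cLnorm_le_of_pint => //; first exact: ltW.
  apply: (@le_trans _ _ (((B + B) `^ (p - 1))%:E *
      N 1%E (fun x => (S s g x - S s' g x)%R))%E).
    apply: pint_interp => //; first by case: (cLpB (lexx 1) lS lS').
      by rewrite addr_ge0.
    have b1 := op_oo mu0 (dsg_ext Ssg s0) mg (aeW mu gB).
    have b2 := op_oo mu0 (dsg_ext Ssg s'0) mg (aeW mu gB).
    apply: filterS2 b1 b2 => x b1 b2.
    by rewrite (le_trans (cnormB _ _))// lerD.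
  apply: (@le_trans _ _ (((B + B) `^ (p - 1))%:E * ((e / 3) `^ p / q)%:E)%E).
    rewrite lee_wpmul2l ?lee_fin ?powR_ge0//.
    apply: le_trans (semigroup_diff1 lg s'0 s's) _; apply: gdl.
      by rewrite subr_ge0.
    by rewrite -(@ger0_norm _ (s - s')) ?subr_ge0.
  rewrite -EFinM lee_fin mulrCA ger_pMr ?powR_gt0// ler_pdivrMr// mul1r.
  by rewrite lerDl.
have gcont' s s' : 0 <= s -> 0 <= s' -> `|s - s'| <= dl ->
    (N p%:E (fun x => (S s g x - S s' g x)%R) <= (e / 3)%:E)%E.
  move=> s0 s'0 sdl; have [ss'|s's] := leP s s'; last exact: gcont (ltW s's) _.
  by rewrite cLnorm_distC; apply: gcont => //; rewrite distrC.
move=> s s' s0 s'0 sdl.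
have small r : 0 <= r -> (N p%:E (S r (fun x => f x - g x)%R) <= (e / 3)%:E)%E.
  move=> r0; apply: le_trans (KP _ (dsg_ds Ssg r0) (dsg_ext Ssg r0) _ lfg).2 _.
  apply: (@le_trans _ _ (K%:E * (e / 3 / K)%:E)%E).
    by rewrite lee_wpmul2l ?lee_fin ?(ltW K0).
  by rewrite -EFinM lee_fin mulrC divfK// gt_eqF.
have lSfg r : 0 <= r -> cmeasurable setT (S r (fun x => f x - g x)).
  by move=> r0; case: (KP _ (dsg_ds Ssg r0) (dsg_ext Ssg r0) _ lfg) => -[].
have mSf r : 0 <= r -> cmeasurable setT (S r f).
  by move=> r0; case: (KP _ (dsg_ds Ssg r0) (dsg_ext Ssg r0) _ lf) => -[].
have mSg r : 0 <= r -> cmeasurable setT (S r g).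
  by move=> r0; case: (KP _ (dsg_ds Ssg r0) (dsg_ext Ssg r0) _ lgp) => -[].
have e1 := opB (dsg_ext Ssg s0) (inc _ lf) (inc _ lgp).
have e2 := opB (dsg_ext Ssg s'0) (inc _ lf) (inc _ lgp).
rewrite (@ae_cLnorm _ _ _ _ p _ (fun x => S s (fun x => f x - g x) x +
    ((S s g x - S s' g x) - S s' (fun x => f x - g x) x))) ?(ltW p0)//.
- apply: le_trans (cLnormD mu p1 (lSfg _ s0) _) _.
    apply: cmeasurableB; last exact: lSfg.
    by apply: cmeasurableB; exact: mSg.
  rewrite (_ : e = e / 3 + (e / 3 + e / 3)); last by field.
  rewrite EFinD leeD ?small//.
  apply: le_trans (cLnormB mu p1 _ (lSfg _ s'0)) _.
    by apply: cmeasurableB; exact: mSg.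
  by rewrite EFinD leeD ?small// gcont'.
- by apply: cmeasurableB; exact: mSf.
- apply: cmeasurableD; first exact: lSfg.
  apply: cmeasurableB; last exact: lSfg.
  by apply: cmeasurableB; exact: mSg.
- by apply: filterS2 e1 e2 => x e1 e2 _; rewrite e1// e2//; ring.
Qed.

End semigroup_continuity.

(** * Chacon's filling scheme *)

(** The substitution [j = n - k]: it regroups the terms [P (n - k) (dd k)] of the filling scheme by
    the power of [P]. *)
Lemma sum_triangle (V : zmodType) (H : nat -> nat -> V) (M : nat) :
  \sum_(n < M) \sum_(k < n.+1) H (n - k)%N k =
  \sum_(j < M) \sum_(k < M - j) H j k.
Proof.
elim: M => [|M ih]; first by rewrite !big_ord0.
rewrite big_ord_recr/= ih [RHS]big_ord_recr/= subSnn big_ord1.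
have -> : \sum_(j < M) \sum_(k < M.+1 - j) H j k =
    \sum_(j < M) \sum_(k < M - j) H j k + \sum_(j < M) H j (M - j)%N.
  rewrite -big_split/=; apply: eq_bigr => j _.
  by rewrite subSn ?(ltnW (ltn_ord j))// big_ord_recr.
rewrite -addrA; congr (_ + _).
rewrite (reindex_inj rev_ord_inj)/= big_ord_recr/= !subnn; rewrite subn0; congr (_ + _).
by apply: eq_bigr => i _; rewrite !subSS subKn// ltnW.
Qed.

Section chacon.
Context {d : measure_display} {T : measurableType d} {R : realType}.
Variable mu : {measure set T -> \bar R}.
Hypothesis mu0 : (0 < mu setT)%E.

(** The powers of one operator, given as a family: for [P n = S (n%:R * h)] the semigroup law holds
    only up to null sets, so [P n] is not literally an iterate of [P 1]. *)
Record ds_sequence (P : nat -> (T -> R[i]) -> T -> R[i]) : Prop := {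
  dss_ds : forall n, dunford_schwartz mu (P n) ;
  dss_ext : forall n, ds_extended mu (P n) ;
  dss0 : forall f, cLp mu 1%E f -> P 0 f = f %[ae mu] ;
  dssD : forall m n f, cLp mu 1%E f -> P (m + n)%N f = P m (P n f) %[ae mu] }.

Variable P : nat -> (T -> R[i]) -> T -> R[i].
Hypothesis Pds : ds_sequence P.
Implicit Types (f g h : T -> R[i]).

Local Notation N p f := (cLnorm mu p f).

Section filling.
Variables (f : T -> R[i]) (a : R).
Hypothesis (lf : cLp mu 1%E f) (a0 : 0 < a).

(* [(fill n).1] is the part of [P^n f] that could not be poured below level
   [a], and [(fill n).2] is the capacity that remains after [n] steps. *)
Fixpoint fill n : (T -> R[i]) * (T -> R) :=
  if n is m.+1 then
    (fun x => P 1 (fill m).1 x - cclip ((fill m).2 x) (P 1 (fill m).1 x),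
     fun x => (fill m).2 x - cnorm (cclip ((fill m).2 x) (P 1 (fill m).1 x)))
  else (fun x => f x - cclip a (f x), fun x => a - cnorm (cclip a (f x))).

Let r n := (fill n).1.
Let c n := (fill n).2.
(** The part poured at step [n]; the first pouring acts on [f] itself. *)
Let dd n : T -> R[i] :=
  if n is m.+1 then (fun x => cclip (c m x) (P 1 (r m) x))
  else fun x => cclip a (f x).

Let c_ge0 n x : 0 <= c n x.
Proof.
elim: n => [|n ih]; rewrite /c /= subr_ge0 cnorm_cclip ?ge_min ?lexx//.
exact: ltW.
Qed.

Let c_anti n m x : (n <= m)%N -> c m x <= c n x.
Proof.
move=> nm; rewrite -(subnKC nm); elim: (m - n)%N => [|k ih]; first by rewrite addn0.
by rewrite addnS (le_trans _ ih)// /c /= gerBl cnorm_ge0.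
Qed.

Let cE n x : c n x = a - \sum_(k < n.+1) cnorm (dd k x).
Proof.
elim: n => [|n ih]; first by rewrite big_ord_recr big_ord0 /= add0r.
by rewrite big_ord_recr/= opprD addrA -ih.
Qed.

(** Mass overflows at a point only once the capacity there is exhausted. *)
Let r_c n x : r n x != 0 -> c n x = 0.
Proof.
move: (c_ge0 n x); rewrite /r /c; case: n => [|n] /= cn0.
  rewrite -cnorm_eq0 cnorm_sub_cclip ?ltW// => h.
  have [fa|fa] := leP (cnorm (f x)) a; first by rewrite excess_small ?eqxx in h.
  by rewrite cnorm_cclip ?ltW// (min_idPl (ltW fa)) subrr.
have c0 := c_ge0 n x; rewrite -/(c n) -/(r n) in cn0 c0 *.
rewrite -cnorm_eq0 cnorm_sub_cclip// => h.
have [fa|fa] := leP (cnorm (P 1 (r n) x)) (c n x).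
  by rewrite excess_small ?eqxx in h.
by rewrite cnorm_cclip// (min_idPl (ltW fa)) subrr.
Qed.

Let fill_mem n : [/\ cLp mu 1%E (r n), cLp mu 1%E (dd n) & measurable_fun setT (c n)].
Proof.
have [mf _] := lf.
elim: n => [|n [lr ld mc]].
  have lc : cLp mu 1%E (fun x => cclip a (f x)) by apply: cLp_cclip => //; exact: ltW.
  split => //; first by apply: cLpB.
  apply: measurable_funB => //.
  by apply: measurable_cnorm; case: lc.
have lPr := ds_L1 (dss_ds Pds 1) lr; have [mPr _] := lPr.
have mcl : cmeasurable setT (fun x => cclip (c n x) (P 1 (r n) x)).
  exact: measurable_cclip.
have lcl : cLp mu 1%E (fun x => cclip (c n x) (P 1 (r n) x)).
  apply: (cLp_dom _ mcl lPr) => //.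
  by apply: aeW => x; rewrite cnorm_cclip// ge_min lexx orbT.
split => //; first by apply: cLpB.
apply: measurable_funB => //; exact: measurable_cnorm.
Qed.

Let lr n : cLp mu 1%E (r n). Proof. by have [] := fill_mem n. Qed.
Let ld n : cLp mu 1%E (dd n). Proof. by have [] := fill_mem n. Qed.
Let mc n : measurable_fun setT (c n). Proof. by have [] := fill_mem n. Qed.

Let split_norm (k : T -> R) g : (forall x, 0 <= k x) -> measurable_fun setT k ->
  cLp mu 1%E g -> (N 1%E (fun x => cclip (k x) (g x)) +
    N 1%E (fun x => (g x - cclip (k x) (g x))%R) = N 1%E g)%E.
Proof.
move=> k0 mk [mg lg].
have mcl : cmeasurable setT (fun x => cclip (k x) (g x)) by exact: measurable_cclip.
rewrite !cLnorm1E -ge0_integralD//.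
- apply: eq_integral => x _; rewrite -EFinD cnorm_sub_cclip// cnorm_cclip//.
  by rewrite /excess subrKC.
- by move=> x _; rewrite lee_fin cnorm_ge0.
- exact: measurable_cnormE.
- by move=> x _; rewrite lee_fin cnorm_ge0.
- by apply: measurable_cnormE; exact: cmeasurableB.
Qed.

(** Conservation of mass: pouring splits the modulus exactly into poured part and rest
    ([split_norm]), and transport by [P 1] does not increase the L^1 norm. *)
Let fill_norm n :
  (\sum_(k < n.+1) N 1%E (dd k) + N 1%E (r n) <= N 1%E f)%E.
Proof.
elim: n => [|n ih].
  rewrite big_ord1 /= /r /=.
  by rewrite (@split_norm (cst a))// => x; exact: ltW.
rewrite big_ord_recr/= -addeA; apply: le_trans ih; rewrite leeD2l//.
have lPr := ds_L1 (dss_ds Pds 1) (lr n).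
rewrite [leLHS](_ : _ = N 1%E (P 1 (r n))); last by rewrite -(split_norm (c_ge0 n) (mc n) lPr).
exact: ds_contract1 (dss_ds Pds 1) _ (lr n).
Qed.

Let inc g : cLp mu 1%E g -> cL1Loo mu g.
Proof. by move=> lg; exact: (@cL1Loo_cLp _ _ _ _ mu0 1). Qed.

Let fill_decomp n : {ae mu, forall x,
  P n f x = \sum_(k < n.+1) P (n - k) (dd k) x + r n x}.
Proof.
elim: n => [|n ih].
  have h1 := dss0 Pds lf; have h2 := dss0 Pds (ld 0).
  apply: filterS2 h1 h2 => x h1 h2.
  by rewrite big_ord_recr big_ord0 /= add0r h1// h2// /r /= subrKC.
have lP k g : cLp mu 1%E g -> cLp mu 1%E (P k g) by move=> lg; exact: (ds_L1 (dss_ds Pds k)).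
have lsum : cLp mu 1%E (fun x => \sum_(k < n.+1) P (n - k) (dd k) x).
  by apply: cLp_sum => // k _; exact: lP.
pose F x := \sum_(k < n.+1) P (n - k) (dd k) x + r n x.
have lF : cLp mu 1%E F by exact: cLpD.
have h1 : P n.+1 f = P 1 (P n f) %[ae mu] by exact: (dssD Pds 1 n lf).
have h2 : P 1 (P n f) = P 1 F %[ae mu].
  apply: (ds_ae (dss_ds Pds 1)) => //; first exact: lP.
  by apply: filterS ih => x ->.
have h3 := opD (dss_ext Pds 1) (inc lsum) (inc (lr n)).
have h4 := op_sum mu0 (dss_ext Pds 1) (fun _ : 'I_n.+1 => 1)
  (fun k : 'I_n.+1 => inc (lP (n - k)%N _ (ld k))).
rewrite (_ : (fun x : T => \sum_(i < n.+1) 1 * P (n - i) (dd i) x) =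
   (fun x => \sum_(k < n.+1) P (n - k) (dd k) x)) in h4; last first.
  by apply/funext => x; apply: eq_bigr => i _; rewrite mul1r.
have h5 : {ae mu, forall x, forall k : 'I_n.+1,
    P (n.+1 - k) (dd k) x = P 1 (P (n - k) (dd k)) x}.
  have := ae_foralln (fun k => dssD Pds 1 (n - k) (ld k)).
  apply: filterS => x h k; rewrite -[RHS]h//.
  by rewrite add1n -subSn// -ltnS.
have h6 := dss0 Pds (ld n.+1).
have h12 : {ae mu, forall x, P n.+1 f x = P 1 F x}.
  by apply: filterS2 h1 h2 => x h1 h2; rewrite h1// h2.
have h34 : {ae mu, forall x, P 1 F x =
    \sum_(k < n.+1) P 1 (P (n - k)%N (dd k)) x + P 1 (r n) x}.
  apply: filterS2 h3 h4 => x h3 h4; rewrite h3// h4//; congr (_ + _).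
  by apply: eq_bigr => i _; rewrite mul1r.
apply: filterS3 h12 h34 (filterI h5 h6) => x h12 h34 [g5 g6].
move: g6; rewrite /= => g6.
rewrite h12 h34 [in RHS]big_ord_recr/= subnn g6// -addrA; congr (_ + _).
  by apply: eq_bigr => i _; rewrite g5.
by rewrite subrKC.
Qed.

(** Off [E] no mass overflows up to time [M], so [P n f] is a sum of transported poured parts, and
    the poured parts add up to at most [a]. The bound then follows from the L^oo contraction alone.
    [E] depends on [f], [a] and [M] but not on the weights [w]; each [m j] bounds all later weights
    because they meet in one function transported by [P j]. *)
Lemma fill_maximal (M : nat) : exists E, [/\ measurable E,
  (a%:E * mu E <= N 1%E f)%E &
  forall (w : nat -> R[i]) (m : nat -> R),
  (forall j n, (j <= n < M)%N -> cnorm (w n) <= m j) ->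
  {ae mu, forall x, ~ E x ->
    cnorm (\sum_(n < M) w n * P n f x) <= a * \sum_(j < M) m j}].
Proof.
(* By [cE] the total poured at a point of [E] is at least [a], so [a * mu E] is at most the total
   mass poured. *)
pose E := [set x | c M x <= 0].
have mE : measurable E.
  rewrite -[E]setTI (_ : E = (c M) @^-1` `]-oo, 0]); first exact: (mc M).
  by apply/seteqP; split => x /=; rewrite in_itv.
exists E; split => //.
  apply: (@le_trans _ _ (\sum_(k < M.+1) N 1%E (dd k))%E); last first.
    by apply: le_trans (fill_norm M); rewrite leeDl// cLnorm_ge0.
  have md k : cmeasurable setT (dd k) by case: (ld k).
  rewrite (_ : (\sum_(k < M.+1) N 1%E (dd k))%E =
      (\int[mu]_x \sum_(k < M.+1) (cnorm (dd k x))%:E)%E); last first.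
    rewrite ge0_integral_sum//.
    - by apply: eq_bigr => k _; rewrite cLnorm1E.
    - by move=> k; exact: measurable_cnormE.
    - by move=> k x _; rewrite lee_fin cnorm_ge0.
  have mS : measurable_fun setT (fun x => \sum_(k < M.+1) (cnorm (dd k x))%:E)%E.
    by apply: emeasurable_sum => k; exact: measurable_cnormE.
  rewrite -(integral_cst mu mE).
  apply: (@le_trans _ _ (\int[mu]_(x in E) \sum_(k < M.+1) (cnorm (dd k x))%:E)%E).
    apply: ge0_le_integral => //.
    - by move=> x _; rewrite lee_fin ltW.
    - exact: measurable_funTS.
    - move=> x /= Ex; rewrite sumEFin lee_fin.
      by move: Ex; rewrite /E /= cE subr_le0.
  apply: ge0_subset_integral => // x _.
  by apply: sume_ge0 => k _; rewrite lee_fin cnorm_ge0.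
move=> w m wm.
have off x n : ~ E x -> (n <= M)%N -> r n x = 0.
  move=> nE nM; apply/eqP/negPn/negP => /r_c cn; apply: nE.
  by rewrite /E /= -cn c_anti.
(* Everything that [P j] transports in the weighted sum, collected so that the L^oo contraction is
   applied once per power. *)
pose e j x := \sum_(k < M - j) w (j + k)%N * dd k x.
have me j : cmeasurable setT (e j).
  apply: cmeasurable_sum => k _; apply: cmeasurableZ.
  by case: (ld k).
have m0 j : (j < M)%N -> 0 <= m j.
  by move=> jM; apply: le_trans (cnorm_ge0 (w j)) _; apply: wm; rewrite leqnn.
have sum_dd x (K : nat) : \sum_(k < K) cnorm (dd k x) <= a.
  case: K => [|K]; first by rewrite big_ord0 ltW.
  by rewrite -subr_ge0 -cE.
have ebound j x : (j < M)%N -> cnorm (e j x) <= m j * a.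
  move=> jM; apply: le_trans (cnorm_sum _ _ _) _.
  apply: le_trans (ler_wpM2l (m0 _ jM) (sum_dd x (M - j)%N)).
  rewrite mulr_sumr; apply: ler_sum => k _; rewrite cnormM ler_wpM2r ?cnorm_ge0//.
  by apply: wm; rewrite leq_addr/= -ltn_subRL.
have Pe : {ae mu, forall x, forall j : nat, (j < M)%N ->
    cnorm (P j (e j) x) <= m j * a}.
  apply: ae_foralln => j; have [jM|_] := boolP (j < M)%N; last exact: aeW.
  have := op_oo mu0 (dss_ext Pds j) (me j) (aeW mu (fun x => ebound j x jM)).
  by apply: filterS => x h _.
have Psum : {ae mu, forall x, forall j : nat,
    P j (e j) x = \sum_(k < M - j) w (j + k)%N * P j (dd k) x}.
  apply: ae_foralln => j.
  have := op_sum mu0 (dss_ext Pds j) (fun k : 'I_(M - j) => w (j + k)%N)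
    (fun k : 'I_(M - j) => inc (ld k)).
  by apply: filterS => x h; rewrite h.
have dec : {ae mu, forall x, forall n,
    P n f x = \sum_(k < n.+1) P (n - k) (dd k) x + r n x}.
  by apply: ae_foralln => n; exact: fill_decomp.
apply: filterS3 Pe Psum dec => x Pe Psum dec nE.
have -> : \sum_(n < M) w n * P n f x = \sum_(j < M) P j (e j) x.
  under [RHS]eq_bigr do rewrite Psum.
  rewrite -(sum_triangle (fun j k => w (j + k)%N * P j (dd k) x)).
  apply: eq_bigr => n _; rewrite dec off ?addr0//; last exact: ltnW.
  rewrite mulr_sumr; apply: eq_bigr => k _; rewrite subnK//.
  by rewrite -ltnS.
apply: le_trans (cnorm_sum _ _ _) _.
rewrite mulrC mulr_suml; apply: ler_sum => j _; exact: Pe.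
Qed.

End filling.
(** The part of [f] above [l] is integrable and goes through the filling scheme at level [l]; the
    truncated part stays below [l] under every [P n]. Each contributes [l] times the sum of the
    [m j], whence the 2. *)
Lemma maximal_Lp p (f : T -> R[i]) (l : R) (M : nat) :
  1 <= p -> cLp mu p%:E f -> 0 < l -> exists E, [/\ measurable E,
  ((l `^ p)%:E * mu E <= pint mu p f)%E &
  forall (w : nat -> R[i]) (m : nat -> R),
  (forall j n, (j <= n < M)%N -> cnorm (w n) <= m j) ->
  {ae mu, forall x, ~ E x ->
    cnorm (\sum_(n < M) w n * P n f x) <= 2 * l * \sum_(j < M) m j}].
Proof.
move=> p1 lf l0; have [mf _] := lf.
pose g x := f x - cclip l (f x); pose h x := cclip l (f x).
have lg : cLp mu 1%E g by exact: cLp1_excess lf.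
have mh : cmeasurable setT h by exact: cmeasurable_cclip.
have hl : {ae mu, forall x, cnorm (h x) <= l}.
  by apply: aeW => x; rewrite (cnorm_cclip _ (ltW l0)) ge_min lexx.
have lh := cLp_oo mu0 mh hl.
have [E [mE muE EP]] := fill_maximal lg l0 M.
exists E; split => //.
  rewrite -[l `^ p]mulr_powRB1 ?(ltW l0) ?(lt_le_trans ltr01)// mulrC EFinM -muleA.
  apply: le_trans (cnorm1_excess mu p1 l0 mf).
  by rewrite lee_wpmul2l// lee_fin powR_ge0.
move=> w m wm.
have lin : {ae mu, forall x, forall n, P n f x = P n g x + P n h x}.
  apply: ae_foralln => n.
  have := opD (dss_ext Pds n) (@cL1Loo_cLp _ _ _ _ mu0 1 _ (lexx 1) lg) (cL1Loo_oo lh).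
  rewrite (_ : (fun x => g x + h x) = f); last by apply/funext => x; rewrite subrK.
  by apply: filterS => x ->.
have Phl : {ae mu, forall x, forall n, cnorm (P n h x) <= l}.
  by apply: ae_foralln => n; exact: op_oo (dss_ext Pds n) _ _ _ _.
apply: filterS3 (EP w m wm) lin Phl => x Ex lin Phl nE.
have -> : \sum_(n < M) w n * P n f x =
    \sum_(n < M) w n * P n g x + \sum_(n < M) w n * P n h x.
  by rewrite -big_split; apply: eq_bigr => n _; rewrite lin mulrDr.
apply: le_trans (cnormD _ _) _.
rewrite (_ : 2 * l * _ = l * \sum_(j < M) m j + l * \sum_(j < M) m j); last by ring.
apply: lerD; first exact: Ex.
apply: le_trans (cnorm_sum _ _ _) _; rewrite mulr_sumr; apply: ler_sum => n _.
rewrite cnormM mulrC ler_pM ?cnorm_ge0//.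
by apply: wm; rewrite leqnn/=.
Qed.

End chacon.

(** * Discrete ergodic averages *)

Lemma le_measure_ae d (T : measurableType d) (R : realType)
    (mu : {measure set T -> \bar R}) (A B : set T) :
  measurable A -> measurable B -> {ae mu, forall x, A x -> B x} ->
  (mu A <= mu B)%E.
Proof.
move=> mA mB [Z [mZ Z0 ABZ]].
apply: (@le_trans _ _ (mu (B `|` Z))).
  apply: le_measure; rewrite ?inE//; first exact: measurableU.
  move=> x Ax; have [Zx|nZx] := pselect (Z x); [by right|left].
  by apply: contrapT => nBx; apply: nZx; apply: ABZ => /= /(_ Ax).
by apply: le_trans (measureU2 mu mB mZ) _; rewrite [X in (_ + X)%E]Z0 adde0.
Qed.

Section L2_norm.
Context {d : measure_display} {T : measurableType d} {R : realType}.
Variable mu : {measure set T -> \bar R}.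
Implicit Types f g : T -> R[i].

Local Notation N p f := (cLnorm mu p f).

Definition n2 f : R := fine (N 2%:E f).

Let le12 : 1 <= 2 :> R. Proof. by rewrite ler1n. Qed.

Lemma n2_ge0 f : 0 <= n2 f. Proof. by rewrite fine_ge0// cLnorm_ge0. Qed.

Lemma n2E f : cLp mu 2%:E f -> N 2%:E f = (n2 f)%:E.
Proof. by move=> [_ lf]; rewrite /n2 fineK// ge0_fin_numE// cLnorm_ge0. Qed.

Lemma pint2E f : cLp mu 2%:E f -> pint mu 2 f = ((n2 f) ^+ 2)%:E.
Proof. by move=> lf; rewrite pintE// n2E// poweR_EFin powR_mulrn// n2_ge0. Qed.

Lemma n2D f g : cLp mu 2%:E f -> cLp mu 2%:E g ->
  n2 (fun x => f x + g x) <= n2 f + n2 g.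
Proof.
move=> lf lg; rewrite -lee_fin EFinD -!n2E//; last exact: cLpD.
by apply: cLnormD => //; [case: lf|case: lg].
Qed.

Lemma n2_distC f g : n2 (fun x => f x - g x) = n2 (fun x => g x - f x).
Proof. by rewrite /n2 cLnorm_distC. Qed.

Lemma n2_ae f g : cmeasurable setT f -> cmeasurable setT g ->
  {ae mu, forall x, f x = g x} -> n2 f = n2 g.
Proof.
move=> mf mg fg; rewrite /n2; congr fine; apply: ae_cLnorm => //.
by apply: filterS fg => x ->.
Qed.

Lemma n2Z (c : R[i]) f : cLp mu 2%:E f -> n2 (fun x => c * f x) = cnorm c * n2 f.
Proof.
move=> lf; apply/EFin_inj; rewrite EFinM -!n2E//; last exact: cLpZ.
by apply: cLnormZ => //; case: lf.
Qed.

Lemma n2_sum (n : nat) (F : 'I_n -> T -> R[i]) (b : 'I_n -> R) :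
  (forall i, cLp mu 2%:E (F i)) -> (forall i, n2 (F i) <= b i) ->
  n2 (fun x => \sum_i F i x) <= \sum_i b i.
Proof.
move=> lF Fb; rewrite -lee_fin -n2E; last exact: cLp_sum.
apply: le_trans (cLnorm_sum mu _ le12 _) _; first by move=> i; case: (lF i).
by rewrite -sumEFin; apply: lee_sum => i _; rewrite n2E// lee_fin.
Qed.

Lemma n2_parallelogram f g : cLp mu 2%:E f -> cLp mu 2%:E g ->
  (n2 (fun x => f x + g x)) ^+ 2 + (n2 (fun x => f x - g x)) ^+ 2 =
  2 * (n2 f) ^+ 2 + 2 * (n2 g) ^+ 2.
Proof.
move=> lf lg; have [mf _] := lf; have [mg _] := lg.
apply/EFin_inj; rewrite !EFinD !(EFinM 2).
rewrite -!pint2E//; [|exact: cLpB|exact: cLpD].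
have m2 (h : T -> R[i]) : cmeasurable setT h ->
    measurable_fun setT (fun x => ((cnorm (h x)) `^ 2)%:E).
  exact: measurable_cnorm_pow.
have p0 (h : T -> R[i]) x : [set: T] x -> (0 <= ((cnorm (h x)) `^ 2)%:E)%E.
  by rewrite lee_fin powR_ge0.
have p20 (h : T -> R[i]) x : [set: T] x -> (0 <= 2%:E * ((cnorm (h x)) `^ 2)%:E)%E.
  by move=> _; rewrite -EFinM lee_fin mulr_ge0 ?powR_ge0.
have m22 (h : T -> R[i]) : cmeasurable setT h ->
    measurable_fun setT (fun x => 2%:E * ((cnorm (h x)) `^ 2)%:E)%E.
  by move=> mh; apply: measurable_funeM; exact: m2.
have Z (h : T -> R[i]) : cmeasurable setT h ->
    (2%:E * pint mu 2 h = \int[mu]_x (2%:E * ((cnorm (h x)) `^ 2)%:E))%E.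
  by move=> mh; rewrite ge0_integralZl_EFin//; [exact: p0|exact: m2].
rewrite !Z// /pint -(ge0_integralD _ _ (p0 _) (m2 _ _) (p0 _) (m2 _ _))//; last 2 first.
- exact: cmeasurableD.
- exact: cmeasurableB.
rewrite -(ge0_integralD _ _ (p20 _) (m22 _ _) (p20 _) (m22 _ _))//.
apply: eq_integral => x _; rewrite -!EFinM -!EFinD.
by rewrite !powR_mulrn ?cnorm_ge0// cnorm_parallelogram.
Qed.

End L2_norm.

Section discrete_ergodic.
Context {d : measure_display} {T : measurableType d} {R : realType}.
Variable mu : {measure set T -> \bar R}.
Hypothesis mu0 : (0 < mu setT)%E.
Variable P : nat -> (T -> R[i]) -> T -> R[i].
Hypothesis Pds : ds_sequence mu P.
Variable e : nat -> R[i].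
Hypothesis (e0 : e 0 = 1) (eD : forall m n, e (m + n)%N = e m * e n)
  (e1 : forall n, cnorm (e n) = 1).
Implicit Types (f g h : T -> R[i]).

Local Notation N p f := (cLnorm mu p f).

Let le12 : 1 <= 2 :> R. Proof. by rewrite ler1n. Qed.

Definition ravg n f x : R[i] := (n%:R^-1)%:C%C * \sum_(k < n) e k * P k f x.

(** The class is kept, with the same [B], by the [P n] and the averages; it lies in L^2 and gives
    almost everywhere errors with explicit constants. *)
Definition L1b (B : R) f := cLp mu 1%E f /\ {ae mu, forall x, cnorm (f x) <= B}.

Lemma L1b_2 B f : L1b B f -> cLp mu 2%:E f.
Proof. by move=> [lf fB]; exact: cLp_interp lf fB. Qed.

Lemma L1b_inc B f : L1b B f -> cL1Loo mu f.
Proof. by move=> [lf fB]; exact: (@cL1Loo_cLp _ _ _ _ mu0 1). Qed.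

Lemma L1bD B C f g : L1b B f -> L1b C g -> L1b (B + C) (fun x => f x + g x).
Proof.
move=> [lf fB] [lg gC]; split; first exact: cLpD.
apply: filterS2 fB gC => x fB gC.
by rewrite (le_trans (cnormD _ _))// lerD.
Qed.

Lemma L1bB B C f g : L1b B f -> L1b C g -> L1b (B + C) (fun x => f x - g x).
Proof.
move=> [lf fB] [lg gC]; split; first exact: cLpB.
apply: filterS2 fB gC => x fB gC.
by rewrite (le_trans (cnormB _ _))// lerD.
Qed.

Lemma L1bP B n f : L1b B f -> L1b B (P n f).
Proof.
move=> [lf fB]; split; first exact: (ds_L1 (dss_ds Pds n)).
by apply: (op_oo mu0 (dss_ext Pds n)) fB; case: lf.
Qed.

Lemma cnorm_invn n : cnorm ((n%:R^-1 : R)%:C%C) = n%:R^-1.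
Proof. by rewrite cnorm_real ger0_norm// invr_ge0. Qed.

Lemma avg_bound (n : nat) (F : nat -> R[i]) (B : R) : 0 <= B ->
  (forall k, cnorm (F k) <= B) ->
  cnorm ((n%:R^-1 : R)%:C%C * \sum_(k < n) F k) <= B.
Proof.
move=> B0 FB; rewrite cnormM cnorm_invn.
have [->|n0] := posnP n; first by rewrite invr0 mul0r.
rewrite ler_pdivrMl ?ltr0n//; apply: le_trans (cnorm_sum _ _ _) _.
apply: (@le_trans _ _ (\sum_(k < n) B)); first by apply: ler_sum => k _; exact: FB.
by rewrite sumr_const card_ord -[leLHS]mulr_natl.
Qed.

Lemma L1b_ravg B n f : 0 <= B -> L1b B f -> L1b B (ravg n f).
Proof.
move=> B0 Lf; split.
  apply: cLpZ => //; apply: cLp_sum => // k _; apply: cLpZ => //.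
  by case: (L1bP k Lf).
have h : {ae mu, forall x, forall k, cnorm (P k f x) <= B}.
  by apply: ae_foralln => k; case: (L1bP k Lf).
apply: filterS h => x h; apply: (@avg_bound n (fun k => e k * P k f x)) => // k.
by rewrite cnormM e1 mul1r.
Qed.

Lemma n2P B n f : 0 <= B -> L1b B f -> n2 mu (P n f) <= n2 mu f.
Proof.
move=> B0 Lf; have [lf fB] := Lf.
rewrite -ler_sqr ?nnegrE ?n2_ge0// -lee_fin.
rewrite -!pint2E; [|exact: L1b_2 Lf|exact: L1b_2 (L1bP n Lf)].
exact: (op_contract2 mu0 (dss_ds Pds n) (dss_ext Pds n) B0).
Qed.

Lemma n2_avg (n : nat) (F : nat -> T -> R[i]) (b : R) : 0 <= b ->
  (forall k, cLp mu 2%:E (F k)) -> (forall k, n2 mu (F k) <= b) ->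
  n2 mu (fun x => (n%:R^-1 : R)%:C%C * \sum_(k < n) F k x) <= b.
Proof.
move=> b0 lF Fb; rewrite n2Z; last by apply: cLp_sum => // k _; exact: lF.
rewrite cnorm_invn; have [->|n0] := posnP n; first by rewrite invr0 mul0r.
rewrite ler_pdivrMl ?ltr0n//.
apply: le_trans (n2_sum (fun k : 'I_n => lF k) (fun k : 'I_n => Fb k)) _.
by rewrite sumr_const card_ord -[leLHS]mulr_natl.
Qed.

Lemma n2_ravg B n f : 0 <= B -> L1b B f -> n2 mu (ravg n f) <= n2 mu f.
Proof.
move=> B0 Lf; apply: (@n2_avg n (fun k x => e k * P k f x)).
- exact: n2_ge0.
- by move=> k; apply: cLpZ => //; exact: L1b_2 (L1bP k Lf).
move=> k; rewrite n2Z; last exact: L1b_2 (L1bP k Lf).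
by rewrite e1 mul1r (n2P _ B0).
Qed.

(** The composite of the averages of lengths [m] and [n], expanded. It agrees with the composite
    only almost everywhere ([ravgE2]), but its symmetry in [m] and [n] is an exact identity. *)
Definition ravg2 m n f x : R[i] := (m%:R^-1)%:C%C *
  \sum_(k < m) (n%:R^-1)%:C%C * \sum_(i < n) e (k + i)%N * P (k + i)%N f x.

Lemma ravg2C m n f : ravg2 m n f = ravg2 n m f.
Proof.
apply/funext => x; rewrite /ravg2 -!mulr_sumr mulrCA; congr (_ * (_ * _)).
rewrite exchange_big/=; apply: eq_bigr => i _; apply: eq_bigr => k _.
by rewrite addnC.
Qed.

Lemma ravgE2 m n B f : L1b B f ->
  {ae mu, forall x, ravg m (ravg n f) x = ravg2 m n f x}.
Proof.
move=> Lf; have [lf _] := Lf.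
have h : {ae mu, forall x, forall k, P k (ravg n f) x =
    (n%:R^-1)%:C%C * \sum_(i < n) e i * P (k + i)%N f x}.
  apply: ae_foralln => k.
  have lsum : cL1Loo mu (fun x => \sum_(i < n) e i * P i f x).
    by apply: (cL1Loo_sum mu0) => i; exact: L1b_inc (L1bP i Lf).
  have h1 := opZ mu0 (dss_ext Pds k) ((n%:R^-1 : R)%:C%C) lsum.
  have h2 := op_sum mu0 (dss_ext Pds k) (fun i : 'I_n => e i)
    (fun i : 'I_n => L1b_inc (L1bP i Lf)).
  have h3 : {ae mu, forall x, forall i, P (k + i)%N f x = P k (P i f) x}.
    by apply: ae_foralln => i; have := dssD Pds k i lf; apply: filterS => x ->.
  apply: filterS3 h1 h2 h3 => x h1 h2 h3; rewrite /ravg h1// h2//.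
  by congr (_ * _); apply: eq_bigr => i _; rewrite h3.
apply: filterS h => x h; rewrite /ravg /ravg2; congr (_ * _).
apply: eq_bigr => k _; rewrite h mulrCA; congr (_ * _).
by rewrite mulr_sumr; apply: eq_bigr => i _; rewrite eD mulrA.
Qed.

(* A telescoping identity: shifting the window of an average of length [n] by
   [k] only changes [k] terms at each end. *)
Lemma shift_sum (F : nat -> R[i]) n k :
  \sum_(i < n) F (k + i)%N - \sum_(i < n) F i =
  \sum_(i < k) F (n + i)%N - \sum_(i < k) F i.
Proof.
have h a b : \sum_(i < b) F (a + i)%N + \sum_(i < a) F i = \sum_(i < a + b) F i.
  by rewrite big_split_ord/= addrC.
apply/eqP; rewrite subr_eq addrAC eq_sym subr_eq; apply/eqP.
by rewrite h addnC -h.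
Qed.

Lemma ravg2_sub m n f x : (0 < m)%N -> ravg2 m n f x - ravg n f x =
  (m%:R^-1)%:C%C * \sum_(k < m) ((n%:R^-1)%:C%C *
    (\sum_(i < k) e (n + i)%N * P (n + i)%N f x - \sum_(i < k) e i * P i f x)).
Proof.
move=> m0.
have mm : (m%:R^-1)%:C%C * m%:R = 1 :> R[i].
  have -> : m%:R = (m%:R : R)%:C%C :> R[i] by rewrite rmorph_nat.
  by rewrite -rmorphM mulVf ?pnatr_eq0 -?lt0n.
have -> : ravg n f x = (m%:R^-1)%:C%C * \sum_(k < m) ravg n f x.
  by rewrite sumr_const card_ord -[X in _ * X]mulr_natl mulrA mm mul1r.
rewrite /ravg2 -mulrBr; congr (_ * _); rewrite -sumrB; apply: eq_bigr => k _.
rewrite /ravg -mulrBr; congr (_ * _).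
by rewrite (shift_sum (fun i => e i * P i f x)).
Qed.

(** A long average is almost invariant under a short one: each shift by [k < m] exchanges [k] terms
    at either end, of total size at most [2 m B / n]. *)
Lemma ravg2_near B m n f : 0 <= B -> (0 < m)%N -> (0 < n)%N -> L1b B f ->
  {ae mu, forall x, cnorm (ravg2 m n f x - ravg n f x) <= 2 * m%:R / n%:R * B}.
Proof.
move=> B0 m0 n0 Lf.
have h : {ae mu, forall x, forall k, cnorm (P k f x) <= B}.
  by apply: ae_foralln => k; case: (L1bP k Lf).
apply: filterS h => x h; rewrite ravg2_sub//.
have hk k : cnorm (e k * P k f x) <= B by rewrite cnormM e1 mul1r.
(* [avg_bound] wants a bound for every index, so the terms are extended by 0 beyond [m]. *)
pose F k := if (k < m)%N then (n%:R^-1)%:C%C *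
    (\sum_(i < k) e (n + i)%N * P (n + i)%N f x - \sum_(i < k) e i * P i f x) else 0.
rewrite (_ : \sum_(k < m) _ = \sum_(k < m) F k); last first.
  by apply: eq_bigr => k _; rewrite /F ltn_ord.
have C0 : 0 <= 2 * m%:R / n%:R * B by rewrite mulr_ge0// divr_ge0// mulr_ge0.
apply: avg_bound => // k; rewrite /F; case: ifPn => [km|_]; last by rewrite cnorm0.
rewrite cnormM cnorm_invn.
rewrite [leRHS](_ : _ = n%:R^-1 * (2 * m%:R * B)); last by ring.
rewrite ler_wpM2l ?invr_ge0//.
have s (G : nat -> R[i]) : (forall i, cnorm (G i) <= B) ->
    cnorm (\sum_(i < k) G i) <= m%:R * B.
  move=> GB; apply: le_trans (cnorm_sum _ _ _) _.
  apply: (@le_trans _ _ (\sum_(i < k) B)); first by apply: ler_sum => i _; exact: GB.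
  rewrite sumr_const card_ord -[leLHS]mulr_natl ler_wpM2r// ler_nat.
  exact: ltnW.
apply: le_trans (cnormB _ _) _; rewrite (_ : 2 * m%:R * B = m%:R * B + m%:R * B); last by ring.
by rewrite lerD//; [exact: (s (fun i => e (n + i)%N * P (n + i)%N f x))|exact: (s (fun i => e i * P i f x))].
Qed.

Lemma n2_ravg2_near B m n f : 0 <= B -> (0 < m)%N -> (0 < n)%N -> L1b B f ->
  n2 mu (fun x => ravg2 m n f x - ravg n f x) <= 2 * m%:R / n%:R * n2 mu f.
Proof.
move=> B0 m0 n0 Lf.
have l2P k : cLp mu 2%:E (fun x => e k * P k f x).
  by apply: cLpZ => //; exact: L1b_2 (L1bP k Lf).
have n2k k : n2 mu (fun x => e k * P k f x) <= n2 mu f.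
  by rewrite n2Z ?e1 ?mul1r ?(n2P _ B0)//; exact: L1b_2 (L1bP k Lf).
pose F k x := if (k < m)%N then (n%:R^-1)%:C%C *
    (\sum_(i < k) e (n + i)%N * P (n + i)%N f x - \sum_(i < k) e i * P i f x) else 0.
rewrite (_ : (fun x => _) = (fun x => (m%:R^-1)%:C%C * \sum_(k < m) F k x)); last first.
  apply/funext => x; rewrite ravg2_sub//; congr (_ * _).
  by apply: eq_bigr => k _; rewrite /F ltn_ord.
have C0 : 0 <= 2 * m%:R / n%:R * n2 mu f.
  by rewrite mulr_ge0 ?n2_ge0// divr_ge0// mulr_ge0.
have ls (a k : nat) : cLp mu 2%:E (fun x => \sum_(i < k) e (a + i)%N * P (a + i)%N f x).
  by apply: cLp_sum => // i _; exact: l2P.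
have ns (a k : nat) : (k < m)%N ->
    n2 mu (fun x => \sum_(i < k) e (a + i)%N * P (a + i)%N f x) <= m%:R * n2 mu f.
  move=> km; apply: le_trans (n2_sum (fun i : 'I_k => l2P (a + i)%N) (fun i : 'I_k => n2k (a + i)%N)) _.
  rewrite sumr_const card_ord -[leLHS]mulr_natl ler_wpM2r ?n2_ge0// ler_nat.
  exact: ltnW.
have lF k : cLp mu 2%:E (F k).
  rewrite /F; case: (k < m)%N; last exact: cLp0.
  by apply: cLpZ => //; apply: cLpB => //; exact: (ls 0%N).
apply: n2_avg => // k; case: (boolP (k < m)%N) => km; last first.
  rewrite (_ : F k = fun=> 0); last by apply/funext => x; rewrite /F (negbTE km).
  by rewrite /n2 cLnorm0.
rewrite (_ : F k = fun x => (n%:R^-1)%:C%C * (\sum_(i < k) e (n + i)%N * P (n + i)%N f x +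
    (-1) * \sum_(i < k) e (0 + i)%N * P (0 + i)%N f x)); last first.
  by apply/funext => x; rewrite /F km mulN1r.
rewrite n2Z ?cnorm_invn; last by apply: cLpD => //; apply: cLpZ.
rewrite [leRHS](_ : _ = n%:R^-1 * (m%:R * n2 mu f + m%:R * n2 mu f)); last by ring.
rewrite ler_wpM2l ?invr_ge0//; apply: le_trans (n2D _ _) _ => //; first exact: cLpZ.
by rewrite lerD ?ns// n2Z// cnormN cnorm1 mul1r ns.
Qed.

End discrete_ergodic.

Section discrete_convergence.
Context {d : measure_display} {T : measurableType d} {R : realType}.
Variable mu : {measure set T -> \bar R}.
Hypothesis mu0 : (0 < mu setT)%E.
Variable P : nat -> (T -> R[i]) -> T -> R[i].
Hypothesis Pds : ds_sequence mu P.
Variable e : nat -> R[i].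
Hypothesis (e0 : e 0 = 1) (eD : forall m n, e (m + n)%N = e m * e n)
  (e1 : forall n, cnorm (e n) = 1).
Implicit Types (f g h : T -> R[i]).

Local Notation N p f := (cLnorm mu p f).
Local Notation A := (ravg P e).
Local Notation AA := (ravg2 P e).
Local Notation n2 := (n2 mu).

Let le12 : 1 <= 2 :> R. Proof. by rewrite ler1n. Qed.

Lemma ravg_linD n B C f g : L1b mu B f -> L1b mu C g ->
  {ae mu, forall x, A n (fun y => f y + g y) x = A n f x + A n g x}.
Proof.
move=> Lf Lg.
have h : {ae mu, forall x, forall k, P k (fun y => f y + g y) x = P k f x + P k g x}.
  apply: ae_foralln => k.
  have := opD (dss_ext Pds k) (L1b_inc mu0 Lf) (L1b_inc mu0 Lg).
  by apply: filterS => x ->.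
apply: filterS h => x h; rewrite /ravg -mulrDr -big_split; congr (_ * _).
by apply: eq_bigr => k _; rewrite h mulrDr.
Qed.

Lemma ravg_linB n B C f g : L1b mu B f -> L1b mu C g ->
  {ae mu, forall x, A n (fun y => f y - g y) x = A n f x - A n g x}.
Proof.
move=> Lf Lg.
have h : {ae mu, forall x, forall k, P k (fun y => f y - g y) x = P k f x - P k g x}.
  apply: ae_foralln => k.
  have := opB (dss_ext Pds k) (L1b_inc mu0 Lf) (L1b_inc mu0 Lg).
  by apply: filterS => x ->.
apply: filterS h => x h; rewrite /ravg -mulrBr -sumrB; congr (_ * _).
by apply: eq_bigr => k _; rewrite h mulrBr.
Qed.

(** The weights [e k / n] for [k < n], padded with zeros up to [M], have bounds of sum 1, or 0 when
    [n = 0]; one set [E] serves all [n <= M]. *)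
Lemma maximal_ravg p (f : T -> R[i]) (l : R) (M : nat) :
  1 <= p -> cLp mu p%:E f -> 0 < l -> exists E, [/\ measurable E,
  ((l `^ p)%:E * mu E <= pint mu p f)%E &
  {ae mu, forall x, forall n, ~ E x -> (n <= M)%N -> cnorm (A n f x) <= 2 * l}].
Proof.
move=> p1 lf l0; have [E [mE muE EP]] := maximal_Lp mu0 Pds M p1 lf l0.
exists E; split => //.
apply: ae_foralln => n; have [nM|nM] := boolP (n <= M)%N; last exact: aeW.
pose w k : R[i] := if (k < n)%N then (n%:R^-1)%:C%C * e k else 0.
pose m k : R := if (k < n)%N then n%:R^-1 else 0.
have wm j k : (j <= k < M)%N -> cnorm (w k) <= m j.
  move=> /andP[jk kM]; rewrite /w /m; case: ifPn => kn.
    by rewrite (leq_ltn_trans jk kn) cnormM e1 mulr1 cnorm_invn.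
  by rewrite cnorm0; case: ifP => // _; rewrite invr_ge0.
apply: filterS (EP w m wm) => x h1 nE _; move: (h1 nE).
have -> : \sum_(j < M) m j = \sum_(j < n) n%:R^-1.
  by rewrite (big_ord_widen M (fun=> n%:R^-1) nM) [RHS]big_mkcond.
have -> : \sum_(j < M) w j * P j f x = A n f x.
  rewrite /ravg mulr_sumr.
  rewrite (big_ord_widen M (fun k => (n%:R^-1)%:C%C * (e k * P k f x)) nM).
  rewrite [RHS]big_mkcond; apply: eq_bigr => k _; rewrite /w.
  by case: ifP => _; rewrite ?mul0r// mulrA.
move/le_trans; apply; rewrite sumr_const card_ord -[X in _ * X]mulr_natl.
have [->|n0] := posnP n; first by rewrite mul0r mulr0 mulr_ge0// ltW.
by rewrite mulfV ?mulr1// pnatr_eq0 -lt0n.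
Qed.

Section fixed_function.
Variables (B : R) (g : T -> R[i]).
Hypotheses (B0 : 0 <= B) (Lg : L1b mu B g).

Let LA n : L1b mu B (A n g). Proof. exact: L1b_ravg. Qed.
Let LAA m n : L1b mu B (AA m n g).
Proof.
have [mA _] := L1b_ravg mu0 Pds e1 m B0 (LA n).
have mAA : cmeasurable setT (AA m n g).
  apply: cmeasurableZ; apply: cmeasurable_sum => k _; apply: cmeasurableZ.
  apply: cmeasurable_sum => i _; apply: cmeasurableZ.
  by case: (L1bP mu0 Pds (k + i)%N Lg) => -[].
have h := ravgE2 mu0 Pds eD m n Lg.
split; first by apply: (cLp_dom _ mAA mA) => //; apply: filterS h => x ->.
have [_ hB] := L1b_ravg mu0 Pds e1 m B0 (LA n).
by apply: filterS2 h hB => x <-.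
Qed.

Let l2A n := L1b_2 (LA n).
Let l2AA m n := L1b_2 (LAA m n).
Let mA n : cmeasurable setT (A n g). Proof. by case: (LA n) => -[]. Qed.
Let mAA m n : cmeasurable setT (AA m n g). Proof. by case: (LAA m n) => -[]. Qed.

Let n2AA m n : n2 (AA m n g) <= n2 (A n g).
Proof.
have [[mAA' _] _] := L1b_ravg mu0 Pds e1 m B0 (LA n).
rewrite -(n2_ae mAA' (mAA m n) (ravgE2 mu0 Pds eD m n Lg)).
exact: (n2_ravg mu0 Pds e1 m B0 (LA n)).
Qed.

(** [A t g] differs by at most [2 n / t] times the norm of [g] from [A t (A n g)], whose norm is at
    most that of [A n g]. *)
Let n2A_decr n t : (0 < n)%N -> (0 < t)%N ->
  n2 (A t g) <= n2 (A n g) + 2 * n%:R / t%:R * n2 g.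
Proof.
move=> n0 t0; have := n2_ravg2_near mu0 Pds e1 B0 n0 t0 Lg.
rewrite n2_distC => h.
have -> : A t g = fun x => AA n t g x + (A t g x - AA n t g x).
  by apply/funext => x; rewrite subrKC.
apply: le_trans (n2D (l2AA n t) (cLpB le12 (l2A t) (l2AA n t))) _.
by apply: lerD h; rewrite ravg2C.
Qed.

(** Apply the contraction [A v] with [v] large: it sends both [A t g] and [A s g] close to [A v g],
    so the sum has norm nearly at least that of [2 * A v g]. *)
Let n2A_sum_ge (alpha : R) t s : (0 < t)%N -> (0 < s)%N ->
  (forall v, (0 < v)%N -> alpha <= n2 (A v g)) ->
  2 * alpha <= n2 (fun x => A t g x + A s g x).
Proof.
move=> t0 s0 ha; set w := fun x => _.
have Lw : L1b mu (B + B) w by exact: L1bD (LA t) (LA s).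
apply: le_of_forall_eps => eps eps0.
have K0 : 0 <= 2 * (t + s)%N%:R * n2 g by rewrite mulr_ge0 ?n2_ge0// mulr_ge0.
pose v := (Num.bound (2 * (t + s)%N%:R * n2 g / eps)).+1.
have vb : (2 * (t + s)%N%:R * n2 g) / v%:R <= eps.
  rewrite ler_pdivrMr ?ltr0n// [leRHS]mulrC -ler_pdivrMr//.
  apply: le_trans (ltW (archi_boundP (divr_ge0 K0 (ltW eps0)))) _.
  by rewrite ler_nat /v leqnSn.
have v0 : (0 < v)%N by [].
have hw : n2 (A v w) <= n2 w by exact: (n2_ravg mu0 Pds e1 v (addr_ge0 B0 B0) Lw).
have eqw : n2 (A v w) = n2 (fun x => AA v t g x + AA v s g x).
  apply: n2_ae.
  - by case: (L1b_ravg mu0 Pds e1 v (addr_ge0 B0 B0) Lw) => -[].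
  - exact: cmeasurableD.
  have h1 := ravg_linD v (LA t) (LA s).
  have h2 := ravgE2 mu0 Pds eD v t Lg; have h3 := ravgE2 mu0 Pds eD v s Lg.
  by apply: filterS3 h1 h2 h3 => x h1 h2 h3; rewrite h1 h2 h3.
have := n2_ravg2_near mu0 Pds e1 B0 t0 v0 Lg.
have := n2_ravg2_near mu0 Pds e1 B0 s0 v0 Lg.
rewrite (ravg2C P e t) (ravg2C P e s) => hs ht.
have av := ha v v0.
have : 2 * n2 (A v g) <= n2 (fun x => AA v t g x + AA v s g x) +
    (n2 (fun x => AA v t g x - A v g x) + n2 (fun x => AA v s g x - A v g x)).
  have -> : 2 * n2 (A v g) = n2 (fun x => 2%:R * A v g x).
    rewrite n2Z//; congr (_ * _).
    have -> : 2%:R = (2%:R : R)%:C%C :> R[i] by rewrite rmorph_nat.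
    by rewrite cnorm_real ger0_norm.
  have -> : (fun x => 2%:R * A v g x) = (fun x => (AA v t g x + AA v s g x) +
      ((-1) * (AA v t g x - A v g x) + (-1) * (AA v s g x - A v g x))).
    by apply/funext => x; ring.
  have l1 k : cLp mu 2%:E (fun x => AA v k g x - A v g x) by exact: cLpB.
  have l3 k : cLp mu 2%:E (fun x => (-1) * (AA v k g x - A v g x)) by exact: cLpZ.
  apply: le_trans (n2D (cLpD le12 (l2AA v t) (l2AA v s)) (cLpD le12 (l3 t) (l3 s))) _.
  rewrite lerD2l; apply: le_trans (n2D (l3 t) (l3 s)) _.
  by rewrite !n2Z// cnormN cnorm1 !mul1r.
rewrite -eqw.
have : 2 * t%:R / v%:R * n2 g + 2 * s%:R / v%:R * n2 g <= eps.
  apply: le_trans vb; rewrite natrD le_eqVlt; apply/orP; left; apply/eqP; ring.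
lra.
Qed.

(** The mean ergodic theorem by near-minimal norms: with [alpha] the infimum of the norms, late
    averages have norm close to [alpha] while their sums have norm at least [2 alpha], so the
    parallelogram law makes their differences small. *)
Lemma n2_ravg_cauchy (eta : R) : 0 < eta -> exists2 K, (0 < K)%N &
  forall t s, (K <= t)%N -> (K <= s)%N ->
  (n2 (fun x => A t g x - A s g x)) ^+ 2 <= eta.
Proof.
move=> eta0.
pose X := [set y | exists2 n, (0 < n)%N & y = n2 (A n g)].
have X0 : X (n2 (A 1 g)) by exists 1%N.
have lbX : lbound X 0 by move=> _ [n _ ->]; exact: n2_ge0.
have infX : has_inf X by split; [exists (n2 (A 1 g))|exists 0].
pose alpha := inf X.
have alpha0 : 0 <= alpha by apply: lb_le_inf => //; exists (n2 (A 1 g)).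
have alphaP v : (0 < v)%N -> alpha <= n2 (A v g).
  by move=> v0; apply: ge_inf; [exists 0|exists v].
(* The parallelogram law leaves [4 (alpha + 2 de)^2 - 4 alpha^2 = 16 alpha de + 16 de^2], which is
   at most [de (16 alpha + 16)] as [de <= 1]. *)
pose de := Num.min 1 (eta / (16 * alpha + 16)).
have q0 : 0 < 16 * alpha + 16 by rewrite ltr_wpDl// mulr_ge0.
have de0 : 0 < de by rewrite lt_min ltr01 divr_gt0.
have de1 : de <= 1 by rewrite ge_min lexx.
have de2 : de * (16 * alpha + 16) <= eta.
  by rewrite -ler_pdivlMr// ge_min lexx orbT.
have [_ [n n0 ->] nlt] := inf_adherent de0 infX.
have M0 : 0 <= 2 * n%:R * n2 g by rewrite mulr_ge0 ?n2_ge0// mulr_ge0.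
pose K := (Num.bound (2 * n%:R * n2 g / de)).+1.
have bd t : (K <= t)%N -> n2 (A t g) <= alpha + 2 * de.
  move=> Kt; have t0 : (0 < t)%N by exact: leq_trans Kt.
  apply: le_trans (n2A_decr n0 t0) _.
  have : 2 * n%:R / t%:R * n2 g <= de.
    rewrite mulrAC ler_pdivrMr ?ltr0n// [leRHS]mulrC -ler_pdivrMr//.
    apply: le_trans (ltW (archi_boundP (divr_ge0 M0 (ltW de0)))) _.
    by rewrite ler_nat (leq_trans _ Kt)// leqnSn.
  by rewrite -/alpha in nlt; move: nlt; lra.
exists K => // t s Kt Ks.
have t0 : (0 < t)%N by exact: leq_trans Kt.
have s0 : (0 < s)%N by exact: leq_trans Ks.
have := n2_parallelogram (l2A t) (l2A s).
have := n2A_sum_ge t0 s0 alphaP.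
have := bd t Kt; have := bd s Ks.
have := n2_ge0 mu (A t g); have := n2_ge0 mu (A s g).
set p := n2 _; set q := n2 _; set a := n2 _; set b := n2 _.
move=> p0 q_0 pb qb ab par.
have H1 : p ^+ 2 <= (alpha + 2 * de) ^+ 2 by rewrite lerXn2r ?nnegrE//; lra.
have H2 : q ^+ 2 <= (alpha + 2 * de) ^+ 2 by rewrite lerXn2r ?nnegrE//; lra.
have H3 : (2 * alpha) ^+ 2 <= a ^+ 2 by rewrite lerXn2r ?nnegrE//; lra.
have : b ^+ 2 = 2 * q ^+ 2 + 2 * p ^+ 2 - a ^+ 2 by rewrite -par; ring.
move=> ->; apply: le_trans de2; move: H1 H2 H3; rewrite sqrrD !exprMn.
have : de ^+ 2 <= de by rewrite expr2 ger_pMl.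
nra.
Qed.

(* For a fixed horizon [N0], [A n h - h] with [h = A u g] is compared with
   [A n (h - A v g) - (h - A v g)], where [v] is so large that [A v g] is almost
   invariant under [A n] for [n <= N0]. *)
Lemma discrete_au_cauchy (eps de : R) : 0 < eps -> 0 < de ->
  exists E (n0 : nat), [/\ measurable E, (mu E <= eps%:E)%E &
  {ae mu, forall x, ~ E x -> forall m n, (n0 <= m)%N -> (n0 <= n)%N ->
    cnorm (A m g x - A n g x) <= de}].
Proof.
(* Late averages will be within [6 l] of [h], hence within [12 l] of one another. *)
move=> eps0 de0; pose l := de / 12.
have l0 : 0 < l by rewrite divr_gt0.
have eta0 : 0 < l ^+ 2 * eps by rewrite mulr_gt0// exprn_gt0.
have [u u0 uC] := n2_ravg_cauchy eta0.
pose h := A u g.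
have Lh : L1b mu B h by exact: LA.
have mh : cmeasurable setT h by exact: mA.
have mAh n : cmeasurable setT (A n h).
  by case: (L1b_ravg mu0 Pds e1 n B0 Lh) => -[].
(* The [5 l] is [2 l + 2 l] from the maximal inequality for [ev], at lengths [n.+1] and 1, plus [l]
   from the near invariance of [A v g]. The shift [n.+1] excludes the average of length 0, which is
   0. *)
pose F n := [set x | 5 * l < cnorm (A n.+1 h x - h x)].
have mF n : measurable (F n).
  by apply: measurable_cnorm_gt; exact: cmeasurableB.
pose G N := \bigcup_(n in `I_N) F n.
have mG N : measurable (G N) by apply: bigcup_measurable => n _.
(* The bound does not depend on the horizon although [v] does, so it passes to the union of the
   increasing sets [G N]. *)
have GE (N0 : nat) : (mu (G N0) <= eps%:E)%E.
  pose v := maxn u (Num.bound (2 * N0%:R * B / l)).+1.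
  have uv : (u <= v)%N by exact: leq_maxl.
  have v0 : (0 < v)%N by rewrite /v leq_max orbT.
  have vb : 2 * N0%:R / v%:R * B <= l.
    rewrite mulrAC ler_pdivrMr ?ltr0n// [leRHS]mulrC -ler_pdivrMr//.
    apply: le_trans (ltW (archi_boundP _)) _.
      by rewrite divr_ge0 ?(ltW l0)// mulr_ge0// mulr_ge0.
    by rewrite ler_nat /v leq_max leqnSn orbT.
  pose ev x := h x - A v g x.
  have Lev : L1b mu (B + B) ev by exact: L1bB (LA u) (LA v).
  have [E [mE muE EP]] := maximal_ravg N0.+1 le12 (L1b_2 Lev) l0.
  have muE' : (mu E <= eps%:E)%E.
    have l20 : 0 < l ^+ 2 by rewrite exprn_gt0.
    have : ((l ^+ 2)%:E * mu E <= (l ^+ 2)%:E * eps%:E)%E.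
      rewrite -[X in (X%:E * mu E)%E]powR_mulrn ?(ltW l0)//; apply: le_trans muE _.
      rewrite pint2E; last exact: L1b_2 Lev.
      by rewrite -EFinM lee_fin; exact: uC.
    by rewrite lee_pmul2l// lte_fin.
  apply: le_trans muE'; apply: le_measure_ae => //.
  have vN n : (0 < n)%N -> (n <= N0)%N -> 2 * n%:R / v%:R * B <= l.
    move=> _ nN; apply: le_trans vb; rewrite ler_wpM2r// ler_wpM2r ?invr_ge0//.
    by rewrite ler_wpM2l// ler_nat.
  have h1 : {ae mu, forall x, forall n, (n < N0)%N ->
      cnorm (AA n.+1 v g x - A v g x) <= l}.
    apply: ae_foralln => n; have [nN|nN] := boolP (n < N0)%N; last exact: aeW.
    have := ravg2_near mu0 Pds e1 B0 (ltn0Sn n) v0 Lg.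
    by apply: filterS => x /le_trans hx _; apply: hx; exact: vN.
  have h2 : {ae mu, forall x, forall n, A n (A v g) x = AA n v g x}.
    by apply: ae_foralln => n; exact: (ravgE2 mu0 Pds eD n v Lg).
  have h3 : {ae mu, forall x, forall n, A n ev x = A n h x - A n (A v g) x}.
    by apply: ae_foralln => n; exact: (ravg_linB n (LA u) (LA v)).
  have h4 : {ae mu, forall x, A 1 ev x = ev x}.
    have := dss0 Pds (proj1 Lev); apply: filterS => x hx.
    by rewrite /ravg big_ord1 e0 invr1 !mul1r hx.
  apply: filterS3 (filterI EP h4) h2 (filterI h1 h3) => x [EPx h4x] h2x [h1x h3x].
  move=> [n nN Fn]; apply: contrapT => nE; move: Fn; apply/negP; rewrite -leNgt.
  have a1 := EPx n.+1 nE (leq_trans nN (leqnSn _)).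
  have a2 := EPx 1%N nE (ltn0Sn _).
  rewrite h4x in a2; rewrite h3x h2x in a1.
  rewrite (_ : A n.+1 h x - h x = ((A n.+1 h x - AA n.+1 v g x) - ev x) +
    (AA n.+1 v g x - A v g x)); last by rewrite /ev; ring.
  apply: le_trans (cnormD _ _) _; apply: le_trans (lerD (cnormB _ _) (h1x n nN)) _.
  by move: a1 a2; lra.
pose n0 := (Num.bound (2 * u%:R * B / l)).+1.
exists (\bigcup_N G N), n0; split.
- exact: bigcupT_measurable.
- apply: mu_bigcup_nondecreasing_le => //.
  move=> N M NM; apply/subsetPset => x [k kN Fk]; exists k => //.
  exact: leq_trans NM.
have h1 : {ae mu, forall x, forall n, (n0 <= n)%N ->
    cnorm (AA u n g x - A n g x) <= l}.
  apply: ae_foralln => n; have [nN|nN] := boolP (n0 <= n)%N; last exact: aeW.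
  have n1 : (0 < n)%N by exact: leq_trans nN.
  have := ravg2_near mu0 Pds e1 B0 u0 n1 Lg.
  apply: filterS => x /le_trans hx _; apply: hx.
  rewrite mulrAC ler_pdivrMr ?ltr0n// [leRHS]mulrC -ler_pdivrMr//.
  apply: le_trans (ltW (archi_boundP _)) _.
      by rewrite divr_ge0 ?(ltW l0)// mulr_ge0// mulr_ge0.
  by rewrite ler_nat (leq_trans _ nN)// leqnSn.
have h2 : {ae mu, forall x, forall n, A n h x = AA n u g x}.
  by apply: ae_foralln => n; exact: (ravgE2 mu0 Pds eD n u Lg).
apply: filterS2 h1 h2 => x h1 h2 nE.
have key n : (n0 <= n)%N -> cnorm (A n g x - h x) <= 6 * l.
  move=> n0n; have n1 : (0 < n)%N by exact: leq_trans n0n.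
  have hF : cnorm (A n h x - h x) <= 5 * l.
    rewrite leNgt; apply/negP => hF; apply: nE; exists n => //.
    by exists n.-1; rewrite /F /= ?ltn_predL ?prednK.
  have := h1 n n0n; rewrite (ravg2C P e u) -h2 cnorm_distC => hn.
  apply: le_trans (cnorm_triangle _ _ (A n h x)) _.
  by move: hn hF; lra.
move=> m n n0m n0n; apply: le_trans (cnorm_triangle _ _ (h x)) _.
rewrite (cnorm_distC (h x)).
by have := key m n0m; have := key n n0n; rewrite /l; lra.
Qed.

End fixed_function.
End discrete_convergence.

(** * Simple functions and the Bochner integral *)

Section lebesgue_completed.
Context {R : realType}.

Lemma leb_measurable (A : set R) :
  measurable (A : set (measurableTypeR R)) -> measurable (A : set (lebesgueTypeR R)).
Proof. by move=> mA; apply: sub_caratheodory; exact: mA. Qed.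

Lemma leb_itv (i : interval R) : leb ([set` i] : set (lebesgueTypeR R)) =
  (if (i.1 < i.2)%E then (i.2 - i.1)%E else 0%E).
Proof. exact: lebesgue_measure_itv. Qed.

Lemma leb_measurable_itv (i : interval R) :
  measurable ([set` i] : set (lebesgueTypeR R)).
Proof. by apply: leb_measurable; exact: measurable_itv. Qed.

Lemma leb_cc (t : R) : 0 <= t -> leb (`[0, t]%classic : set (lebesgueTypeR R)) = t%:E.
Proof.
move=> t0; rewrite leb_itv /= lte_fin; case: ltP => ht.
  by rewrite oppr0 adde0.
by congr EFin; apply/eqP; rewrite eq_le t0 ht.
Qed.

End lebesgue_completed.

Section simple_functions.
Context {d : measure_display} {T : measurableType d} {R : realType}.
Variable mu : {measure set T -> \bar R}.
Variables (p t : R).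
Hypotheses (p1 : 1 <= p) (t0 : 0 <= t).

Local Notation L := (lebesgueTypeR R).
Local Notation N f := (cLnorm mu p%:E f).
Local Notation D := (`[0%R, t]%classic : set L).

Let mD : measurable D. Proof. exact: leb_measurable_itv. Qed.

Section atoms.
Variable S : Lp_simple mu p%:E t.

Local Notation n := (lps_size S).
Local Notation E := (@lps_set _ _ _ _ _ _ S).
Local Notation g := (@lps_val _ _ _ _ _ _ S).

(** The sets of a simple function may overlap. [J s] records which of them contain [s]; its level
    sets partition [[0, t]], and the value of the simple function depends on [s] only through
    [J s]. *)
Let J (s : L) : {ffun 'I_n -> bool} := [ffun i => s \in E i].

Let atom (c : {ffun 'I_n -> bool}) : set L := [set s | D s /\ J s = c].

Let measurable_atom c : measurable (atom c).
Proof.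
pose F i : set L := if c i then E i else ~` E i.
have -> : atom c = D `&` \bigcap_(i in [set: 'I_n]) F i.
  apply/seteqP; split => s [Ds].
    move=> Jc; split => // i _; rewrite /F -Jc ffunE.
    by case: ifPn => [/set_mem//|/negP sE]; move=> /mem_set.
  move=> sF; split => //; apply/ffunP => i; have := sF i Logic.I.
  by rewrite /F ffunE; case: (c i) => [/mem_set//|sE]; apply/negbTE/negP => /set_mem.
apply: measurableI => //; apply: fin_bigcap_measurable => // i _.
by rewrite /F; case: (c i); [|apply: measurableC]; exact: lps_measurable.
Qed.

Let measurable_J (psi : {ffun 'I_n -> bool} -> \bar R) :
  measurable_fun D (fun s => psi (J s)).
Proof.
move=> _ B mB.
have -> : D `&` (fun s => psi (J s)) @^-1` B =
    \bigcup_(c in [set c | B (psi c)]) atom c.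
  apply/seteqP; split => [s [Ds Bs]|s [c Bc [Ds Jc]]]; first by exists (J s).
  by split => //=; rewrite Jc.
exact: fin_bigcup_measurable.
Qed.

Let integral_J (psi : {ffun 'I_n -> bool} -> \bar R) : (forall c, (0 <= psi c)%E) ->
  (\int[leb]_(s in D) psi (J s) = \sum_c psi c * leb (atom c))%E.
Proof.
move=> psi0.
transitivity (\int[leb]_(s in D) (\sum_c psi c * (\1_(atom c) s)%:E))%E.
  apply: eq_integral => s; rewrite inE => Ds.
  rewrite (bigD1 (J s))//= [X in (_ + X)%E]big1 ?adde0; last first.
    move=> c cJ; rewrite indicE memNset ?mule0//= => -[_ Jc].
    by rewrite Jc eqxx in cJ.
  by rewrite indicE mem_set ?mule1.
have m1 c : measurable_fun D (fun s : L => (\1_(atom c) s)%:E).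
  by apply/measurable_EFinP; exact: measurable_indic.
have mpsi c : measurable_fun D (fun s : L => psi c * (\1_(atom c) s)%:E)%E.
  exact: measurable_funeM.
rewrite ge0_integral_sum//; last by move=> c s _; rewrite mule_ge0.
apply: eq_bigr => c _; rewrite ge0_integralZl//.
by rewrite integral_indic// setIidl// => s [].
Qed.

Let leb_set i : (leb (E i) = \sum_(c : {ffun 'I_n -> bool}) (c i)%:R%:E * leb (atom c))%E.
Proof.
rewrite -(@integral_J (fun c : {ffun 'I_n -> bool} => (c i)%:R%:E)); last by move=> c; rewrite lee_fin.
transitivity (\int[leb]_(s in D) (\1_(E i) s)%:E)%E.
  by rewrite integral_indic// ?setIidl//; [exact: lps_sub|exact: lps_measurable].
by apply: eq_integral => s _; rewrite indicE ffunE.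
Qed.

Let atom_fin c : leb (atom c) \is a fin_num.
Proof.
rewrite ge0_fin_numE//; apply: (@le_lt_trans _ _ (leb D)).
  by apply: le_measure; rewrite ?inE// => s [].
by rewrite leb_cc// ltry.
Qed.

Let phi (c : {ffun 'I_n -> bool}) : \bar R :=
  N (fun x => \sum_i ((c i)%:R : R)%:C%C * g i x).

Let lps_fun_phi s : N (lps_fun S s) = phi (J s).
Proof.
rewrite /phi; congr cLnorm; apply/funext => x; apply: eq_bigr => i _.
by rewrite ffunE indicE.
Qed.

Lemma measurable_lps_norm : measurable_fun D (fun s => N (lps_fun S s)).
Proof.
rewrite (_ : (fun s => _) = (fun s => phi (J s))); first exact: measurable_J.
by apply/funext => s; exact: lps_fun_phi.
Qed.

(** Once both sides are written over the disjoint atoms, this is the triangle inequality. *)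
Lemma lps_integral_le :
  (N (lps_integral S) <= \int[leb]_(s in D) N (lps_fun S s))%E.
Proof.
have -> : (\int[leb]_(s in D) N (lps_fun S s) = \int[leb]_(s in D) phi (J s))%E.
  by apply: eq_integral => s _; exact: lps_fun_phi.
rewrite integral_J; last by move=> c; exact: cLnorm_ge0.
have lset i : fine (leb (E i)) = \sum_(c : {ffun 'I_n -> bool}) (c i)%:R * fine (leb (atom c)).
  rewrite leb_set -sum_fine; last by move=> c _; rewrite fin_numM.
  by apply: eq_bigr => c _; rewrite fineM.
have mphi (c : {ffun 'I_n -> bool}) :
    cLp mu p%:E (fun x => \sum_i ((c i)%:R : R)%:C%C * g i x).
  by apply: cLp_sum => // i _; apply: cLpZ => //; exact: lps_Lp.
have -> : lps_integral S = (fun x => \sum_(c : {ffun 'I_n -> bool}) (fine (leb (atom c)))%:C%C *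
    \sum_i ((c i)%:R : R)%:C%C * g i x).
  apply/funext => x; rewrite /lps_integral.
  under eq_bigr do rewrite lset rmorph_sum mulr_suml.
  rewrite exchange_big; apply: eq_bigr => c _; rewrite mulr_sumr.
  by apply: eq_bigr => i _; rewrite rmorphM/= mulrA; congr (_ * _); rewrite mulrC.
apply: le_trans (cLnorm_sum mu _ p1 _) _.
  by move=> c; apply: cmeasurableZ; case: (mphi c).
apply: lee_sum => c _; rewrite cLnormZ//; last by case: (mphi c).
rewrite cnorm_real ger0_norm ?fine_ge0// fineK//.
by rewrite muleC.
Qed.

End atoms.

(** Ties a function to its integral while hiding the representing record, so that sums can be formed
    and rewritten pointwise. *)
Definition simple_rep (F : R -> T -> R[i]) (G : T -> R[i]) :=
  exists S : Lp_simple mu p%:E t, lps_fun S = F /\ lps_integral S = G.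

Lemma simple_rep0 : simple_rep (fun _ _ => 0) (fun=> 0).
Proof.
have f0 (i : 'I_0) : False by case: i.
exists (@LpSimple _ _ _ mu p%:E t 0 (fun=> set0) (fun _ _ => 0)
  (fun i => False_ind _ (f0 i)) (fun i => False_ind _ (f0 i))
  (fun i => False_ind _ (f0 i))); split.
  by apply/funext => s; apply/funext => x; rewrite /lps_fun big_ord0.
by apply/funext => x; rewrite /lps_integral big_ord0.
Qed.

Lemma simple_rep1 (E : set L) (g : T -> R[i]) : measurable E -> E `<=` D ->
  cLp mu p%:E g -> simple_rep (fun s x => (\1_E s : R)%:C%C * g x)
    (fun x => (fine (leb E))%:C%C * g x).
Proof.
move=> mE ED lg.
exists (@LpSimple _ _ _ mu p%:E t 1 (fun=> E) (fun=> g)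
  (fun=> mE) (fun=> ED) (fun=> lg)); split.
  by apply/funext => s; apply/funext => x; rewrite /lps_fun big_ord1.
by apply/funext => x; rewrite /lps_integral big_ord1.
Qed.

Lemma simple_repD F1 G1 F2 G2 : simple_rep F1 G1 -> simple_rep F2 G2 ->
  simple_rep (fun s x => F1 s x + F2 s x) (fun x => G1 x + G2 x).
Proof.
move=> [S1 [F1E G1E]] [S2 [F2E G2E]].
pose n1 := lps_size S1; pose n2 := lps_size S2.
pose E (i : 'I_(n1 + n2)) := match fintype.split i with
  inl j => @lps_set _ _ _ _ _ _ S1 j | inr k => @lps_set _ _ _ _ _ _ S2 k end.
pose g (i : 'I_(n1 + n2)) := match fintype.split i with
  inl j => @lps_val _ _ _ _ _ _ S1 j | inr k => @lps_val _ _ _ _ _ _ S2 k end.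
have mE i : measurable (E i).
  by rewrite /E; case: (fintype.split i) => j; exact: lps_measurable.
have ED i : E i `<=` `[0, t].
  by rewrite /E; case: (fintype.split i) => j; exact: lps_sub.
have lg i : cLp mu p%:E (g i).
  by rewrite /g; case: (fintype.split i) => j; exact: lps_Lp.
have El j : fintype.split (lshift n2 j) = inl j :> 'I_n1 + 'I_n2.
  exact: (unsplitK (inl _ j)).
have Er j : fintype.split (rshift n1 j) = inr j :> 'I_n1 + 'I_n2.
  exact: (unsplitK (inr _ j)).
exists (@LpSimple _ _ _ mu p%:E t (n1 + n2) E g mE ED lg); split.
  apply/funext => s; apply/funext => x; rewrite -F1E -F2E /lps_fun /=.
  rewrite big_split_ord/=; congr (_ + _); apply: eq_bigr => j _.
    by rewrite /E /g El.
  by rewrite /E /g Er.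
apply/funext => x; rewrite -G1E -G2E /lps_integral /=.
rewrite big_split_ord/=; congr (_ + _); apply: eq_bigr => j _.
  by rewrite /E /g El.
by rewrite /E /g Er.
Qed.

Lemma simple_rep_sum (I : Type) (r : seq I) (F : I -> R -> T -> R[i]) G :
  (forall i, simple_rep (F i) (G i)) ->
  simple_rep (fun s x => \sum_(i <- r) F i s x) (fun x => \sum_(i <- r) G i x).
Proof.
move=> FG; elim: r => [|i r ih].
  have := simple_rep0; congr simple_rep.
    by apply/funext => s; apply/funext => x; rewrite big_nil.
  by apply/funext => x; rewrite big_nil.
have := simple_repD (FG i) ih; congr simple_rep.
  by apply/funext => s; apply/funext => x; rewrite big_cons.
by apply/funext => x; rewrite big_cons.
Qed.

Lemma simple_repN F G : simple_rep F G ->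
  simple_rep (fun s x => - F s x) (fun x => - G x).
Proof.
move=> [S [FE GE]].
exists (@LpSimple _ _ _ mu p%:E t (lps_size S) (@lps_set _ _ _ _ _ _ S) (fun i x => - @lps_val _ _ _ _ _ _ S i x)
  (@lps_measurable _ _ _ _ _ _ S) (@lps_sub _ _ _ _ _ _ S)
  (fun i => cLpN (@lps_Lp _ _ _ _ _ _ S i))); split.
  apply/funext => s; apply/funext => x; rewrite -FE /lps_fun /= -sumrN.
  by apply: eq_bigr => i _; rewrite mulrN.
apply/funext => x; rewrite -GE /lps_integral /= -sumrN.
by apply: eq_bigr => i _; rewrite mulrN.
Qed.

Lemma simple_rep_le F G : simple_rep F G ->
  measurable_fun D (fun s => N (F s)) /\
  (N G <= \int[leb]_(s in D) N (F s))%E.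
Proof.
by move=> [S [<- <-]]; split; [exact: measurable_lps_norm|exact: lps_integral_le].
Qed.

Lemma simple_rep_cLp F G : simple_rep F G -> (forall s, cLp mu p%:E (F s)) /\ cLp mu p%:E G.
Proof.
move=> [S [<- <-]]; split => [s|]; apply: cLp_sum => // i _; apply: cLpZ => //;
  exact: lps_Lp.
Qed.

End simple_functions.

Section bochner.
Context {d : measure_display} {T : measurableType d} {R : realType}.
Variable mu : {measure set T -> \bar R}.
Variables (p t : R).
Hypotheses (p1 : 1 <= p) (t0 : 0 <= t).

Local Notation L := (lebesgueTypeR R).
Local Notation N f := (cLnorm mu p%:E f).
Local Notation D := (`[0%R, t]%classic : set L).

Let mD : measurable D. Proof. exact: leb_measurable_itv. Qed.

Lemma cLnorm_fin_num f : cLp mu p%:E f -> N f \is a fin_num.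
Proof. by move=> [_ lf]; rewrite ge0_fin_numE// cLnorm_ge0. Qed.

Lemma cLnorm_cvg (f h : T -> R[i]) (u : nat -> T -> R[i]) :
  cLp mu p%:E f -> cLp mu p%:E h -> (forall n, cLp mu p%:E (u n)) ->
  (N (fun x => (f x - u n x)%R) @[n --> \oo] --> 0%E) ->
  (N (fun x => (u n x - h x)%R) @[n --> \oo] --> N (fun x => (f x - h x)%R)).
Proof.
move=> lf lh lu fu.
have lfh : cLp mu p%:E (fun x => f x - h x) by exact: cLpB.
have luh n : cLp mu p%:E (fun x => u n x - h x) by exact: cLpB.
have lfu n : cLp mu p%:E (fun x => f x - u n x) by exact: cLpB.
have mf : cmeasurable setT f by case: lf.
have mh : cmeasurable setT h by case: lh.
have mu_ n : cmeasurable setT (u n) by case: (lu n).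
rewrite -(fineK (cLnorm_fin_num lfh)); apply: cvg_EFin.
  by apply: nearW => n; exact: cLnorm_fin_num.
apply/cvgrPdist_le => e e0.
have [K KP] := (ecvgn0P (fun n => cLnorm_ge0 mu p%:E _)).1 fu e e0.
exists K => // n /KP {KP} fue; rewrite /= ler_norml; apply/andP; split.
  rewrite lerBrDl lerBlDl -lee_fin EFinD !fineK ?cLnorm_fin_num//.
  apply: le_trans (cLnorm_triangle mu p1 (mu_ n) mh mf) _.
  by rewrite leeD2r// cLnorm_distC.
rewrite lerBlDr -lee_fin EFinD !fineK ?cLnorm_fin_num//.
apply: le_trans (cLnorm_triangle mu p1 mf mh (mu_ n)) _.
by rewrite leeD2r.
Qed.

(** For almost every [s] the distance from [F s] to [Phi m s] is the limit of the distances from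
    [Phi n s], which are measurable in [s]. The completed Lebesgue measure makes this almost
    everywhere equality sufficient. *)
Lemma measurable_bochner_dist (F : R -> T -> R[i]) (Phi : nat -> R -> T -> R[i])
    (I : nat -> T -> R[i]) (m : nat) :
  (forall s, 0 <= s <= t -> cLp mu p%:E (F s)) ->
  (forall n, simple_rep mu p t (Phi n) (I n)) ->
  {ae leb, forall s : L, 0 <= (s : R) <= t ->
    N (fun x => (F s x - Phi n s x)%R) @[n --> \oo] --> 0%E} ->
  measurable_fun D (fun s => N (fun x => (F s x - Phi m s x)%R)).
Proof.
move=> lF PI FP.
have lPhi n s : cLp mu p%:E (Phi n s) by case: (simple_rep_cLp p1 (PI n)).
pose w (s : L) := limn_esup (fun n => N (fun x => (Phi n s x - Phi m s x)%R)).
have mw : measurable_fun D w.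
  apply: measurable_fun_limn_esup => n.
  have := simple_repD (PI n) (simple_repN (PI m)).
  by move=> /(simple_rep_le p1 t0)[].
apply: (ae_measurable_fun (@completed_lebesgue_measure_is_complete R) _ mw).
apply: filterS FP => s FP /= Ds.
have Dst : 0 <= (s : R) <= t by move: Ds; rewrite in_itv.
have := cLnorm_cvg (lF s Dst) (lPhi m s) (fun n => lPhi n s) (FP Dst).
by move=> /cvg_limn_einf_sup[_ wE]; rewrite /w wE.
Qed.

(** Insert an approximating simple function [S n] from the definition: the norm of [S n - Phi] is at
    most [psi] plus the distance from [F] to [S n], whose integral vanishes in the limit. It applies
    to any Bochner integral of [F], in particular to the chosen representative. *)
Lemma bochner_compare (F : R -> T -> R[i]) (g : T -> R[i]) Phi I (psi : L -> \bar R) :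
  is_bochner_integral mu p%:E t F g -> simple_rep mu p t Phi I ->
  measurable_fun D psi -> (forall s, (0 <= psi s)%E) ->
  {ae leb, forall s : L, D s -> (N (fun x => (F s x - Phi s x)%R) <= psi s)%E} ->
  (N (fun x => (g x - I x)%R) <= \int[leb]_(s in D) psi s)%E.
Proof.
move=> [lF lg [S [S1 S2 S3]]] PI mpsi psi0 Fpsi.
have [lPhi lI] := simple_rep_cLp p1 PI.
have SS n : simple_rep mu p t (lps_fun (S n)) (lps_integral (S n)) by exists (S n).
have lS n s : cLp mu p%:E (lps_fun (S n) s) by case: (simple_rep_cLp p1 (SS n)).
have lIS n : cLp mu p%:E (lps_integral (S n)) by case: (simple_rep_cLp p1 (SS n)).
have mFS n := measurable_bochner_dist n lF SS S1.
apply/lee_addgt0Pr => e e0; have e20 : 0 < e / 2 by rewrite divr_gt0.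
have h2 := (ecvgn0P (fun n => integral_ge0 leb
  (fun s (_ : D s) => cLnorm_ge0 mu p%:E _))).1 S2 _ e20.
have h3 := (ecvgn0P (fun n => cLnorm_ge0 mu p%:E _)).1 S3 _ e20.
have [n [hn2 hn3]] : exists n,
    (\int[leb]_(s in D) N (fun x => (F s x - lps_fun (S n) s x)%R) <= (e / 2)%:E)%E /\
    (N (fun x => (g x - lps_integral (S n) x)%R) <= (e / 2)%:E)%E.
  have [K2 P2] := h2; have [K3 P3] := h3; exists (maxn K2 K3).
  by split; [apply: P2|apply: P3]; rewrite ?leq_maxl ?leq_maxr.
have mg : cmeasurable setT g by case: lg.
have mI : cmeasurable setT I by case: lI.
have mIS : cmeasurable setT (lps_integral (S n)) by case: (lIS n).
apply: le_trans (cLnorm_triangle mu p1 mg mI mIS) _.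
have -> : e%:E = ((e / 2)%:E + (e / 2)%:E)%E by rewrite -EFinD -splitr.
rewrite addeCA; apply: leeD => //.
have [mSP SP] := simple_rep_le p1 t0 (simple_repD (SS n) (simple_repN PI)).
apply: le_trans SP _.
apply: (@le_trans _ _ (\int[leb]_(s in D)
    (psi s + N (fun x => (F s x - lps_fun (S n) s x)%R)))%E); last first.
  by rewrite ge0_integralD// ?leeD2l// => s _; exact: cLnorm_ge0.
have mD' : measurable_fun D (fun s => psi s + N (fun x => (F s x - lps_fun (S n) s x)%R))%E.
  exact: emeasurable_funD.
apply: ae_ge0_le_integral => //.
- by move=> s _; exact: cLnorm_ge0.
- by move=> s _; rewrite adde_ge0// cLnorm_ge0.
apply: filterS Fpsi => s Fpsi Ds.
have Dst : 0 <= (s : R) <= t by move: Ds; rewrite /= in_itv.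
have mF : cmeasurable setT (F s) by case: (lF s Dst).
have mP : cmeasurable setT (Phi s) by case: (lPhi s).
have mS : cmeasurable setT (lps_fun (S n) s) by case: (lS n s).
apply: le_trans (cLnorm_triangle mu p1 mS mP mF) _.
by rewrite addeC leeD ?Fpsi// cLnorm_distC.
Qed.

(** The measurable majorants [psi n] make the integrals of the simple functions Cauchy in L^p before
    anything is known about the measurability of [F]. *)
Lemma bochner_exists (F : R -> T -> R[i]) Phi I (psi : nat -> L -> \bar R) :
  (forall s, 0 <= s <= t -> cLp mu p%:E (F s)) ->
  (forall n, simple_rep mu p t (Phi n) (I n)) ->
  (forall n, measurable_fun D (psi n)) -> (forall n s, (0 <= psi n s)%E) ->
  {ae leb, forall s : L, D s -> forall n,
    (N (fun x => (F s x - Phi n s x)%R) <= psi n s)%E} ->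
  {ae leb, forall s : L, 0 <= (s : R) <= t ->
    N (fun x => (F s x - Phi n s x)%R) @[n --> \oo] --> 0%E} ->
  (\int[leb]_(s in D) psi n s @[n --> \oo] --> 0)%E ->
  bochner_integrable mu p%:E t F.
Proof.
move=> lF PI mpsi psi0 Fpsi FPhi psicvg.
have lPhi n s : cLp mu p%:E (Phi n s) by case: (simple_rep_cLp p1 (PI n)).
have lI n : cLp mu p%:E (I n) by case: (simple_rep_cLp p1 (PI n)).
have ipsi0 n : (0 <= \int[leb]_(s in D) psi n s)%E by exact: integral_ge0.
have psicvg' := (ecvgn0P ipsi0).1 psicvg.
have Icauchy e : 0 < e -> exists K, forall m n, (K <= m)%N -> (K <= n)%N ->
    (N (fun x => (I m x - I n x)%R) <= e%:E)%E.
  move=> e0; have e20 : 0 < e / 2 by rewrite divr_gt0.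
  have [K KP] := psicvg' _ e20; exists K => m n Km Kn.
  have [mmn le_mn] := simple_rep_le p1 t0 (simple_repD (PI m) (simple_repN (PI n))).
  apply: le_trans le_mn _.
  apply: (@le_trans _ _ (\int[leb]_(s in D) (psi m s + psi n s))%E); last first.
    by rewrite ge0_integralD// (splitr e) EFinD leeD//; exact: KP.
  have mD' : measurable_fun D (fun s => psi m s + psi n s)%E by exact: emeasurable_funD.
  apply: ae_ge0_le_integral => //.
  - by move=> s _; exact: cLnorm_ge0.
  - by move=> s _; rewrite adde_ge0.
  apply: filterS Fpsi => s Fpsi Ds.
  have Dst : 0 <= (s : R) <= t by move: Ds; rewrite /= in_itv.
  have mF : cmeasurable setT (F s) by case: (lF s Dst).
  have mP k : cmeasurable setT (Phi k s) by case: (lPhi k s).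
  apply: le_trans (cLnorm_triangle mu p1 (mP m) (mP n) mF) _.
  by rewrite leeD ?Fpsi// cLnorm_distC Fpsi.
have [g lg gI] := riesz_fischer p1 lI Icauchy.
have /choice[S SP] : forall n, exists S : Lp_simple mu p%:E t,
  lps_fun S = Phi n /\ lps_integral S = I n by exact: PI.
exists g; split => //; exists S; split.
- apply: filterS FPhi => s FPhi Ds.
  rewrite (_ : (fun n => _) = (fun n => N (fun x => (F s x - Phi n s x)%R))).
    exact: FPhi.
  by apply/funext => n; rewrite (SP n).1.
- rewrite (_ : (fun n => _) = (fun n =>
      \int[leb]_(s in D) N (fun x => (F s x - Phi n s x)%R))%E); last first.
    by apply/funext => n; rewrite (SP n).1.
  apply/ecvgn0P => [n|e e0]; first by apply: integral_ge0 => s _; exact: cLnorm_ge0.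
  have [K KP] := psicvg' e e0; exists K => n /KP; apply: le_trans.
  have mdist := measurable_bochner_dist n lF PI FPhi.
  apply: ae_ge0_le_integral => //.
  + by move=> s _; exact: cLnorm_ge0.
  + by apply: filterS Fpsi => s Fpsi Ds; exact: Fpsi.
- apply/ecvgn0P => [n|e e0]; first exact: cLnorm_ge0.
  by have [K KP] := gI e e0; exists K => n Kn; rewrite (SP n).2; exact: KP.
Qed.

Lemma bochner_integralP (F : R -> T -> R[i]) : bochner_integrable mu p%:E t F ->
  is_bochner_integral mu p%:E t F (bochner_integral mu p%:E t F).
Proof. by move=> [g gP]; rewrite /bochner_integral; case: xgetP => [y -> //|/(_ g)]. Qed.

End bochner.

(** * Riemann sums *)

Section grid.
Context {R : realType}.
Variables (h t : R).
Hypotheses (h0 : 0 < h) (t0 : 0 <= t).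

Local Notation L := (lebesgueTypeR R).
Local Notation D := (`[0%R, t]%classic : set L).

(** Half-open intervals are disjoint; the strict inequality [t < M * h] is what puts the endpoint
    [t] into one of the first [M] cells. *)
Definition cell (j : nat) : set L :=
  (`[j%:R * h, j.+1%:R * h[%classic : set L) `&` D.

Lemma measurable_cell j : measurable (cell j).
Proof. by apply: measurableI; exact: leb_measurable_itv. Qed.

Lemma cell_sub j : cell j `<=` D. Proof. by move=> s []. Qed.

Lemma cellP j (s : L) : cell j s <->
  [/\ j%:R * h <= (s : R), (s : R) < j.+1%:R * h, 0 <= (s : R) & (s : R) <= t].
Proof.
rewrite /cell /= !in_itv /=; split; first by move=> [/andP[? ?] /andP[? ?]].
by move=> [-> -> -> ->].
Qed.

Lemma cell_uniq i j s : cell i s -> cell j s -> i = j.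
Proof.
have half a b : cell a s -> cell b s -> (a <= b)%N.
  move=> /cellP[a1 _ _ _] /cellP[_ b2 _ _].
  by rewrite -ltnS -(ltr_nat R) -(ltr_pM2r h0) (le_lt_trans a1).
by move=> ci cj; apply/eqP; rewrite eqn_leq !half.
Qed.

Lemma cell_cover M s : D s -> t < M%:R * h -> exists2 j, (j < M)%N & cell j s.
Proof.
move=> Ds tM; have /andP[s0 st] : 0 <= (s : R) <= t by move: Ds; rewrite /= in_itv.
have ex_j : exists j, (s : R) < j.+1%:R * h.
  exists M; apply: le_lt_trans st (lt_trans tM _).
  by rewrite ltr_pM2r// ltr_nat.
pose j := ex_minn ex_j.
have [sj jmin] : (s : R) < j.+1%:R * h /\ forall k, (s : R) < k.+1%:R * h -> (j <= k)%N.
  by rewrite /j; case: ex_minnP.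
have js : j%:R * h <= (s : R).
  case: (j) jmin => [|k] kmin; first by rewrite mul0r.
  by rewrite leNgt; apply/negP => /kmin; rewrite ltnn.
exists j; last by apply/cellP.
by rewrite -(ltr_nat R) -(ltr_pM2r h0) (le_lt_trans js)// (le_lt_trans st).
Qed.

Lemma sum_cell (V : pzRingType) M (X : nat -> V) j s : (j < M)%N -> cell j s ->
  \sum_(i < M) (\1_(cell i) s) * X i = X j.
Proof.
move=> jM cj; rewrite (bigD1 (Ordinal jM))//= big1 ?addr0; last first.
  move=> i ij; rewrite indicE memNset ?mul0r// => ci.
  by move: ij; rewrite -val_eqE/= (cell_uniq ci cj) eqxx.
by rewrite indicE mem_set// mul1r.
Qed.

(** This form telescopes and covers the full, the cut and the empty cells at once. *)
Definition cell_len j : R := Num.min (j.+1%:R * h) t - Num.min (j%:R * h) t.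

Lemma leb_cell j : leb (cell j) = (cell_len j)%:E.
Proof.
have jh : j%:R * h < j.+1%:R * h by rewrite ltr_pM2r// ltr_nat.
have jh0 : 0 <= j%:R * h by rewrite mulr_ge0// ltW.
rewrite /cell_len; have [tj|jt] := ltP t (j%:R * h).
  rewrite (min_idPr (ltW (lt_trans tj jh))) subrr.
  rewrite (_ : cell j = set0) ?measure0// -subset0 => s /cellP[js _ _ st].
  by have := lt_le_trans (le_lt_trans st tj) js; rewrite ltxx.
have [jt'|tj] := leP (j.+1%:R * h) t.
  rewrite (_ : cell j = `[j%:R * h, j.+1%:R * h[%classic).
    by rewrite leb_itv /= lte_fin jh.
  apply/seteqP; split => s; first by move=> [].
  move=> sj; move: (sj); rewrite /= in_itv/= => /andP[s1 s2].
  apply/cellP; split => //; first exact: le_trans s1.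
  exact: le_trans (ltW s2) _.
rewrite (_ : cell j = `[j%:R * h, t]%classic).
  rewrite leb_itv /= lte_fin; case: ltP => // tj'.
  by congr EFin; apply/esym/eqP; rewrite subr_eq0 eq_le jt tj'.
apply/seteqP; split => s.
  by move=> /cellP[s1 _ _ s4]; rewrite /= in_itv/= s1.
rewrite /= in_itv/= => /andP[s1 s2]; apply/cellP; split => //.
  exact: le_lt_trans tj.
exact: le_trans s1.
Qed.

Lemma cell_len_ge0 j : 0 <= cell_len j.
Proof. by rewrite -lee_fin -leb_cell measure_ge0. Qed.

(** Provides the decreasing bounds on the weights for [maximal_Lp], and the decreasing weights for
    [weighted_shift]. *)
Lemma cell_len_anti i j : (i <= j)%N -> cell_len j <= cell_len i.
Proof.
move=> ij; have h0' := h0; rewrite /cell_len -!natr1 !mulrDl !mul1r.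
have : i%:R * h <= j%:R * h by rewrite ler_wpM2r ?(ltW h0)// ler_nat.
move: (i%:R * h) (j%:R * h) => a b ab.
case: (leP (b + h) t) => h1; case: (leP b t) => h2;
  case: (leP (a + h) t) => h3; case: (leP a t) => h4; lra.
Qed.

Lemma sum_cell_lenE M : \sum_(j < M) cell_len j = Num.min (M%:R * h) t.
Proof.
elim: M => [|M ih]; first by rewrite big_ord0 mul0r (min_idPl t0).
by rewrite big_ord_recr /= ih /cell_len subrKC.
Qed.

Lemma sum_cell_len M : \sum_(j < M) cell_len j <= t.
Proof. by rewrite sum_cell_lenE ge_min lexx orbT. Qed.

Lemma sum_integral_cell M (w : L -> \bar R) : measurable_fun D w ->
  (forall s, (0 <= w s)%E) ->
  (\sum_(j < M) \int[leb]_(s in cell j) w s <= \int[leb]_(s in D) w s)%E.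
Proof.
move=> mw w0.
have mwc j : measurable_fun D (fun s => w s * (\1_(cell j) s)%:E)%E.
  apply: (emeasurable_funM mw); apply/measurable_EFinP.
  by apply: measurable_indic; exact: measurable_cell.
have msum : measurable_fun D (fun s => \sum_(j < M) w s * (\1_(cell j) s)%:E)%E.
  exact: emeasurable_sum.
rewrite (_ : (\sum_(j < M) _)%E =
    (\int[leb]_(s in D) \sum_(j < M) w s * (\1_(cell j) s)%:E)%E); last first.
  rewrite ge0_integral_sum//.
  - apply: eq_bigr => j _; rewrite -[X in integral _ X _](setIidr (@cell_sub j)).
    rewrite [LHS]integral_mkcondr; apply: eq_integral => s _.
    by rewrite epatch_indic.
  - exact: leb_measurable_itv.
  - by move=> j s _; rewrite mule_ge0// lee_fin.
apply: ge0_le_integral => //.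
- exact: leb_measurable_itv.
- by move=> s _; apply: sume_ge0 => j _; rewrite mule_ge0// lee_fin.
move=> s _; rewrite -ge0_sume_distrr//.
apply: (@le_trans _ _ (w s * 1)%E); last by rewrite mule1.
rewrite lee_wpmul2l// sumEFin lee_fin.
have [[j jM cj]|nc] := pselect (exists2 j, (j < M)%N & cell j s).
  by have := sum_cell (fun=> 1 : R) jM cj; under eq_bigr do rewrite mulr1; move=> ->.
rewrite big1// => j _; rewrite indicE memNset// => cj; apply: nc.
by exists j.
Qed.

End grid.

Section complex_integral.
Context {R : realType}.

Local Notation L := (lebesgueTypeR R).
Implicit Types (E : set L) (b c : R -> R[i]).

(** Complex integrals are estimated through their two components; comparing this norm with the
    modulus costs the factor 2 seen in [cnorm_cint_bound] and in later constants. *)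
Definition abs1 (z : R[i]) : R := `|complex.Re z| + `|complex.Im z|.

Lemma abs1_ge0 z : 0 <= abs1 z. Proof. by rewrite addr_ge0. Qed.

Lemma cnorm_le_abs1 z : cnorm z <= abs1 z. Proof. exact: cnorm_le_ReIm. Qed.

Lemma abs1_le_cnorm z : abs1 z <= 2 * cnorm z.
Proof.
by have := le_Re_cnorm z; have := le_Im_cnorm z; rewrite /abs1; lra.
Qed.

Lemma measurable_abs1 E b : cmeasurable E (b : L -> R[i]) ->
  measurable_fun E (fun s : L => (abs1 (b s))%:E).
Proof.
move=> [mr mi]; apply/measurable_EFinP; apply: measurable_funD.
  exact: measurableT_comp.
exact: measurableT_comp.
Qed.

Definition cint E b : R[i] := Complex
  (Rintegral leb E (fun s => complex.Re (b s))) (Rintegral leb E (fun s => complex.Im (b s))).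

Definition cintegrable E b :=
  leb.-integrable E (fun s : L => (complex.Re (b s))%:E) /\
  leb.-integrable E (fun s : L => (complex.Im (b s))%:E).

Lemma cintegrableB E b c : measurable E -> cintegrable E b -> cintegrable E c ->
  cintegrable E (fun s => b s - c s).
Proof.
move=> mE [br bi] [cr ci]; split.
- under eq_fun do rewrite ReD ReN EFinB; exact: integrableB.
- under eq_fun do rewrite ImD ImN EFinB; exact: integrableB.
Qed.

Lemma cintB E b c : measurable E -> cintegrable E b -> cintegrable E c ->
  cint E b - cint E c = cint E (fun s => b s - c s).
Proof.
move=> mE [br bi] [cr ci]; rewrite /cint.
under [in RHS]eq_Rintegral do rewrite ReD ReN.
under [X in _ = Complex _ X]eq_Rintegral do rewrite ImD ImN.
by rewrite !RintegralB.
Qed.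

Lemma cintegrable_measurable E b : cintegrable E b -> cmeasurable E (b : L -> R[i]).
Proof.
by move=> [/integrableP[/measurable_EFinP mr _] /integrableP[/measurable_EFinP mi _]].
Qed.

Lemma cnorm_cint E b : measurable E -> cintegrable E b ->
  ((cnorm (cint E b))%:E <= \int[leb]_(s in E) (abs1 (b s))%:E)%E.
Proof.
move=> mE bE; have [br bi] := bE; have [mr mi] := cintegrable_measurable bE.
apply: (@le_trans _ _ (abs1 (cint E b))%:E); first by rewrite lee_fin cnorm_le_abs1.
rewrite /abs1 /=; under eq_integral do rewrite EFinD.
have m1 (f : L -> R) : measurable_fun E f -> measurable_fun E (fun s => `|f s|%:E).
  by move=> mf; apply/measurable_EFinP; exact: measurableT_comp.
have m2 := m1 _ mr; have m3 := m1 _ mi.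
move/measurable_EFinP : mr => mr; move/measurable_EFinP : mi => mi.
rewrite ge0_integralD// EFinD leeD// EFin_normr_Rintegral//; exact: le_abse_integral.
Qed.

Lemma cintegrable_bounded E b (C : R) : measurable E -> (leb E < +oo)%E ->
  cmeasurable E (b : L -> R[i]) -> 0 <= C ->
  {ae leb, forall s : L, E s -> cnorm (b s) <= C} -> cintegrable E b.
Proof.
move=> mE Eoo [mr mi] C0 bC.
have key (P : L -> R) : measurable_fun E P -> (forall s, `|P s| <= cnorm (b s)) ->
    leb.-integrable E (fun s : L => (P s)%:E).
  move=> /measurable_EFinP mP Pb; apply/integrableP; split => //.
  have mP' : measurable_fun E (fun s => `|(P s)%:E|)%E.
    exact: (measurableT_comp (@abse_measurable R setT) mP).
  apply: (@le_lt_trans _ _ (\int[leb]_(s in E) (cst C%:E) s)%E); last first.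
    by rewrite integral_cst// lte_mul_pinfty// lee_fin.
  apply: ae_ge0_le_integral => //.
  by apply: filterS bC => s bC Es; rewrite /= lee_fin (le_trans (Pb s))// bC.
by split; apply: key => // s; [exact: le_Re_cnorm|exact: le_Im_cnorm].
Qed.

Lemma cnorm_cint_bound E b (C : R) : measurable E -> (leb E < +oo)%E ->
  cintegrable E b -> 0 <= C ->
  {ae leb, forall s : L, E s -> cnorm (b s) <= C} ->
  cnorm (cint E b) <= 2 * C * fine (leb E).
Proof.
move=> mE Eoo bE C0 bC; rewrite -lee_fin.
apply: le_trans (cnorm_cint mE bE) _.
have mb := measurable_abs1 (cintegrable_measurable bE).
apply: (@le_trans _ _ (\int[leb]_(s in E) (cst (2 * C)%:E) s)%E).
  apply: ae_ge0_le_integral => //.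
  - by move=> s _; rewrite lee_fin abs1_ge0.
  - by move=> s _; rewrite /= lee_fin mulr_ge0.
  apply: filterS bC => s bC Es; rewrite /= lee_fin.
  by apply: le_trans (abs1_le_cnorm _) _; rewrite ler_wpM2l// bC.
by rewrite integral_cst// [leRHS]EFinM fineK// ge0_fin_numE.
Qed.

End complex_integral.

Section riemann.
Context {d : measure_display} {T : measurableType d} {R : realType}.
Variable mu : {measure set T -> \bar R}.
Variable p : R.
Hypothesis p1 : 1 <= p.

Local Notation L := (lebesgueTypeR R).
Local Notation N f := (cLnorm mu p%:E f).

(** Only the orbit is sampled: [b] is merely measurable, so it is integrated exactly over each
    cell. *)
Definition rsum (h t : R) (M : nat) (X : R -> T -> R[i]) (b : R -> R[i]) x : R[i] :=
  \sum_(j < M) cint (cell h t j) b * X (j%:R * h) x.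

Section finite_range.
Variable t : R.
Hypothesis t0 : 0 <= t.
Local Notation D := (`[0%R, t]%classic : set L).

Let Dfin : (leb D < +oo)%E. Proof. by rewrite leb_cc// ltry. Qed.
Let mD : measurable D. Proof. exact: leb_measurable_itv. Qed.

Lemma integrable_bounded_sub (phi : L -> R) (E : set L) (C : R) :
  measurable E -> E `<=` D -> measurable_fun E phi -> 0 <= C ->
  (forall s, `|phi s| <= C) -> leb.-integrable E (fun s : L => (phi s)%:E).
Proof.
move=> mE ED mphi C0 phiC.
have Efin : (leb E < +oo)%E.
  by apply: le_lt_trans Dfin; apply: le_measure; rewrite ?inE.
have phiC' : {ae leb, forall s : L, E s -> cnorm ((phi s)%:C%C) <= C}.
  by apply: aeW => s _; rewrite cnorm_real.
by have [] := cintegrable_bounded mE Efin (cmeasurable_real mphi) C0 phiC'.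
Qed.

Variable phi : L -> R.
Hypotheses (mphi : measurable_fun setT phi) (fphi : finite_set (range phi)).

Let range_seq : exists2 r : seq R, uniq r & forall s, phi s \in r.
Proof.
have /finite_seqP[r rE] := fphi; exists (undup r); first exact: undup_uniq.
move=> s; rewrite mem_undup; have : range phi (phi s) by exists s.
by rewrite rE.
Qed.

Let phiE r s : uniq r -> phi s \in r ->
  phi s = \sum_(y <- r) y * \1_(phi @^-1` [set y]) s.
Proof.
move=> ur rs; rewrite (bigD1_seq (phi s))//= big1 ?addr0; last first.
  move=> y yphi; rewrite indicE memNset ?mulr0//= => ys.
  by rewrite ys eqxx in yphi.
by rewrite indicE mem_set// mulr1.
Qed.

Lemma finite_range_bounded : exists2 C : R, 0 <= C & forall s, `|phi s| <= C.
Proof.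
have [r ur rP] := range_seq.
exists (\sum_(y <- r) `|y|); first exact: sumr_ge0.
move=> s; rewrite (phiE ur (rP s)); apply: le_trans (ler_norm_sum _ _ _) _.
apply: ler_sum => y _; rewrite normrM indicE.
by case: (_ \in _); rewrite ?normr1 ?mulr1// normr0 mulr0.
Qed.

Lemma simple_rep_finite_range (E : set L) (g : T -> R[i]) :
  measurable E -> E `<=` D -> cLp mu p%:E g ->
  simple_rep mu p t (fun s x => (\1_E (s : L) * phi s)%:C%C * g x)
    (fun x => (Rintegral leb E phi)%:C%C * g x).
Proof.
move=> mE ED lg; have [r ur rP] := range_seq.
have mphiy (y : R) : measurable (phi @^-1` [set y]).
  by rewrite -[X in measurable X]setTI; exact: mphi.
have mF (y : R) : measurable (E `&` phi @^-1` [set y]) by exact: measurableI.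
have FD y : E `&` phi @^-1` [set y] `<=` D by move=> s [/ED].
have := simple_rep_sum r (fun y => simple_rep1 (mF y) (FD y) (cLpZ (y%:C%C) p1 lg)).
congr simple_rep.
  apply/funext => s; apply/funext => x.
  rewrite [in RHS](phiE ur (rP s)) mulr_sumr rmorph_sum mulr_suml.
  apply: eq_bigr => y _; rewrite mulrA -rmorphM; congr (_%:C%C * _).
  by rewrite indicI /=; ring.
apply/funext => x.
have -> : Rintegral leb E phi = \sum_(y <- r) y * fine (leb (E `&` phi @^-1` [set y])).
  rewrite /Rintegral.
  have -> : (\int[leb]_(s in E) (phi s)%:E)%E =
      (\int[leb]_(s in E) \sum_(y <- r) (y * \1_(phi @^-1` [set y]) s)%:E)%E.
    by apply: eq_integral => s _; rewrite [in LHS](phiE ur (rP s)) -sumEFin.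
  have ind_le1 (A : set L) s : `|\1_A s : R| <= 1.
    by rewrite indicE; case: (_ \in _); rewrite ?normr1// normr0.
  rewrite integral_sum//; last first.
    move=> y; have my : measurable_fun E (fun s => y * \1_(phi @^-1` [set y]) s).
      by apply: measurable_funM; [exact: measurable_cst|exact: measurable_indic].
    apply: (integrable_bounded_sub (C := `|y|)) => //.
    by move=> s; rewrite normrM -[leRHS]mulr1 ler_wpM2l.
  have yint y : (\int[leb]_(s in E) (y * \1_(phi @^-1` [set y]) s)%:E =
      (y * fine (leb (E `&` phi @^-1` [set y])))%:E)%E.
    under eq_integral do rewrite EFinM.
    rewrite integralZl//; last first.
      by apply: (integrable_bounded_sub (C := 1)).
    rewrite integral_indic// EFinM setIC fineK// ge0_fin_numE//.
    by apply: le_lt_trans Dfin; apply: le_measure; rewrite ?inE// setIC.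
  by under eq_bigr do rewrite yint; rewrite sumEFin.
rewrite rmorph_sum mulr_suml; apply: eq_bigr => y _.
by rewrite mulrA -rmorphM; congr (_%:C%C * _); rewrite mulrC.
Qed.

End finite_range.

Record csimple (g : R -> R[i]) : Prop := {
  csimple_Re : measurable_fun setT (fun s : L => complex.Re (g s)) ;
  csimple_Im : measurable_fun setT (fun s : L => complex.Im (g s)) ;
  csimple_finRe : finite_set (range (fun s : L => complex.Re (g s))) ;
  csimple_finIm : finite_set (range (fun s : L => complex.Im (g s))) }.

Lemma csimple_cintegrable t g (E : set L) : 0 <= t -> csimple g -> measurable E ->
  E `<=` `[0%R, t]%classic -> cintegrable E g.
Proof.
move=> t0 [mr mi fr fi] mE ED; split.
- have [C C0 rC] := finite_range_bounded fr.
  by apply: (integrable_bounded_sub t0 mE ED _ C0 rC); exact: measurable_funTS.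
- have [C C0 rC] := finite_range_bounded fi.
  by apply: (integrable_bounded_sub t0 mE ED _ C0 rC); exact: measurable_funTS.
Qed.

Lemma simple_rep_rsum h t M X g : 0 < h -> 0 <= t -> csimple g ->
  (forall s, 0 <= s -> cLp mu p%:E (X s)) ->
  simple_rep mu p t
    (fun s x => \sum_(j < M) (\1_(cell h t j) (s : L) : R)%:C%C * g s * X (j%:R * h) x)
    (rsum h t M X g).
Proof.
move=> h0 t0 [mr mi fr fi] lX.
have lXj (j : nat) : cLp mu p%:E (X (j%:R * h)) by apply: lX; rewrite mulr_ge0// ltW.
(* [simple_rep_finite_range] takes real weights, so the imaginary part of [g] is carried by
   [i * X]. *)
have liXj (j : nat) : cLp mu p%:E (fun x => Complex 0 1 * X (j%:R * h) x) by exact: cLpZ.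
have := simple_rep_sum (index_enum 'I_M) (fun j : 'I_M => simple_repD
  (simple_rep_finite_range t0 mr fr (measurable_cell h t j) (@cell_sub _ h t j) (lXj j))
  (simple_rep_finite_range t0 mi fi (measurable_cell h t j) (@cell_sub _ h t j) (liXj j))).
have E1 (a u v : R) (z : R[i]) : (a * u)%:C%C * z + (a * v)%:C%C * (Complex 0 1 * z) =
    a%:C%C * Complex u v * z.
  by case: z => zr zi; apply/eqP; rewrite eq_complex /=; apply/andP; split; apply/eqP; ring.
congr simple_rep.
  apply/funext => s; apply/funext => x; apply: eq_bigr => j _.
  by rewrite E1; case: (g s).
apply/funext => x; rewrite /rsum; apply: eq_bigr => j _.
rewrite /cint -[RHS]mul1r mulrA -(E1 1 (Rintegral leb (cell h t j) (fun s => complex.Re (g s)))).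
by rewrite !mul1r.
Qed.

End riemann.

Section csimple_approximation.
Context {R : realType}.
Local Notation L := (lebesgueTypeR R).

Import HBSimple.

Lemma csimple_approximation (E : set L) (b : R -> R[i]) : measurable E ->
  cintegrable E b -> exists g : nat -> R -> R[i],
  [/\ forall n, csimple (g n),
      forall s : L, E s -> (fun n => abs1 (b s - g n s)) @ \oo --> (0 : R) &
      (fun n => \int[leb]_(s in E) (abs1 (b s - g n s))%:E)%E @ \oo --> 0%E].
Proof.
move=> mE bE; have [br bi] := bE; have [mbr mbi] := cintegrable_measurable bE.
have [u [ui uc uI]] := approximation_sfun_integrable mE br.
have [v [vi vc vI]] := approximation_sfun_integrable mE bi.
pose g n (s : R) : R[i] := Complex (u n s) (v n s).
have gE n (s : R) : abs1 (b s - g n s) =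
    `|complex.Re (b s) - u n s| + `|complex.Im (b s) - v n s|.
  by rewrite /abs1 ReD ImD ReN ImN.
exists g; split.
- move=> n; split => /=; [exact: measurable_funP|exact: measurable_funP| |];
    exact: fimfunP.
- move=> s Es; under eq_fun do rewrite gE.
  have dist_cvg0 (a : nat -> R) (l : R) : a @ \oo --> l ->
      (fun n => `|l - a n|) @ \oo --> (0 : R).
    move=> al; apply/cvgr0Pnorm_le => e e0; move/cvgrPdist_le : al => /(_ e e0).
    by apply: filterS => n; rewrite normr_id.
  have cu : (fun n => u n s) @ \oo --> complex.Re (b s) by have /fine_cvgP[_] := uc s Es.
  have cv : (fun n => v n s) @ \oo --> complex.Im (b s) by have /fine_cvgP[_] := vc s Es.
  have := cvgD (dist_cvg0 _ _ cu) (dist_cvg0 _ _ cv); rewrite addr0; exact.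
- have mu_ n : measurable_fun E (fun s : L => `|complex.Re (b s) - u n s|%:E).
    apply/measurable_EFinP; apply: (measurableT_comp (@normr_measurable R setT)).
    by apply: (measurable_funB mbr); apply: measurable_funTS; exact: measurable_funP.
  have mv_ n : measurable_fun E (fun s : L => `|complex.Im (b s) - v n s|%:E).
    apply/measurable_EFinP; apply: (measurableT_comp (@normr_measurable R setT)).
    by apply: (measurable_funB mbi); apply: measurable_funTS; exact: measurable_funP.
  rewrite (_ : (fun n => _) = (fun n =>
      \int[leb]_(s in E) `|(complex.Re (b s))%:E - (u n s)%:E| +
      \int[leb]_(s in E) `|(complex.Im (b s))%:E - (v n s)%:E|)%E); last first.
    apply/funext => n; under eq_integral do rewrite gE EFinD.
    by rewrite ge0_integralD.
  have := cvgeD _ uI vI; rewrite adde0; exact.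
Qed.

End csimple_approximation.

Section riemann_sums.
Context {d : measure_display} {T : measurableType d} {R : realType}.
Variable mu : {measure set T -> \bar R}.
Variable p : R.
Hypothesis p1 : 1 <= p.

Local Notation L := (lebesgueTypeR R).
Local Notation N f := (cLnorm mu p%:E f).

Variables (X : R -> T -> R[i]) (B : R).
Hypotheses (lX : forall s, 0 <= s -> cLp mu p%:E (X s))
  (B0 : 0 <= B) (XB : forall s, 0 <= s -> (N (X s) <= B%:E)%E).

Variables (b : R -> R[i]) (C : R).
Hypotheses (mb : cmeasurable (`[0, +oo[%classic : set L) (b : L -> R[i]))
  (C0 : 0 <= C) (bC : {ae leb, forall s : L, 0 <= (s : R) -> cnorm (b s) <= C}).

Variable t : R.
Hypothesis t0 : 0 <= t.
Local Notation D := (`[0%R, t]%classic : set L).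

Let mD : measurable D. Proof. exact: leb_measurable_itv. Qed.
Let Dfin : (leb D < +oo)%E. Proof. by rewrite leb_cc// ltry. Qed.

Lemma sub_cintegrable (E : set L) : measurable E -> E `<=` D -> cintegrable E b.
Proof.
move=> mE ED; have D0 (s : L) : D s -> 0 <= (s : R).
  by rewrite /= in_itv/= => /andP[].
have mI := leb_measurable_itv `[(0 : R), +oo[.
have sub : E `<=` (`[0, +oo[%classic : set L).
  by move=> s /ED /D0 s0; rewrite /= in_itv/= s0.
have mbE : cmeasurable E (b : L -> R[i]).
  by case: mb => mr mi; split; [exact: measurable_funS mr|exact: measurable_funS mi].
apply: (@cintegrable_bounded _ E b C) => //.
- by apply: le_lt_trans Dfin; apply: le_measure; rewrite ?inE.
- by apply: filterS bC => s bCs Es; apply: bCs; apply: D0; exact: ED.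
Qed.

Let cell_cint h g (j : nat) : csimple g -> cintegrable (cell h t j) (fun s => b s - g s).
Proof.
move=> sg; apply: cintegrableB; first exact: measurable_cell.
- by apply: sub_cintegrable; [exact: measurable_cell|exact: cell_sub].
- by apply: (csimple_cintegrable t0 sg); [exact: measurable_cell|exact: cell_sub].
Qed.

Let abs1_meas g : csimple g -> measurable_fun D (fun s : L => (abs1 (b s - g s))%:E).
Proof.
move=> sg; apply: (@measurable_abs1 _ _ (fun s => b s - g s)).
apply: cintegrable_measurable; apply: cintegrableB => //.
- exact: sub_cintegrable.
- exact: (csimple_cintegrable t0 sg).
Qed.

Lemma rsum_dist h M g : 0 < h -> csimple g ->
  (N (fun x => (rsum h t M X g x - rsum h t M X b x)%R) <=
   B%:E * \int[leb]_(s in D) (abs1 (b s - g s))%:E)%E.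
Proof.
move=> h0 sg.
have lXj (j : nat) : cLp mu p%:E (X (j%:R * h)) by apply: lX; rewrite mulr_ge0// ltW.
have XBj (j : nat) : (N (X (j%:R * h)) <= B%:E)%E by apply: XB; rewrite mulr_ge0// ltW.
have mw := abs1_meas sg.
have w0 (s : L) : (0 <= (abs1 (b s - g s))%:E)%E by rewrite lee_fin abs1_ge0.
rewrite (_ : (fun x => _) = (fun x => \sum_(j < M)
    (cint (cell h t j) g - cint (cell h t j) b) * X (j%:R * h) x)); last first.
  by apply/funext => x; rewrite /rsum -sumrB; apply: eq_bigr => j _; rewrite mulrBl.
apply: le_trans (cLnorm_sum mu _ p1 _) _.
  by move=> j; apply: cmeasurableZ; case: (lXj j).
apply: (@le_trans _ _ (\sum_(j < M) B%:E *
    \int[leb]_(s in cell h t j) (abs1 (b s - g s))%:E)%E); last first.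
  rewrite -ge0_sume_distrr; last first.
    by move=> j _; apply: integral_ge0 => s _; exact: w0.
  by rewrite lee_wpmul2l// ?lee_fin//; exact: sum_integral_cell.
apply: lee_sum => j _; rewrite cLnormZ//; last by case: (lXj j).
rewrite cnorm_distC muleC lee_pmul ?cLnorm_ge0 ?lee_fin ?cnorm_ge0//.
have mc := @measurable_cell _ h t j.
rewrite cintB//.
- exact: cnorm_cint (cell_cint _ _ sg).
- by apply: sub_cintegrable => //; exact: cell_sub.
- by apply: (csimple_cintegrable t0 sg) => //; exact: cell_sub.
Qed.

Lemma step_dist h M g (w : R) : 0 < h -> t < M%:R * h -> 0 <= w ->
  (forall s s', 0 <= s -> 0 <= s' -> `|s - s'| <= h ->
     (N (fun x => (X s x - X s' x)%R) <= w%:E)%E) ->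
  {ae leb, forall s : L, D s -> (N (fun x => (b s * X s x -
     \sum_(j < M) (\1_(cell h t j) (s : L) : R)%:C%C * g s * X (j%:R * h) x)%R) <=
     (abs1 (b s - g s) * B + C * w)%:E)%E}.
Proof.
move=> h0 tM w0 Xw; apply: filterS bC => s bCs Ds.
have s0 : 0 <= (s : R) by move: Ds; rewrite /= in_itv/= => /andP[].
have [j jM cj] := cell_cover h0 Ds tM.
have jh0 : 0 <= j%:R * h by rewrite mulr_ge0// ltW.
have [mXs _] := lX s0; have [mXj _] := lX jh0.
have sumE x : \sum_(j < M) (\1_(cell h t j) (s : L) : R)%:C%C * g s * X (j%:R * h) x =
    g s * X (j%:R * h) x.
  under eq_bigr do rewrite -mulrA.
  rewrite (bigD1 (Ordinal jM))//= big1 ?addr0; last first.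
    move=> i ij; rewrite indicE memNset ?mul0r// => ci.
    by move: ij; rewrite -val_eqE/= (cell_uniq h0 ci cj) eqxx.
  by rewrite indicE mem_set// mul1r.
rewrite (_ : (fun x => _) = (fun x => (b s - g s) * X (j%:R * h) x +
    b s * (X s x - X (j%:R * h) x))); last first.
  by apply/funext => x; rewrite sumE; ring.
apply: le_trans (cLnormD mu p1 _ _) _.
- exact: cmeasurableZ.
- by apply: cmeasurableZ; exact: cmeasurableB.
rewrite !cLnormZ//; last exact: cmeasurableB.
rewrite EFinD; apply: leeD; rewrite EFinM.
  by apply: lee_pmul; rewrite ?lee_fin ?cnorm_ge0 ?cLnorm_ge0 ?cnorm_le_abs1// XB.
apply: lee_pmul; rewrite ?lee_fin ?cnorm_ge0 ?cLnorm_ge0 ?bCs//.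
apply: Xw => //; move: cj => /cellP[c1 c2 _ _].
rewrite ger0_norm ?subr_ge0// lerBlDr; move: c2.
by rewrite -natr1 mulrDl mul1r addrC => /ltW.
Qed.

Let integral_psi g (w : R) : csimple g -> 0 <= w ->
  (\int[leb]_(s in D) (abs1 (b s - g s) * B + C * w)%:E =
   B%:E * \int[leb]_(s in D) (abs1 (b s - g s))%:E + (C * w * t)%:E)%E.
Proof.
move=> sg w0; have mw := abs1_meas sg.
under eq_integral do rewrite EFinD EFinM muleC.
have m1 : measurable_fun D (fun s : L => B%:E * (abs1 (b s - g s))%:E)%E.
  exact: measurable_funeM.
rewrite ge0_integralD//.
- rewrite ge0_integralZl_EFin//; last by move=> s _; rewrite lee_fin abs1_ge0.
  congr (_ + _)%E; rewrite -[LHS]/(\int[leb]_(s in D) (cst (C * w)%:E) s)%E.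
  by rewrite integral_cst// [X in (_ * X)%E](leb_cc t0).
- by move=> s _; rewrite -EFinM lee_fin mulr_ge0// abs1_ge0.
- by move=> s _; rewrite lee_fin mulr_ge0.
Qed.

Let measurable_psi g (w : R) : csimple g ->
  measurable_fun D (fun s : L => (abs1 (b s - g s) * B + C * w)%:E).
Proof.
move=> sg; have /measurable_EFinP mw := abs1_meas sg.
have mB : measurable_fun D (fun s : L => abs1 (b s - g s) * B) by exact: measurable_funM.
by apply/measurable_EFinP; exact: measurable_funD.
Qed.

(** [b] is approximated in L^1 by a simple weight [g]. Passing from [b] to [g] costs [B] times the
    integral of [|b - g|] twice, in the integral and in the Riemann sum, and both vanish in the
    limit; the modulus of continuity [w] of the orbit remains. *)
Lemma rsum_bochner h M (w : R) G : 0 < h -> t < M%:R * h -> 0 <= w ->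
  (forall s s', 0 <= s -> 0 <= s' -> `|s - s'| <= h ->
     (N (fun x => (X s x - X s' x)%R) <= w%:E)%E) ->
  is_bochner_integral mu p%:E t (fun s x => b s * X s x) G ->
  (N (fun x => (G x - rsum h t M X b x)%R) <= (C * w * t)%:E)%E.
Proof.
move=> h0 tM w0 Xw GP.
have [g [sg _ gI]] := csimple_approximation mD (sub_cintegrable mD (@subset_refl _ D)).
have I0 n : (0 <= \int[leb]_(s in D) (abs1 (b s - g n s))%:E)%E.
  by apply: integral_ge0 => s _; rewrite lee_fin abs1_ge0.
have gI' := (ecvgn0P I0).1 gI.
have lG : cLp mu p%:E G by case: GP.
have lXj (j : nat) : cLp mu p%:E (X (j%:R * h)) by apply: lX; rewrite mulr_ge0// ltW.
have lrs c : cLp mu p%:E (rsum h t M X c).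
  by apply: cLp_sum => // j _; exact: cLpZ.
apply/lee_addgt0Pr => e e0.
have q0 : 0 < B + B + 1 by rewrite ltr_wpDl ?addr_ge0.
have [K KP] := gI' (e / (B + B + 1)) (divr_gt0 e0 q0).
have In := KP K (leqnn K).
have srep := simple_rep_rsum p1 M h0 t0 (sg K) lX.
have psi0 (s : L) : (0 <= (abs1 (b s - g K s) * B + C * w)%:E)%E.
  by rewrite lee_fin addr_ge0 ?mulr_ge0 ?abs1_ge0.
have cmp := bochner_compare p1 t0 GP srep (measurable_psi w (sg K)) psi0
  (step_dist (g K) h0 tM w0 Xw).
have dist := rsum_dist M h0 (sg K).
have mG : cmeasurable setT G by case: lG.
have mr c : cmeasurable setT (rsum h t M X c) by case: (lrs c).
apply: le_trans (cLnorm_triangle mu p1 mG (mr b) (mr (g K))) _.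
apply: le_trans (leeD cmp dist) _.
rewrite integral_psi// -addeA addeC -addeA leeD2l//.
have BI : (B%:E * \int[leb]_(s in D) (abs1 (b s - g K s))%:E <=
    B%:E * (e / (B + B + 1))%:E)%E by rewrite lee_wpmul2l ?lee_fin.
apply: le_trans (leeD BI BI) _; rewrite -!EFinM -EFinD lee_fin -mulrDl.
by rewrite mulrA ler_pdivrMr// mulrC ler_wpM2l ?(ltW e0)// lerDl.
Qed.

Hypothesis Xuc : forall e, 0 < e -> exists2 dl : R, 0 < dl &
  forall s s', 0 <= s -> 0 <= s' -> `|s - s'| <= dl ->
  (N (fun x => (X s x - X s' x)%R) <= e%:E)%E.

Lemma bochner_integrable_continuous :
  bochner_integrable mu p%:E t (fun s x => b s * X s x).
Proof.
have [g [sg gc gI]] := csimple_approximation mD (sub_cintegrable mD (@subset_refl _ D)).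
have I0 n : (0 <= \int[leb]_(s in D) (abs1 (b s - g n s))%:E)%E.
  by apply: integral_ge0 => s _; rewrite lee_fin abs1_ge0.
have gI' := (ecvgn0P I0).1 gI.
have /choice[h hP] : forall n, exists h : R, 0 < h /\
    forall s s', 0 <= s -> 0 <= s' -> `|s - s'| <= h ->
    (N (fun x => (X s x - X s' x)%R) <= (2^-1 ^+ n)%:E)%E.
  by move=> n; have [dl dl0 dlP] := Xuc (half_gt0 n (R := R)); exists dl.
have h0 n : 0 < h n by case: (hP n).
pose M n := Num.bound (t / h n).
have tM n : t < (M n)%:R * h n.
  by rewrite -ltr_pdivrMr// archi_boundP// divr_ge0// ltW.
have hw n : 0 <= 2^-1 ^+ n :> R by exact: half_ge0.
pose psi n (s : L) := (abs1 (b s - g n s) * B + C * 2^-1 ^+ n)%:E.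
have psi0 n (s : L) : (0 <= psi n s)%E.
  by rewrite lee_fin addr_ge0 ?mulr_ge0 ?abs1_ge0.
have psi_ae : {ae leb, forall s : L, D s -> forall n, (N (fun x => (b s * X s x -
     \sum_(j < M n) (\1_(cell (h n) t j) (s : L) : R)%:C%C * g n s * X (j%:R * h n) x)%R) <=
     psi n s)%E}.
  have := ae_foralln (fun n => step_dist (g n) (h0 n) (tM n) (hw n) (hP n).2).
  by apply: filterS => s hs Ds n; exact: hs.
apply: (bochner_exists p1 t0 (F := fun s x => b s * X s x)
  (Phi := fun n s x => \sum_(j < M n) (\1_(cell (h n) t j) (s : L) : R)%:C%C * g n s * X (j%:R * h n) x)
  (I := fun n => rsum (h n) t (M n) X (g n)) (psi := psi)) => //.
- by move=> s /andP[s0 _]; apply: cLpZ => //; exact: lX.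
- by move=> n; exact: simple_rep_rsum.
- by move=> n; exact: measurable_psi.
- apply: filterS psi_ae => s psis Dst.
  have Ds : D s by rewrite /= in_itv.
  apply/ecvgn0P => [n|e e0]; first exact: cLnorm_ge0.
  have q0 : 0 < B + C + 1 by rewrite ltr_wpDl ?addr_ge0.
  have e1 : 0 < e / (B + C + 1) by rewrite divr_gt0.
  have /cvgr0Pnorm_le/(_ _ e1)[K1 _ K1P] := gc s Ds.
  have [K2 K2P] := half_small e1.
  exists (maxn K1 K2) => n; rewrite geq_max => /andP[K1n K2n].
  apply: le_trans (psis Ds n) _; rewrite lee_fin.
  have a1 := K1P n K1n; rewrite ger0_norm ?abs1_ge0// in a1.
  have a2 : 2^-1 ^+ n <= e / (B + C + 1) :> R.
    exact: le_trans (half_mono K2n) (ltW K2P).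
  apply: (@le_trans _ _ (e / (B + C + 1) * B + C * (e / (B + C + 1)))).
    by rewrite lerD// ?ler_wpM2r// ler_wpM2l.
  rewrite (mulrC C) -mulrDr mulrAC ler_pdivrMr// ler_wpM2l ?(ltW e0)// lerDl.
  exact: ler01.
- apply/ecvgn0P => [n|e e0]; first by apply: integral_ge0 => s _; exact: psi0.
  have q0 : 0 < B + C * t + 1 by rewrite ltr_wpDl ?addr_ge0 ?mulr_ge0.
  have e1 : 0 < e / (B + C * t + 1) by rewrite divr_gt0.
  have [K1 K1P] := gI' _ e1.
  have [K2 K2P] := half_small e1.
  exists (maxn K1 K2) => n; rewrite geq_max => /andP[K1n K2n].
  rewrite /psi integral_psi//.
  have a1 := K1P n K1n.
  have a2 : 2^-1 ^+ n <= e / (B + C * t + 1) :> R.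
    exact: le_trans (half_mono K2n) (ltW K2P).
  apply: (@le_trans _ _ (B%:E * (e / (B + C * t + 1))%:E + (C * (e / (B + C * t + 1)) * t)%:E)%E).
    rewrite leeD// ?lee_wpmul2l ?lee_fin//.
    by rewrite ler_wpM2r// ler_wpM2l.
  rewrite -EFinM -EFinD lee_fin.
  rewrite (_ : _ + _ = (e * (B + C * t)) / (B + C * t + 1)); last by ring.
  by rewrite ler_pdivrMr// ler_wpM2l ?(ltW e0)// lerDl.
Qed.

End riemann_sums.

(** * Orbit integrals and their maximal inequality *)

Section averages.
Context {d : measure_display} {T : measurableType d} {R : realType}.
Variable mu : {measure set T -> \bar R}.
Hypothesis mu0 : (0 < mu setT)%E.
Variable S : R -> (T -> R[i]) -> T -> R[i].
Hypothesis Ssg : ds_semigroup mu S.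
Hypothesis Scont : strongly_continuous_L1 mu S.
Variable p : R.
Hypothesis p1 : 1 <= p.
Variable K : R.
Hypotheses (K0 : 0 < K)
  (KP : forall A, dunford_schwartz mu A -> ds_extended mu A ->
    forall f, cLp mu p%:E f -> cLp mu p%:E (A f) /\
      (cLnorm mu p%:E (A f) <= K%:E * cLnorm mu p%:E f)%E).
Implicit Types (f g : T -> R[i]) (b : R -> R[i]) (C t : R).

Local Notation L := (lebesgueTypeR R).
Local Notation N f := (cLnorm mu p%:E f).

Record admissible b C : Prop := {
  adm_meas : cmeasurable (`[0, +oo[%classic : set L) (b : L -> R[i]) ;
  adm_ge0 : 0 <= C ;
  adm_bound : {ae leb, forall s : L, 0 <= (s : R) -> cnorm (b s) <= C} }.

Lemma semigroup_ds_sequence (h : R) : 0 <= h -> ds_sequence mu (fun n => S (n%:R * h)).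
Proof.
move=> h0; have nh (n : nat) : 0 <= n%:R * h by rewrite mulr_ge0.
split.
- by move=> n; exact: dsg_ds.
- by move=> n; exact: dsg_ext.
- by move=> f lf; rewrite mul0r; exact: dsg0.
- by move=> m n f lf; rewrite natrD mulrDl; exact: dsgD.
Qed.

Lemma semigroup_cLp f s : cLp mu p%:E f -> 0 <= s -> cLp mu p%:E (S s f).
Proof. by move=> lf s0; case: (KP (dsg_ds Ssg s0) (dsg_ext Ssg s0) lf). Qed.

Definition sbound f : R := K * fine (N f).

Lemma sbound_ge0 f : 0 <= sbound f.
Proof. by rewrite mulr_ge0 ?(ltW K0)// fine_ge0// cLnorm_ge0. Qed.

Lemma semigroup_norm f s : cLp mu p%:E f -> 0 <= s -> (N (S s f) <= (sbound f)%:E)%E.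
Proof.
move=> lf s0; have [_] := KP (dsg_ds Ssg s0) (dsg_ext Ssg s0) lf.
by move/le_trans; apply; rewrite EFinM fineK// cLnorm_fin_num.
Qed.

Definition orbit_integral b f t := bochner_integral mu p%:E t (fun s y => b s * S s f y).

Lemma orbit_integrable b C f t : admissible b C -> cLp mu p%:E f -> 0 <= t ->
  bochner_integrable mu p%:E t (fun s y => b s * S s f y).
Proof.
move=> [mb C0 bC] lf t0.
apply: (bochner_integrable_continuous p1 (fun s => @semigroup_cLp f s lf)
  (sbound_ge0 f) (fun s => @semigroup_norm f s lf) mb C0 bC t0).
by move=> e e0; exact: semigroup_uniform_continuity.
Qed.

Lemma orbit_integralP b C f t : admissible b C -> cLp mu p%:E f -> 0 <= t ->
  is_bochner_integral mu p%:E t (fun s y => b s * S s f y) (orbit_integral b f t).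
Proof. by move=> ab lf t0; apply: bochner_integralP; exact: orbit_integrable ab lf t0. Qed.

Lemma cLp_orbit_integral b C f t : admissible b C -> cLp mu p%:E f -> 0 <= t ->
  cLp mu p%:E (orbit_integral b f t).
Proof. by move=> ab lf t0; case: (orbit_integralP ab lf t0). Qed.

Local Notation rs h t M f b := (rsum h t M (fun s => S s f) b).

Lemma cLp_rsum h t M f b : 0 < h -> cLp mu p%:E f -> cLp mu p%:E (rs h t M f b).
Proof.
move=> h0 lf; apply: cLp_sum => // j _; apply: cLpZ => //.
by apply: semigroup_cLp => //; rewrite mulr_ge0// ltW.
Qed.

Lemma rsum_orbit_integral b C f t h M w : admissible b C -> cLp mu p%:E f -> 0 <= t ->
  0 < h -> t < M%:R * h -> 0 <= w ->
  (forall s s', 0 <= s -> 0 <= s' -> `|s - s'| <= h ->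
     (N (fun x => (S s f x - S s' f x)%R) <= w%:E)%E) ->
  (N (fun x => (orbit_integral b f t x - rs h t M f b x)%R) <= (C * w * t)%:E)%E.
Proof.
move=> ab lf t0 h0 tM w0 Sw; have [mb C0 bC] := ab.
exact: (rsum_bochner p1 (fun s => @semigroup_cLp f s lf)
  (sbound_ge0 f) (fun s => @semigroup_norm f s lf) mb C0 bC t0 h0 tM w0 Sw (orbit_integralP ab lf t0)).
Qed.

Lemma orbit_integral_approx b C f t (e : R) : admissible b C -> cLp mu p%:E f -> 0 <= t -> 0 < e ->
  exists2 h0 : R, 0 < h0 & forall h M, 0 < h -> h <= h0 -> t < M%:R * h ->
  (N (fun x => (orbit_integral b f t x - rs h t M f b x)%R) <= e%:E)%E.
Proof.
move=> ab lf t0 e0; have C0 := adm_ge0 ab.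
have q0 : 0 < C * t + 1 by rewrite ltr_wpDl// mulr_ge0.
have [h0 h00 hP] := semigroup_uniform_continuity mu0 Ssg Scont p1 (divr_gt0 e0 q0) lf.
exists h0 => // h M h_0 hh0 tM.
apply: le_trans (rsum_orbit_integral ab lf t0 h_0 tM (ltW (divr_gt0 e0 q0)) _) _.
  by move=> s s' s0 s'0 ss'; apply: hP => //; exact: le_trans hh0.
rewrite lee_fin (_ : _ * _ * _ = e * (C * t) / (C * t + 1)); last by ring.
by rewrite ler_pdivrMr// ler_wpM2l ?(ltW e0)// lerDl.
Qed.

(** Approximants at distance [2^-k * 2^-k] converge almost everywhere, so a pointwise bound survives
    a limit in L^p. With [E = set0] it is a plain almost everywhere bound. *)
Lemma ae_le_lim (F : T -> R[i]) (E : set T) (c : R) : cmeasurable setT F ->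
  (forall e : R, 0 < e -> exists v, [/\ cmeasurable setT v,
     (N (fun x => (F x - v x)%R) <= e%:E)%E &
     {ae mu, forall x, ~ E x -> cnorm (v x) <= c}]) ->
  {ae mu, forall x, ~ E x -> cnorm (F x) <= c}.
Proof.
move=> mF H.
have h20 k : 0 < 2^-1 ^+ k * 2^-1 ^+ k :> R by rewrite mulr_gt0// half_gt0.
have /choice[v vP] := fun k => H _ (h20 k).
have mv k : cmeasurable setT (v k) by case: (vP k).
have vF k : (N (fun x => (F x - v k x)%R) <= (2^-1 ^+ k * 2^-1 ^+ k)%:E)%E.
  by case: (vP k).
have fast := ae_fast_cvg p1 mv mF vF.
have vc : {ae mu, forall x, forall k, ~ E x -> cnorm (v k x) <= c}.
  by apply: ae_foralln => k; case: (vP k).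
apply: filterS2 fast vc => x [k0 xk] vc nE; apply: le_of_forall_eps => e e0.
have [k1 hk1] := half_small e0; pose k := maxn k0 k1.
rewrite -[F x](subrK (v k x)) addrC; apply: le_trans (cnormD _ _) _.
rewrite lerD ?vc//; apply: le_trans (xk k _) _; first exact: leq_maxl.
by apply: le_trans (half_mono _) (ltW hk1); exact: leq_maxr.
Qed.

Lemma cnorm_cint_cell b C h t j : admissible b C -> 0 < h -> 0 <= t ->
  cnorm (cint (cell h t j) b) <= 2 * C * cell_len h t j.
Proof.
move=> [mb C0 bC] h0 t0.
have -> : cell_len h t j = fine (leb (cell h t j)) by rewrite leb_cell.
apply: cnorm_cint_bound => //.
- exact: measurable_cell.
- by rewrite leb_cell// ltry.
- apply: (sub_cintegrable mb C0 bC t0); [exact: measurable_cell|exact: cell_sub].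
- by apply: filterS bC => s bCs /cellP[_ _ s0 _]; exact: bCs.
Qed.

Lemma rsum_sub h t M f g b : 0 < h -> cLp mu p%:E f -> cLp mu p%:E g ->
  {ae mu, forall x, rs h t M f b x - rs h t M g b x =
    \sum_(n < M) cint (cell h t n) b * S (n%:R * h) (fun y => f y - g y) x}.
Proof.
move=> h0 lf lg.
have lin : {ae mu, forall x, forall n : nat,
    S (n%:R * h) (fun y => f y - g y) x = S (n%:R * h) f x - S (n%:R * h) g x}.
  apply: ae_foralln => n; have nh : 0 <= n%:R * h by rewrite mulr_ge0// ltW.
  have := opB (dsg_ext Ssg nh) (cL1Loo_cLp mu0 p1 lf) (cL1Loo_cLp mu0 p1 lg).
  by apply: filterS => x ->.
apply: filterS lin => x lin; rewrite /rsum -sumrB; apply: eq_bigr => n _.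
by rewrite lin mulrBr.
Qed.

(* The exceptional set is the lower limit of the discrete exceptional sets
   along a sequence of meshes for which the Riemann sums converge almost
   everywhere for every [t]. *)
Lemma maximal_pair f g (l : R) : cLp mu p%:E f -> cLp mu p%:E g -> 0 < l ->
  exists E, [/\ measurable E,
    ((l `^ p)%:E * mu E <= pint mu p (fun x => f x - g x)%R)%E &
    forall b C t, admissible b C -> 0 <= t ->
    {ae mu, forall x, ~ E x -> cnorm (orbit_integral b f t x - orbit_integral b g t x) <= 4 * C * l * t}].
Proof.
move=> lf lg l0.
have lfg : cLp mu p%:E (fun x => f x - g x) by exact: cLpB.
have h20 k : 0 < 2^-1 ^+ k * 2^-1 ^+ k :> R by rewrite mulr_gt0// half_gt0.
have /choice[h hP] : forall k, exists h : R, 0 < h /\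
    forall s s', 0 <= s -> 0 <= s' -> `|s - s'| <= h ->
    (N (fun x => (S s f x - S s' f x)%R) <= (2^-1 ^+ k * 2^-1 ^+ k)%:E)%E /\
    (N (fun x => (S s g x - S s' g x)%R) <= (2^-1 ^+ k * 2^-1 ^+ k)%:E)%E.
  move=> k.
  have [h1 h10 h1P] := semigroup_uniform_continuity mu0 Ssg Scont p1 (h20 k) lf.
  have [h2 h20' h2P] := semigroup_uniform_continuity mu0 Ssg Scont p1 (h20 k) lg.
  exists (Num.min h1 h2); split; first by rewrite lt_min h10.
  move=> s s' s0 s'0; rewrite le_min => /andP[ss1 ss2].
  by split; [exact: h1P|exact: h2P].
have h0 k : 0 < h k by case: (hP k).
(* The cells cover [[0, k]], so one discrete exceptional set serves every [t <= k] and every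
   weight. *)
pose M k := Num.bound (k%:R / h k).
have kM k : k%:R < (M k)%:R * h k.
  by rewrite -ltr_pdivrMr// archi_boundP// divr_ge0// ltW.
have /choice[E EP] := fun k => maximal_Lp mu0 (semigroup_ds_sequence (ltW (h0 k))) (M k) p1 lfg l0.
have mE k : measurable (E k) by case: (EP k).
pose F m := \bigcap_(k in [set k | (m <= k)%N]) E k.
have mF m : measurable (F m).
  by apply: bigcap_measurable => //; exists m => /=.
have ll : 0 < l `^ p by exact: powR_gt0.
exists (\bigcup_m F m); split.
- exact: bigcupT_measurable.
- have muF : (mu (\bigcup_m F m) <= (l `^ p)^-1%:E * pint mu p (fun x => f x - g x)%R)%E.
    apply: mu_bigcup_nondecreasing_le => //.
      move=> m n mn; apply/subsetPset => x Fx k /= nk; apply: Fx => /=.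
      exact: leq_trans nk.
    move=> m; rewrite lee_pdivlMl//.
    have [_ muE _] := EP m; apply: le_trans muE.
    rewrite lee_wpmul2l ?lee_fin ?powR_ge0//; apply: le_measure; rewrite ?inE//.
    by move=> x; apply => /=.
  by rewrite -lee_pdivlMl.
move=> b C t ab t0; have C0 := adm_ge0 ab.
(* From index [J] on the cells cover [[0, t]], and the extra factor [2^-J] absorbs the constant
   [2 C t] of the error, leaving the rate that [ae_fast_cvg] asks for. *)
pose J0 := Num.bound t.
have q0 : 0 < (C * t + C * t + 1)^-1 by rewrite invr_gt0 ltr_wpDl// addr_ge0// mulr_ge0.
have [J1 hJ1] := half_small q0.
pose J := maxn J0 J1.
have tk k : (J <= k)%N -> t < (M k)%:R * h k.
  move=> Jk; apply: le_lt_trans (kM k).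
  apply: le_trans (ltW (archi_boundP t0)) _; rewrite ler_nat.
  exact: leq_trans (leq_maxl _ _) Jk.
pose u k x := rs (h k) t (M k) f b x - rs (h k) t (M k) g b x.
have mu_ k : cmeasurable setT (u k).
  by apply: cmeasurableB; [case: (cLp_rsum t (M k) b (h0 k) lf)|case: (cLp_rsum t (M k) b (h0 k) lg)].
have mGf : cmeasurable setT (orbit_integral b f t) by case: (cLp_orbit_integral ab lf t0).
have mGg : cmeasurable setT (orbit_integral b g t) by case: (cLp_orbit_integral ab lg t0).
(* Orbit integrals are chosen representatives; estimating the difference of two of them leaves
   linearity to the Riemann sums, where it is [rsum_sub]. *)
pose H x := orbit_integral b f t x - orbit_integral b g t x.
have mH : cmeasurable setT H by exact: cmeasurableB.
have sub4 (y z w v : R[i]) : (y - z) - (w - v) = (y - w) - (z - v) by ring.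
have uH k : (N (fun x => (H x - u (k + J)%N x)%R) <= (2^-1 ^+ k * 2^-1 ^+ k)%:E)%E.
  set n := (k + J)%N.
  have tn : t < (M n)%:R * h n by apply: tk; rewrite leq_addl.
  have f1 := rsum_orbit_integral ab lf t0 (h0 n) tn (ltW (h20 n))
    (fun s s' s0 s'0 ss => ((hP n).2 s s' s0 s'0 ss).1).
  have g1 := rsum_orbit_integral ab lg t0 (h0 n) tn (ltW (h20 n))
    (fun s s' s0 s'0 ss => ((hP n).2 s s' s0 s'0 ss).2).
  rewrite (_ : (fun x => _) = (fun x => (orbit_integral b f t x - rs (h n) t (M n) f b x) -
      (orbit_integral b g t x - rs (h n) t (M n) g b x))); last first.
    by apply/funext => x; exact: sub4.
  apply: le_trans (cLnormB mu p1 _ _) _.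
  - by apply: cmeasurableB => //; case: (cLp_rsum t (M n) b (h0 n) lf).
  - by apply: cmeasurableB => //; case: (cLp_rsum t (M n) b (h0 n) lg).
  apply: le_trans (leeD f1 g1) _; rewrite -EFinD lee_fin.
  rewrite (_ : _ + _ = (2^-1 ^+ n * 2^-1 ^+ n) * (C * t + C * t)); last by ring.
  rewrite /n exprD.
  have hk := half_gt0 k (R := R); have hJ := half_gt0 J (R := R).
  have hJ' : 2^-1 ^+ J * (C * t + C * t + 1) <= 1 :> R.
    rewrite -ler_pdivlMr ?mul1r; last by rewrite -invr_gt0.
    by apply: le_trans (half_mono (leq_maxr J0 J1)) (ltW hJ1).
  have hJ1' : 2^-1 ^+ J <= 1 :> R by rewrite exprn_ile1 ?invr_ge0// invf_le1// ler1n.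
  have Ct0 : 0 <= C * t by rewrite mulr_ge0.
  rewrite (_ : _ * _ * _ = (2^-1 ^+ k * 2^-1 ^+ k) *
    (2^-1 ^+ J * (2^-1 ^+ J * (C * t + C * t)))); last by ring.
  rewrite -[leRHS]mulr1 ler_wpM2l ?mulr_ge0 ?(ltW hk)//.
  rewrite mulr_ile1 ?(ltW hJ) ?mulr_ge0 ?addr_ge0 ?(ltW hJ)//.
  by apply: le_trans hJ'; rewrite ler_wpM2l ?(ltW hJ)// lerDl.
have fast := ae_fast_cvg p1 (fun k => mu_ (k + J)%N) mH uH.
have bnd : {ae mu, forall x, forall k, ~ E k x -> cnorm (u k x) <= 4 * C * l * t}.
  apply: ae_foralln => k.
  have [_ _ EPk] := EP k.
  have := EPk (fun n => cint (cell (h k) t n) b) (fun j => 2 * C * cell_len (h k) t j) _.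
  have wm j n : (j <= n < M k)%N -> cnorm (cint (cell (h k) t n) b) <=
      2 * C * cell_len (h k) t j.
    move=> /andP[jn _]; apply: le_trans (cnorm_cint_cell n ab (h0 k) t0) _.
    by rewrite ler_wpM2l ?mulr_ge0//; exact: cell_len_anti.
  move=> /(_ wm) bk; have sk := rsum_sub t (M k) b (h0 k) lf lg.
  apply: filterS2 bk sk => x bk sk nE; rewrite /u sk; apply: le_trans (bk nE) _.
  (* One factor 2 comes from [maximal_Lp], the other from the bound [2 * C] on the mean of [b] over
     a cell. *)
  rewrite -mulr_sumr (_ : 4 * C * l * t = 2 * l * (2 * C * t)); last by ring.
  rewrite ler_wpM2l ?mulr_ge0 ?(ltW l0)// ler_wpM2l ?mulr_ge0//.
  exact: sum_cell_len.
apply: filterS2 fast bnd => x [k0 xk] bnd nE.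
apply: le_of_forall_eps => e e0; have [k1 hk1] := half_small e0.
pose m := (maxn k0 k1 + J)%N.
(* A point outside the lower limit of the [E n] avoids infinitely many of them. *)
have [n mn nEn] : exists2 n, (m <= n)%N & ~ E n x.
  apply: contrapT => nex; apply: nE; exists m => // n /= mn; apply: contrapT => nEn.
  by apply: nex; exists n.
have Jn : (J <= n)%N by apply: leq_trans mn; rewrite leq_addl.
have kn : (maxn k0 k1 <= n - J)%N by rewrite -(addnK J (maxn k0 k1)) leq_sub2r.
have := xk (n - J)%N (leq_trans (leq_maxl _ _) kn); rewrite subnK// => xn.
rewrite -/(H x) -[H x](subrK (u n x)) addrC; apply: le_trans (cnormD _ _) _.
rewrite lerD ?bnd//; apply: le_trans xn _.
by apply: le_trans (half_mono (leq_trans (leq_maxr _ _) kn)) (ltW hk1).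
Qed.

(** A crude bound, from one fixed mesh on which the orbit varies by at most 1. It is linear in [t],
    so the averages are bounded in L^p and Fatou places their limit there. *)
Lemma orbit_integral_norm b C f t : admissible b C -> cLp mu p%:E f -> 0 < t ->
  (N (orbit_integral b f t) <= ((2 * C * sbound f + C) * t)%:E)%E.
Proof.
move=> ab lf t0; have C0 := adm_ge0 ab.
have [h h0 hP] := semigroup_uniform_continuity mu0 Ssg Scont p1 ltr01 lf.
pose M := Num.bound (t / h).
have tM : t < M%:R * h by rewrite -ltr_pdivrMr// archi_boundP// divr_ge0// ltW.
have mG : cmeasurable setT (orbit_integral b f t) by case: (cLp_orbit_integral ab lf (ltW t0)).
have [mr _] := cLp_rsum t M b h0 lf.
have := rsum_orbit_integral ab lf (ltW t0) h0 tM ler01 hP; rewrite mulr1 => dist.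
rewrite (_ : orbit_integral b f t = fun x => (orbit_integral b f t x - rs h t M f b x) + rs h t M f b x); last first.
  by apply/funext => x; rewrite subrK.
apply: le_trans (cLnormD mu p1 (cmeasurableB mG mr) mr) _.
rewrite mulrDl EFinD addeC; apply: leeD => //.
have lS (j : nat) : cLp mu p%:E (S (j%:R * h) f).
  by apply: semigroup_cLp => //; rewrite mulr_ge0// ltW.
apply: le_trans (cLnorm_sum mu _ p1 _) _.
  by move=> j; apply: cmeasurableZ; case: (lS j).
apply: (@le_trans _ _ (\sum_(j < M) (2 * C * cell_len h t j * sbound f)%:E)%E).
  apply: lee_sum => j _; rewrite cLnormZ//; last by case: (lS j).
  rewrite EFinM; apply: lee_pmul; rewrite ?lee_fin ?cnorm_ge0 ?cLnorm_ge0//.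
    exact: cnorm_cint_cell (ltW t0).
  by apply: semigroup_norm => //; rewrite mulr_ge0// ltW.
rewrite sumEFin lee_fin -mulr_suml -mulr_sumr mulrAC ler_wpM2l//.
  by apply: mulr_ge0; [rewrite mulr_ge0|exact: sbound_ge0].
by apply: sum_cell_len => //; exact: ltW.
Qed.

End averages.

(** * Almost uniform Cauchy families *)

Section almost_uniform_cauchy.
Context {d : measure_display} {T : measurableType d} {R : realType}.
Variable mu : {measure set T -> \bar R}.
Implicit Types u v : R -> T -> R[i].

(* The exceptional set may depend on the precision [de]; a union over
   [de = 2^-k] turns this into the almost uniform Cauchy property. *)
Definition au_cauchy u := forall eps de : R, 0 < eps -> 0 < de ->
  exists E t0, [/\ measurable E, (mu E <= eps%:E)%E, 0 < t0 &
  forall t t', t0 <= t -> t0 <= t' ->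
  {ae mu, forall x, ~ E x -> cnorm (u t x - u t' x) <= de}].

Lemma mu_setU_le (A B : set T) (a b : R) : measurable A -> measurable B ->
  (mu A <= a%:E)%E -> (mu B <= b%:E)%E -> (mu (A `|` B) <= (a + b)%:E)%E.
Proof.
move=> mA mB ha hb; apply: le_trans (measureU2 mu mA mB) _.
by rewrite EFinD leeD.
Qed.

(** The approximating family may change with the precision; this closes the property under the
    passage from smooth functions to L^p. *)
Lemma au_cauchy_approx u : (forall eps de : R, 0 < eps -> 0 < de ->
  exists v E t0, [/\ au_cauchy v, measurable E, (mu E <= eps%:E)%E &
  forall t, t0 <= t -> {ae mu, forall x, ~ E x -> cnorm (u t x - v t x) <= de}]) ->
  au_cauchy u.
Proof.
move=> H eps de eps0 de0.
have eps2 : 0 < eps / 2 by rewrite divr_gt0.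
have de3 : 0 < de / 3 by rewrite divr_gt0.
have [v [E1 [t1 [wv mE1 muE1 uv]]]] := H _ _ eps2 de3.
have [E2 [t2 [mE2 muE2 t20 vv]]] := wv _ _ eps2 de3.
exists (E1 `|` E2), (Num.max t1 t2); split.
- exact: measurableU.
- by rewrite (splitr eps); exact: mu_setU_le.
- by rewrite lt_max t20 orbT.
move=> t t'; rewrite !ge_max => /andP[t1t t2t] /andP[t1t' t2t'].
have h1 := uv t t1t; have h2 := uv t' t1t'; have h3 := vv t t' t2t t2t'.
apply: filterS3 h1 h2 h3 => x h1 h2 h3 nE.
have nE1 : ~ E1 x by move=> ?; apply: nE; left.
have nE2 : ~ E2 x by move=> ?; apply: nE; right.
apply: le_trans (cnorm_triangle _ _ (v t x)) _.
have := cnorm_triangle (v t x) (u t' x) (v t' x).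
have := h1 nE1; have := h2 nE1; have := h3 nE2.
rewrite (cnorm_distC (u t' x)); lra.
Qed.

Lemma au_cauchy0 : au_cauchy (fun _ _ => 0).
Proof.
move=> eps de eps0 de0; exists set0, 1; split => //.
  by rewrite measure0 lee_fin ltW.
by move=> t t' _ _; apply: aeW => x _; rewrite subrr cnorm0 ltW.
Qed.

Lemma au_cauchyD u v : au_cauchy u -> au_cauchy v -> au_cauchy (fun t x => u t x + v t x).
Proof.
move=> wu wv eps de eps0 de0.
have eps2 : 0 < eps / 2 by rewrite divr_gt0.
have de2 : 0 < de / 2 by rewrite divr_gt0.
have [E1 [t1 [mE1 muE1 t10 uu]]] := wu _ _ eps2 de2.
have [E2 [t2 [mE2 muE2 t20 vv]]] := wv _ _ eps2 de2.
exists (E1 `|` E2), (Num.max t1 t2); split.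
- exact: measurableU.
- by rewrite (splitr eps); exact: mu_setU_le.
- by rewrite lt_max t20 orbT.
move=> t t'; rewrite !ge_max => /andP[t1t t2t] /andP[t1t' t2t'].
have h1 := uu t t' t1t t1t'; have h2 := vv t t' t2t t2t'.
apply: filterS2 h1 h2 => x h1 h2 nE.
have nE1 : ~ E1 x by move=> ?; apply: nE; left.
have nE2 : ~ E2 x by move=> ?; apply: nE; right.
rewrite opprD addrACA; apply: le_trans (cnormD _ _) _.
by have := h1 nE1; have := h2 nE2; lra.
Qed.

Lemma au_cauchyZ (c : R[i]) u : au_cauchy u -> au_cauchy (fun t x => c * u t x).
Proof.
move=> wu eps de eps0 de0.
have c0 : 0 < cnorm c + 1 by rewrite ltr_wpDl// cnorm_ge0.
have [E [t1 [mE muE t10 uu]]] := wu _ _ eps0 (divr_gt0 de0 c0).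
exists E, t1; split => // t t' t1t t1t'.
apply: filterS (uu t t' t1t t1t') => x h nE; rewrite -mulrBr cnormM.
have := h nE; rewrite ler_pdivlMr// mulrC; apply: le_trans.
by rewrite ler_wpM2r ?cnorm_ge0// lerDl.
Qed.

Lemma au_cauchy_cvg u (p M : R) : (0 < mu setT)%E -> 0 < p ->
  (forall t, 0 < t -> cmeasurable setT (u t)) ->
  (forall t, 0 < t -> (pint mu p (u t) <= M%:E)%E) -> au_cauchy u ->
  exists2 fhat : T -> R[i], cLp mu p%:E fhat & au_cvg mu (pinfty_nbhs R) u fhat.
Proof.
move=> mu0 p0 mut uM wu.
have /choice[Et EtP] : forall k : nat, exists Et : set T * R, [/\ measurable Et.1,
    (mu Et.1 <= (2^-1 ^+ k)%:E)%E, 0 < Et.2 &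
    forall t t', Et.2 <= t -> Et.2 <= t' ->
    {ae mu, forall x, ~ Et.1 x -> cnorm (u t x - u t' x) <= 2^-1 ^+ k}].
  move=> k; have [E [t0 H]] := wu _ _ (half_gt0 k (R := R)) (half_gt0 k (R := R)).
  by exists (E, t0).
(* Partial sums of positive times dominate each threshold and increase. *)
pose tau k := \sum_(i < k.+1) (Et i).2.
have Et0 k : 0 < (Et k).2 by case: (EtP k).
have tau_ge k : (Et k).2 <= tau k.
  by rewrite /tau big_ord_recr/= lerDr sumr_ge0// => i _; exact: ltW.
have tauS k : tau k <= tau k.+1 by rewrite /tau [leRHS]big_ord_recr/= lerDl ltW.
have tau0 k : 0 < tau k by exact: lt_le_trans (tau_ge k).
pose w k := u (tau k).
have mw k : cmeasurable setT (w k) by exact: mut.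
(* Off the set of [Et k] this is a null set. Adjoining it keeps the measure bound and makes the
   increment small at every point off [E k], as [au_limit] requires. *)
pose B k := [set x | 2^-1 ^+ k < cnorm (w k.+1 x - w k x)].
have mB k : measurable (B k) by apply: measurable_cnorm_gt; exact: cmeasurableB.
pose E k := (Et k).1 `|` B k.
have mE k : measurable (E k) by apply: measurableU => //; case: (EtP k).
have muE k : (mu (E k) <= (2^-1 ^+ k)%:E)%E.
  have [mEk muEk _ H] := EtP k; apply: le_trans muEk; apply: le_measure_ae => //.
  have := H (tau k.+1) (tau k) (le_trans (tau_ge k) (tauS k)) (tau_ge k).
  apply: filterS => x h [//|Bx]; apply: contrapT => /h.
  by rewrite leNgt => /negP; apply.
have [k x nE|g mg gP] := @au_limit _ _ _ w E mw mE.
  by rewrite leNgt; apply/negP => Bx; apply: nE; right.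
have wg : {ae mu, forall x, (fun k => cnorm (g x - w k x)) @ \oo --> (0 : R)}.
  apply: filterS (ae_eventually_notin mE muE) => x [K xK].
  apply: (@cvg0_half _ _ 2 K) => // k Kk.
  by rewrite ger0_norm ?cnorm_ge0//; apply: (gP K).
exists g.
  split => //; rewrite -pint_lty ?gt_eqF//.
  apply: le_lt_trans (fatou_pint p0 mw mg wg (fun k => uM _ (tau0 k))) _.
  exact: ltry.
move=> e e0; have [K hK] := half_small (divr_gt0 e0 (ltr0n R 2)).
pose Z := \bigcup_(k in [set k | (K <= k)%N]) E k.
have mZ : measurable Z by apply: bigcup_measurable.
exists (~` Z); split; first exact: measurableC.
  rewrite setCK; apply: le_trans (mu_tail_half K mE muE) _.
  by rewrite lee_fin mulrC -ler_pdivlMr// ltW.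
apply/ecvg0P => [t|eta eta0]; first exact: cLnorm_ge0.
have [K2 hK2] := half_small (divr_gt0 eta0 (ltr0n R 3)).
pose k := maxn K K2.
(* Two parts bound the distance from the limit to [w k], one that from [w k] to [u t]. *)
have hk : 3 * 2^-1 ^+ k <= eta.
  rewrite mulrC -ler_pdivlMr//; apply: le_trans (half_mono _) (ltW hK2).
  exact: leq_maxr.
exists (tau k); split; first exact: num_real.
move=> t tkt; apply/cLnormooP => //.
have [_ _ _ H] := EtP k.
have := H (tau k) t (tau_ge k) (le_trans (tau_ge k) (ltW tkt)).
apply: filterS => x h.
have [Zx|nZx] := pselect (Z x).
  by rewrite indicE memNset//= ?mulr0 ?cnorm0 ?(ltW eta0)// => /(_ Zx).
rewrite indicE mem_set//= mulr1.
have nE j : (K <= j)%N -> ~ E j x by move=> Kj Ej; apply: nZx; exists j.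
have a1 := gP K x nE k (leq_maxl _ _).
have a2 : cnorm (w k x - u t x) <= 2^-1 ^+ k.
  by apply: h => Ex; apply: (nE k (leq_maxl _ _)); left.
by apply: le_trans (cnorm_triangle _ _ (w k x)) _; move: hk; lra.
Qed.

End almost_uniform_cauchy.

(** * Smoothing *)

Section weighted_shift.
Context {R : realType}.
Variables (l : nat -> R) (F : nat -> R[i]) (B : R).
Hypotheses (l0 : forall j, 0 <= l j) (lS : forall j, l j.+1 <= l j)
  (FB : forall j, cnorm (F j) <= B).

(** Abel summation moves the difference from [F] to the decreasing weights, whose total variation is
    at most [l 0]. *)
Lemma weighted_shift1 M :
  cnorm (\sum_(j < M) (l j)%:C%C * (F j.+1 - F j)) <= 2 * B * l 0.
Proof.
have B0 : 0 <= B by exact: le_trans (cnorm_ge0 _) (FB 0).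
have lFB j k : cnorm ((l j)%:C%C * F k) <= l j * B.
  by rewrite cnormM cnorm_real ger0_norm// ler_wpM2l.
case: M => [|M]; first by rewrite big_ord0 cnorm0 !mulr_ge0.
(* The induction closes once the boundary term is removed; it is put back afterwards. *)
have : cnorm (\sum_(j < M.+1) (l j)%:C%C * (F j.+1 - F j) - (l M)%:C%C * F M.+1) <=
    B * (2 * l 0 - l M).
  elim: M => [|M ih].
    rewrite big_ord_recr big_ord0/= add0r mulrBr addrAC subrr add0r cnormN.
    by apply: le_trans (lFB _ _) _; rewrite (_ : B * _ = l 0 * B)//; ring.
  rewrite big_ord_recr/=.
  rewrite (_ : _ - _ = (\sum_(j < M.+1) (l j)%:C%C * (F j.+1 - F j) - (l M)%:C%C * F M.+1) +
    (l M - l M.+1)%:C%C * F M.+1); last by rewrite rmorphB/=; ring.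
  apply: le_trans (cnormD _ _) _.
  rewrite (_ : B * _ = B * (2 * l 0 - l M) + (l M - l M.+1) * B); last by ring.
  rewrite lerD// cnormM cnorm_real ger0_norm ?subr_ge0//.
  by rewrite ler_wpM2l ?subr_ge0.
move=> h; rewrite -[X in cnorm X](subrK ((l M)%:C%C * F M.+1)).
apply: le_trans (cnormD _ _) _; have := lFB M M.+1; lra.
Qed.

End weighted_shift.

Lemma weighted_shift {R : realType} (l : nat -> R) (F : nat -> R[i]) (B : R) :
  (forall j, 0 <= l j) -> (forall j, l j.+1 <= l j) ->
  (forall j, cnorm (F j) <= B) -> forall n M,
  cnorm (\sum_(j < M) (l j)%:C%C * F (j + n)%N - \sum_(j < M) (l j)%:C%C * F j) <=
  2 * B * l 0 * n%:R.
Proof.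
move=> l0 lS FB n M; elim: n => [|n ih].
  by under eq_bigr do rewrite addn0; rewrite subrr cnorm0 mulr0.
have := @weighted_shift1 _ l (fun j => F (j + n)%N) B l0 lS (fun j => FB _) M.
move=> h; rewrite -[n.+1%:R]natr1 mulrDr mulr1.
apply: le_trans (cnorm_triangle _ _ (\sum_(j < M) (l j)%:C%C * F (j + n)%N)) _.
rewrite addrC lerD//; move: h; congr (cnorm _ <= _).
rewrite -sumrB; apply: eq_bigr => j _.
by rewrite addnS addSn mulrBr.
Qed.

Lemma cint_cst {R : realType} (E : set (lebesgueTypeR R)) (c : R[i]) :
  measurable E -> cint E (fun=> c) = (fine (leb E))%:C%C * c.
Proof.
move=> mE; rewrite /cint !Rintegral_cst//; case: c => a b /=.
by apply/eqP; rewrite eq_complex /= !mul0r subr0 addr0 ![_ * fine _]mulrC !eqxx.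
Qed.

Section smoothing.
Context {d : measure_display} {T : measurableType d} {R : realType}.
Variable mu : {measure set T -> \bar R}.
Hypothesis mu0 : (0 < mu setT)%E.
Variable S : R -> (T -> R[i]) -> T -> R[i].
Hypothesis Ssg : ds_semigroup mu S.
Hypothesis Scont : strongly_continuous_L1 mu S.
Implicit Types (f g : T -> R[i]).

Local Notation L := (lebesgueTypeR R).
Local Notation N f := (cLnorm mu 1%:E f).

Let le11 : 1 <= 1 :> R. Proof. by []. Qed.

Let K1 A : dunford_schwartz mu A -> ds_extended mu A ->
  forall f, cLp mu 1%:E f -> cLp mu 1%:E (A f) /\
    (N (A f) <= 1%:E * N f)%E.
Proof.
move=> dsA dxA f lf; split; first exact: (ds_L1 dsA).
by rewrite mul1e; exact: ds_contract1.
Qed.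

Lemma admissible1 : @admissible R (fun=> 1) 1.
Proof.
split; [by split; exact: measurable_cst|exact: ler01|].
by apply: aeW => s _; rewrite cnorm1.
Qed.

Lemma L1b_semigroup B s f : 0 <= s -> L1b mu B f -> L1b mu B (S s f).
Proof.
move=> s0 [lf fB]; split; first exact: (ds_L1 (dsg_ds Ssg s0)).
by apply: (op_oo mu0 (dsg_ext Ssg s0)) fB; case: lf.
Qed.

Lemma L1b_orbit B h f : 0 <= h -> L1b mu B f ->
  {ae mu, forall x, forall j : nat, cnorm (S (j%:R * h) f x) <= B}.
Proof.
move=> h0 Lf; apply: ae_foralln => j.
by have [] := @L1b_semigroup B (j%:R * h) f (mulr_ge0 (ler0n _ _) h0) Lf.
Qed.

Lemma cint_cell_cst h t j (c : R[i]) : 0 < h -> 0 <= t ->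
  cint (cell h t j) (fun=> c) = (cell_len h t j)%:C%C * c.
Proof.
by move=> h0 t0; rewrite cint_cst ?leb_cell//; exact: measurable_cell.
Qed.

(** The function is the mean of the orbit of [g0] over [[0, t]]. Moving that window by [s] changes
    the integral by at most [2 * B * s] in L^oo; on Riemann sums this is Abel summation against the
    decreasing cell lengths. *)
Lemma smoothing (g0 : T -> R[i]) (B e : R) : 0 <= B -> 0 < e -> L1b mu B g0 ->
  exists g K, [/\ L1b mu B g, (N (fun x => (g x - g0 x)%R) <= e%:E)%E, 0 <= K &
  forall s, 0 <= s -> {ae mu, forall x, cnorm (S s g x - g x) <= K * s}].
Proof.
move=> B0 e0 Lg0; have [lg0 g0B] := Lg0.
have [h h0 hP] := semigroup_uniform_continuity mu0 Ssg Scont le11 e0 lg0.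
(* Strictly below [h], so that one cell of mesh [h] covers [[0, t]] and the Riemann sum is just
   [t * g0]. *)
pose t := h / 2; have t0 : 0 < t by rewrite divr_gt0.
have ti : cnorm ((t^-1)%:C%C : R[i]) = t^-1.
  by rewrite cnorm_real ger0_norm// invr_ge0 ltW.
pose H := orbit_integral mu S 1 (fun=> 1) g0 t.
have lH : cLp mu 1%:E H := cLp_orbit_integral mu0 Ssg Scont le11 ltr01 K1 admissible1 lg0 (ltW t0).
have mH : cmeasurable setT H by case: lH.
have lrs k M : 0 < k -> cLp mu 1%:E (rsum k t M (fun s => S s g0) (fun=> 1)).
  by move=> k0; exact: (cLp_rsum Ssg le11 K1).
have mrs k M : 0 < k -> cmeasurable setT (rsum k t M (fun s => S s g0) (fun=> 1)).
  by move=> k0; case: (lrs k M k0).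
have rsE k M x : 0 < k -> rsum k t M (fun s => S s g0) (fun=> 1) x =
    \sum_(j < M) (cell_len k t j)%:C%C * S (j%:R * k) g0 x.
  move=> k0; apply: eq_bigr => j _; rewrite cint_cell_cst ?mulr1//; exact: ltW.
have H1 : (N (fun x => (H x - t%:C%C * g0 x)%R) <= (e * t)%:E)%E.
  have th : t < 1%:R * h.
    by rewrite mul1r /t ltr_pdivrMr// ltr_pMr// ltr1n.
  have := rsum_orbit_integral mu0 Ssg Scont le11 ltr01 K1 admissible1 lg0 (ltW t0) h0 th (ltW e0) hP.
  rewrite mul1r; apply: le_trans; rewrite le_eqVlt; apply/orP; left; apply/eqP.
  apply: ae_cLnorm => //.
  - by apply: cmeasurableB => //; apply: cmeasurableZ; case: lg0.
  - by apply: cmeasurableB => //; exact: mrs.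
  have len0 : cell_len h t 0 = t.
    by move: th; rewrite /cell_len mul0r !mul1r => /ltW th; rewrite (min_idPr th) (min_idPl (ltW t0)) subr0.
  have := dsg0 Ssg lg0; apply: filterS => x S0 _.
  by rewrite rsE// big_ord_recl big_ord0 addr0 /= mul0r S0// len0.
pose g x := (t^-1)%:C%C * H x.
have tt (z : R[i]) : (t^-1)%:C%C * (t%:C%C * z) = z.
  by rewrite mulrA -rmorphM/= mulVf ?gt_eqF// mul1r.
have HB : {ae mu, forall x, ~ set0 x -> cnorm (H x) <= B * t}.
  apply: (ae_le_lim le11 mH) => eps eps0.
  have [k k0 kP] := orbit_integral_approx mu0 Ssg Scont le11 ltr01 K1 admissible1 lg0 (ltW t0) eps0.
  pose M := Num.bound (t / k).
  have tM : t < M%:R * k by rewrite -ltr_pdivrMr// archi_boundP// divr_ge0// ltW.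
  exists (rsum k t M (fun s => S s g0) (fun=> 1)); split; [exact: mrs|exact: kP|].
  apply: filterS (L1b_orbit (ltW k0) Lg0) => x xB _; rewrite rsE//.
  apply: le_trans (cnorm_sum _ _ _) _.
  apply: (@le_trans _ _ (\sum_(j < M) B * cell_len k t j)).
    apply: ler_sum => j _; rewrite cnormM cnorm_real ger0_norm ?cell_len_ge0 ?(ltW t0)//.
    by rewrite mulrC ler_wpM2r ?cell_len_ge0 ?(ltW t0).
  by rewrite -mulr_sumr ler_wpM2l// sum_cell_len//; exact: ltW.
have lg : cLp mu 1%:E g by exact: cLpZ.
exists g, (2 * B / t); split.
- split => //; apply: filterS HB => x /(_ id) HB; rewrite cnormM ti.
  by rewrite ler_pdivrMl// mulrC.
- rewrite (_ : (fun x => _) = fun x => (t^-1)%:C%C * (H x - t%:C%C * g0 x)); last first.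
    by apply/funext => x; rewrite mulrBr tt.
  rewrite cLnormZ//; last by apply: cmeasurableB => //; apply: cmeasurableZ; case: lg0.
  rewrite ti lee_pdivrMl//; apply: le_trans H1 _; rewrite -EFinM lee_fin.
  by rewrite mulrC.
- by rewrite divr_ge0 ?mulr_ge0// ltW.
move=> s; rewrite le_eqVlt => /predU1P[<-|s0].
  by have := dsg0 Ssg lg; apply: filterS => x ->//; rewrite subrr cnorm0 mulr0.
have dsx := dsg_ext Ssg (ltW s0); have dss := dsg_ds Ssg (ltW s0).
have incH : cL1Loo mu H by exact: (cL1Loo_cLp mu0 le11).
have : {ae mu, forall x, ~ set0 x -> cnorm (S s H x - H x) <= 2 * B * s}.
  have mSH : cmeasurable setT (S s H) by apply: (op_measurable dsx).
  apply: (ae_le_lim le11); first exact: cmeasurableB.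
  move=> eps eps0; have eps2 : 0 < eps / 2 by rewrite divr_gt0.
  have [k k0 kP] := orbit_integral_approx mu0 Ssg Scont le11 ltr01 K1 admissible1 lg0 (ltW t0) eps2.
  (* The mesh divides [s], so [S s] sends the node [j * q] to the node [(j + n) * q] and acts as a
     shift of the index. *)
  pose n := (Num.bound (s / k)).+1; pose q := s / n%:R.
  have n0 : 0 < n%:R :> R by rewrite ltr0n.
  have q0 : 0 < q by rewrite divr_gt0.
  have qk : q <= k.
    rewrite /q ler_pdivrMr// mulrC -ler_pdivrMr//; apply: ltW.
    apply: lt_trans (archi_boundP _) _; first by rewrite divr_ge0// ltW.
    by rewrite ltr_nat.
  pose M := Num.bound (t / q).
  have tM : t < M%:R * q by rewrite -ltr_pdivrMr// archi_boundP// divr_ge0// ltW.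
  set v := rsum q t M (fun s => S s g0) (fun=> 1).
  have lv : cLp mu 1%:E v by exact: lrs.
  have incv : cL1Loo mu v by exact: (cL1Loo_cLp mu0 le11).
  have mv : cmeasurable setT v by exact: mrs.
  have mSv : cmeasurable setT (S s v) by apply: (op_measurable dsx).
  have vH : (N (fun x => (H x - v x)%R) <= (eps / 2)%:E)%E by exact: kP.
  exists (fun x => S s v x - v x); split; first exact: cmeasurableB.
    rewrite (_ : (fun x => _) = (fun x => (S s H x - S s v x) - (H x - v x))); last first.
      by apply/funext => x; ring.
    apply: le_trans (cLnormB mu le11 _ _) _; [exact: cmeasurableB|exact: cmeasurableB|].
    rewrite (splitr eps) EFinD; apply: leeD => //; apply: le_trans vH.
    have lHv := cLpB le11 lH lv.
    apply: le_trans (ds_contract1 dss lHv); rewrite le_eqVlt; apply/orP; left; apply/eqP.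
    apply: (@ae_cLnorm _ _ _ mu 1) => //; first exact: cmeasurableB.
      by apply: (op_measurable dsx); exact: (cL1Loo_cLp mu0 le11).
    by have := opB dsx incH incv; apply: filterS => x Sx _; rewrite Sx.
  have qj (j : nat) : 0 <= j%:R * q by rewrite mulr_ge0// ltW.
  have h1 : {ae mu, forall x, forall j : nat, S s (S (j%:R * q) g0) x = S ((j + n)%:R * q) g0 x}.
    apply: ae_foralln => j; have := dsgD Ssg (ltW s0) (qj j) lg0.
    rewrite (_ : s + j%:R * q = (j + n)%:R * q).
      by apply: filterS => x ->.
    by rewrite natrD mulrDl addrC; congr (_ + _); rewrite /q mulrC divfK// gt_eqF.
  have h2 : {ae mu, forall x, S s v x = \sum_(j < M) (cell_len q t j)%:C%C * S s (S (j%:R * q) g0) x}.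
    rewrite (_ : v = fun x => \sum_(j < M) (cell_len q t j)%:C%C * S (j%:R * q) g0 x); last first.
      by apply/funext => x; rewrite /v rsE.
    have inc (j : 'I_M) : cL1Loo mu (S (j%:R * q) g0).
      by apply: (cL1Loo_cLp mu0 le11); case: (L1b_semigroup (qj j) Lg0).
    have := op_sum mu0 dsx (fun j : 'I_M => (cell_len q t j)%:C%C) inc.
    by apply: filterS => x ->.
  apply: filterS3 h1 h2 (L1b_orbit (ltW q0) Lg0) => x h1 h2 xB _.
  rewrite h2 /v rsE//; under eq_bigr do rewrite h1.
  apply: le_trans (weighted_shift _ _ xB n M) _.
  - by move=> j; apply: cell_len_ge0 => //; exact: ltW.
  - by move=> j; apply: cell_len_anti.
  rewrite -mulrA ler_wpM2l ?mulr_ge0//.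
  rewrite (_ : s = q * n%:R); last by rewrite /q divfK// gt_eqF.
  rewrite ler_wpM2r// /cell_len mul0r (min_idPl (ltW t0)) subr0 mul1r.
  by rewrite ge_min lexx.
have SZ := opZ mu0 dsx ((t^-1 : R)%:C%C) incH.
apply: filterS2 SZ => x SZ /(_ id) hx; rewrite SZ// -mulrBr cnormM ti.
by rewrite ler_pdivrMl// [leRHS](_ : _ = 2 * B * s)//; field; rewrite gt_eqF.
Qed.

End smoothing.

(** * Lattice sums and trigonometric polynomials *)

Section grid_refinement.
Context {R : realType}.
Variables (h t : R) (m : nat).
Hypotheses (m0 : (0 < m)%N).

Lemma sum_cell_len_from (k : R) (a n : nat) :
  \sum_(i < n) cell_len k t (a + i)%N =
  Num.min ((a + n)%:R * k) t - Num.min (a%:R * k) t.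
Proof.
elim: n => [|n ih]; first by rewrite big_ord0 addn0 subrr.
by rewrite big_ord_recr /= ih /cell_len addnS addrC addrA subrK.
Qed.

(** The lengths of the [m] fine cells inside a coarse one telescope to its length, also when [t]
    cuts it. *)
Lemma sum_cell_refine (Y : nat -> R[i]) M :
  \sum_(j < M * m) (cell_len (h / m%:R) t j)%:C%C * Y (j %/ m)%N =
  \sum_(k < M) (cell_len h t k)%:C%C * Y k.
Proof.
have mm : m%:R != 0 :> R by rewrite pnatr_eq0 -lt0n.
elim: M => [|M ih]; first by rewrite !big_ord0.
rewrite mulSnr big_split_ord/= ih big_ord_recr/=; congr (_ + _).
under eq_bigr do rewrite divnMDl// divn_small// addn0.
rewrite -mulr_suml -rmorph_sum/= sum_cell_len_from; congr (_%:C%C * _).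
rewrite /cell_len -mulSnr !natrM.
have k n : n%:R * m%:R * (h / m%:R) = n%:R * h by field.
by rewrite !k.
Qed.

End grid_refinement.

Section lattice_sums.
Context {d : measure_display} {T : measurableType d} {R : realType}.
Variable mu : {measure set T -> \bar R}.
Hypothesis mu0 : (0 < mu setT)%E.
Variable S : R -> (T -> R[i]) -> T -> R[i].
Hypothesis Ssg : ds_semigroup mu S.
Hypothesis Scont : strongly_continuous_L1 mu S.
Variable p : R.
Hypothesis p1 : 1 <= p.
Variable K : R.
Hypotheses (K0 : 0 < K)
  (KP : forall A, dunford_schwartz mu A -> ds_extended mu A ->
    forall f, cLp mu p%:E f -> cLp mu p%:E (A f) /\
      (cLnorm mu p%:E (A f) <= K%:E * cLnorm mu p%:E f)%E).
Implicit Types (f g : T -> R[i]) (b q : R -> R[i]).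

Local Notation L := (lebesgueTypeR R).
Local Notation N f := (cLnorm mu p%:E f).

(** Unlike [rsum], this samples the weight too; for a trigonometric polynomial it becomes a
    combination of sums of [lambda^j P^j f]. *)
Definition lsum h t M q f x : R[i] :=
  \sum_(j < M) (cell_len h t j)%:C%C * (q (j%:R * h) * S (j%:R * h) f x).

Lemma semigroup_lipschitz (B A : R) f r s : L1b mu B f ->
  (forall s, 0 <= s -> {ae mu, forall x, cnorm (S s f x - f x) <= A * s}) ->
  0 <= r -> 0 <= s -> {ae mu, forall x, cnorm (S (r + s) f x - S r f x) <= A * s}.
Proof.
move=> Lf lip r0 s0; have [lf _] := Lf.
have LSf := L1b_semigroup mu0 Ssg s0 Lf.
have dsx := dsg_ext Ssg r0.
have h1 := dsgD Ssg r0 s0 lf.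
have h2 := opB dsx (L1b_inc mu0 LSf) (L1b_inc mu0 Lf).
have h3 : {ae mu, forall x, cnorm (S r (fun y => S s f y - f y) x) <= A * s}.
  apply: (op_oo mu0 dsx); last exact: lip.
  by case: (L1bB LSf Lf) => -[].
by apply: filterS3 h1 h2 h3 => x -> // -> //.
Qed.

Section comparison.
Variables (b q : R -> R[i]) (C Q e h : R).
Hypotheses (ab : admissible b C)
  (mq : cmeasurable (`[0, +oo[%classic : set L) (q : L -> R[i]))
  (Q0 : 0 <= Q) (qQ : forall s, 0 <= s -> cnorm (q s) <= Q)
  (e0 : 0 <= e) (h0 : 0 < h)
  (qe : forall s s', 0 <= s -> 0 <= s' -> `|s - s'| <= h -> cnorm (q s - q s') <= e).
Variables (t c : R).
Hypotheses (t0 : 0 <= t)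
  (bqc : (\int[leb]_(s in (`[0%R, t] : set L)) (cnorm (b s - q s)%R)%:E <= c%:E)%E).

Local Notation D := (`[0%R, t]%classic : set L).

Let mbq E : measurable E -> E `<=` D ->
  measurable_fun E (fun s : L => (cnorm (b s - q s))%:E).
Proof.
move=> mE ED; have [mb _ _] := ab.
apply: (@measurable_funS _ _ L _ (`[0, +oo[%classic : set L)).
- exact: leb_measurable_itv.
- by move=> s /ED /=; rewrite !in_itv/= andbT => /andP[].
by apply: measurable_cnormE; exact: cmeasurableB.
Qed.

Let bq_ge0 E : (0 <= \int[leb]_(s in E) (cnorm (b s - q s)%R)%:E)%E.
Proof. by apply: integral_ge0 => s _; rewrite lee_fin cnorm_ge0. Qed.

Let bq_cell k j : ((\int[leb]_(s in cell k t j) (cnorm (b s - q s)%R)%:E) < +oo)%E.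
Proof.
apply: (@le_lt_trans _ _ c%:E); last exact: ltry.
apply: le_trans bqc; apply: ge0_subset_integral.
- exact: measurable_cell.
- exact: leb_measurable_itv.
- by apply: mbq => //; exact: leb_measurable_itv.
- by move=> s _; rewrite lee_fin cnorm_ge0.
- exact: cell_sub.
Qed.

Lemma sum_bq_cell k M : 0 < k ->
  \sum_(j < M) fine (\int[leb]_(s in cell k t j) (cnorm (b s - q s)%R)%:E)%E <= c.
Proof.
move=> k0; rewrite -lee_fin -sumEFin.
under eq_bigr do rewrite fineK ?ge0_fin_numE ?bq_cell ?bq_ge0//.
have mD : measurable_fun D (fun s : L => (cnorm (b s - q s))%:E).
  by apply: mbq => //; exact: leb_measurable_itv.
apply: le_trans bqc; apply: sum_integral_cell => //.
- by move=> s; rewrite lee_fin cnorm_ge0.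
Qed.

Lemma cnorm_cint_osc k j : 0 < k -> k <= h ->
  cnorm (cint (cell k t j) b - (cell_len k t j)%:C%C * q (j%:R * k)) <=
  2 * fine (\int[leb]_(s in cell k t j) (cnorm (b s - q s)%R)%:E)%E +
  2 * e * cell_len k t j.
Proof.
move=> k0 kh; have [mb C0 bC] := ab.
have mE := measurable_cell k t j.
have cb := sub_cintegrable mb C0 bC t0 mE (@cell_sub _ k t j).
have cq : cintegrable (cell k t j) (fun=> q (j%:R * k)).
  have Eoo : (leb (cell k t j) < +oo)%E by rewrite leb_cell// ltry.
  have mc : cmeasurable (cell k t j) ((fun=> q (j%:R * k)) : L -> R[i]).
    by split; exact: measurable_cst.
  apply: (cintegrable_bounded mE Eoo mc (cnorm_ge0 (q (j%:R * k)))).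
  by apply: aeW => s _.
rewrite -lee_fin EFinD !EFinM fineK ?ge0_fin_numE ?bq_cell ?bq_ge0//.
rewrite -cint_cell_cst// cintB//.
apply: le_trans (cnorm_cint mE (cintegrableB mE cb cq)) _.
have m1 := mbq mE (@cell_sub _ k t j).
have i1 : (2%:E * \int[leb]_(s in cell k t j) (cnorm (b s - q s)%R)%:E =
    \int[leb]_(s in cell k t j) (2%:E * (cnorm (b s - q s)%R)%:E))%E.
  by rewrite ge0_integralZl_EFin// => s _; rewrite lee_fin cnorm_ge0.
have i2 : (2%:E * e%:E * (cell_len k t j)%:E =
    \int[leb]_(s in cell k t j) (cst (2%:E * e%:E) s))%E.
  by rewrite integral_cst // -leb_cell.
have m2 : measurable_fun (cell k t j) (fun s : L => 2%:E * (cnorm (b s - q s))%:E)%E.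
  exact: measurable_funeM.
rewrite i1 i2 -ge0_integralD//; last 2 first.
- by move=> s _; rewrite -EFinM lee_fin mulr_ge0 ?cnorm_ge0.
- by move=> s _; rewrite /= -EFinM lee_fin mulr_ge0.
have m3 := measurable_abs1 (cintegrable_measurable (cintegrableB mE cb cq)).
have m4 : measurable_fun (cell k t j) (fun s : L =>
    2%:E * (cnorm (b s - q s))%:E + cst (2%:E * e%:E) s)%E.
  exact: emeasurable_funD.
apply: ge0_le_integral => //.
- by move=> s _; rewrite lee_fin abs1_ge0.
move=> s /cellP[s1 s2 s3 _]; rewrite /= -!EFinM -EFinD lee_fin.
apply: le_trans (abs1_le_cnorm _) _; rewrite -mulrDr ler_wpM2l//.
apply: le_trans (cnorm_triangle _ _ (q s)) _; rewrite lerD2l qe//.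
  by rewrite mulr_ge0// ltW.
rewrite ger0_norm ?subr_ge0//; apply: le_trans kh.
by move: s2; rewrite -natr1 mulrDl mul1r; move: s1; lra.
Qed.

(** The lattice mesh [h] is tied to [q] and not to [t], and the error, apart from [c], is [t] times
    a constant. Three replacements are made: [b] by [q], the samples of [q] by those at lattice
    nodes, and the orbit by its values there. *)
Lemma orbit_integral_lsum f (B A : R) M : cLp mu p%:E f -> 0 <= B -> L1b mu B f -> 0 <= A ->
  (forall s, 0 <= s -> {ae mu, forall x, cnorm (S s f x - f x) <= A * s}) ->
  t < M%:R * h ->
  {ae mu, forall x, cnorm (orbit_integral mu S p b f t x - lsum h t M q f x) <=
    2 * B * c + (3 * e * B + Q * A * h) * t}.
Proof.
move=> lf B0 Lf A0 lip tM.
have lls : cLp mu p%:E (lsum h t M q f).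
  apply: cLp_sum => // j _; apply: cLpZ => //; apply: cLpZ => //.
  by apply: (semigroup_cLp Ssg KP) => //; rewrite mulr_ge0// ltW.
have mls : cmeasurable setT (lsum h t M q f) by case: lls.
have mG : cmeasurable setT (orbit_integral mu S p b f t).
  by case: (cLp_orbit_integral mu0 Ssg Scont p1 K0 KP ab lf t0).
suff : {ae mu, forall x, ~ set0 x -> cnorm (orbit_integral mu S p b f t x - lsum h t M q f x) <=
    2 * B * c + (3 * e * B + Q * A * h) * t}.
  by apply: filterS => x /(_ id).
apply: (ae_le_lim p1); first exact: cmeasurableB.
move=> eps eps0.
have [k k0 kP] := orbit_integral_approx mu0 Ssg Scont p1 K0 KP ab lf t0 eps0.
(* An auxiliary refinement of the lattice, fine enough for the Riemann sum to approach the integral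
   in norm; [m] depends on [t] and [eps] but leaves no trace in the bound. *)
pose m := (Num.bound (h / k)).+1.
have m0 : 0 < m%:R :> R by rewrite ltr0n.
have mm : m%:R != 0 :> R by rewrite gt_eqF.
pose n := h / m%:R; have n0 : 0 < n by rewrite divr_gt0.
have nk : n <= k.
  rewrite /n ler_pdivrMr// mulrC -ler_pdivrMr//; apply: ltW.
  apply: lt_trans (archi_boundP _) _; first by rewrite divr_ge0// ltW.
  by rewrite ltr_nat.
have nh : n <= h.
  by rewrite /n ler_pdivrMr// ler_pMr// ler1n.
have modh (j : nat) : (j %% m)%:R * n <= h.
  rewrite /n mulrCA -[leRHS]mulr1 ler_wpM2l ?(ltW h0)//.
  by rewrite ler_pdivrMr// mul1r ler_nat ltnW// ltn_mod.
have tMn : t < (M * m)%:R * n.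
  by rewrite natrM /n (_ : _ * _ * _ = M%:R * h)//; field.
set r := rsum n t (M * m) (fun s => S s f) b.
have mr : cmeasurable setT r.
  by case: (cLp_rsum Ssg p1 KP t (M * m) b n0 lf).
exists (fun x => r x - lsum h t M q f x); split; first exact: cmeasurableB.
  rewrite (_ : (fun x => _) = (fun x => orbit_integral mu S p b f t x - r x)); first exact: kP.
  by apply/funext => x; ring.
have h1 := L1b_orbit mu0 Ssg (ltW n0) Lf.
have h2 : {ae mu, forall x, forall j : nat,
    cnorm (S (j%:R * n) f x - S ((j %/ m)%:R * h) f x) <= A * h}.
  apply: ae_foralln => j.
  have a0 : 0 <= (j %/ m)%:R * h by rewrite mulr_ge0// ltW.
  have b0 : 0 <= (j %% m)%:R * n by rewrite mulr_ge0// ltW.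
  have := semigroup_lipschitz Lf lip a0 b0.
  rewrite (_ : _ + _ = j%:R * n); last first.
    by rewrite {3}(divn_eq j m) natrD natrM /n; field.
  by apply: filterS => x /le_trans; apply; rewrite ler_wpM2l.
apply: filterS2 h1 h2 => x h1 h2 _.
rewrite /lsum.
rewrite -(sum_cell_refine h t (ltn0Sn _ : (0 < m)%N)
  (fun k => q (k%:R * h) * S (k%:R * h) f x)) -/n /r /rsum -sumrB.
apply: le_trans (cnorm_sum _ _ _) _.
pose bq j := fine (\int[leb]_(s in cell n t j) (cnorm (b s - q s)%R)%:E)%E.
apply: (@le_trans _ _ (\sum_(j < M * m) (2 * B * bq j +
    (3 * e * B + Q * A * h) * cell_len n t j))); last first.
  rewrite big_split/= -!mulr_sumr lerD// ler_wpM2l ?mulr_ge0//.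
  - exact: sum_bq_cell.
  - by rewrite addr_ge0// !mulr_ge0// ltW.
  - exact: sum_cell_len.
apply: ler_sum => j _.
set X := S (j%:R * n) f x; set Y := S ((j %/ m)%:R * h) f x.
set l := cell_len n t j; set z := q (j%:R * n); set w := q ((j %/ m)%:R * h).
have l0 : 0 <= l by apply: cell_len_ge0.
rewrite (_ : _ - _ = (cint (cell n t j) b - l%:C%C * z) * X +
  (l%:C%C * ((z - w) * X) + l%:C%C * (w * (X - Y)))); last by ring.
apply: le_trans (cnormD _ _) _; apply: le_trans (lerD (lexx _) (cnormD _ _)) _.
have X1 : cnorm X <= B by exact: h1.
have XY : cnorm (X - Y) <= A * h by exact: h2.
have w1 : cnorm w <= Q by apply: qQ; rewrite mulr_ge0// ltW.
have zw : cnorm (z - w) <= e.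
  have jn : 0 <= j%:R * n by rewrite mulr_ge0// ltW.
  have jh : 0 <= (j %/ m)%:R * h by rewrite mulr_ge0// ltW.
  have jm : 0 <= (j %% m)%:R * n by rewrite mulr_ge0// ltW.
  apply: qe => //.
  have -> : j%:R * n - (j %/ m)%:R * h = (j %% m)%:R * n.
    by rewrite {1}(divn_eq j m) natrD natrM /n; field.
  by rewrite ger0_norm.
have o1 := cnorm_cint_osc j n0 nh; rewrite -/l -/z -/(bq j) in o1.
rewrite !cnormM cnorm_real (ger0_norm l0).
(* The final [3 * e * B] is [2 * e * B] from the oscillation of [q] in the fine cell, doubled by
   [abs1], and [e * B] from moving the sample to the lattice node. *)
apply: (@le_trans _ _ ((2 * bq j + 2 * e * l) * B + (l * (e * B) + l * (Q * (A * h))))).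
  apply: lerD; first by rewrite ler_pM// cnorm_ge0.
  by apply: lerD; rewrite ler_wpM2l// ler_pM// cnorm_ge0.
by rewrite le_eqVlt; apply/orP; left; apply/eqP; ring.
Qed.

End comparison.
End lattice_sums.

Section trigonometric_polynomials.
Context {R : realType}.
Local Notation L := (lebesgueTypeR R).
Implicit Types q : R -> R[i].

Lemma expi_near1 (e : R) : 0 < e ->
  exists2 h : R, 0 < h & forall u : R, `|u| <= h -> cnorm (expi u - 1) <= e.
Proof.
move=> e0; have e20 : 0 < e / 2 by rewrite divr_gt0.
have /cvgrPdist_le/(_ _ e20) cc := @continuous_cos R 0.
have /cvgrPdist_le/(_ _ e20) cs := @continuous_sin R 0.
have [h h0 hP] := filterI cc cs.
exists (h / 2); first by rewrite divr_gt0.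
move=> u uh; have [|c s] := hP u.
  rewrite /= sub0r normrN; apply: le_lt_trans uh _.
  by rewrite ltr_pdivrMr// ltr_pMr// ltr1n.
apply: le_trans (cnorm_le_ReIm _) _; rewrite (splitr e) /= subr0 lerD//.
  by move: c; rewrite cos0 distrC.
by move: s; rewrite sin0 sub0r normrN.
Qed.

Lemma measurable_expi (th : R) :
  cmeasurable (`[0, +oo[%classic : set L) ((fun s => expi (th * s)) : L -> R[i]).
Proof.
have key (f : R -> R) : continuous f ->
    measurable_fun (`[0, +oo[%classic : set L) ((fun s => f (th * s)) : L -> R).
  move=> cf; apply: (@measurable_funS _ _ L _ setT); [exact: measurableT|exact: subsetT|].
  move=> _ Y mY; rewrite setTI; apply: leb_measurable.
  have mf : measurable_fun [set: R] (fun s => f (th * s)).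
    apply: measurableT_comp; first exact: continuous_measurable_fun.
    exact: measurable_funM.
  by rewrite -[X in measurable X]setTI; exact: mf.
by split; apply: key; [exact: continuous_cos|exact: continuous_sin].
Qed.

Variable q : R -> R[i].
Hypothesis tq : trig_poly q.

Lemma trig_poly_measurable : cmeasurable (`[0, +oo[%classic : set L) (q : L -> R[i]).
Proof.
have [n [w [th qE]]] := tq; rewrite (_ : q = fun s => \sum_j w j * expi (th j * s)).
  by apply: cmeasurable_sum => j _; apply: cmeasurableZ; exact: measurable_expi.
exact/funext.
Qed.

Lemma trig_poly_bounded : exists2 Q : R, 0 <= Q & forall s, cnorm (q s) <= Q.
Proof.
have [n [w [th qE]]] := tq; exists (\sum_j cnorm (w j)).
  by apply: sumr_ge0 => j _; exact: cnorm_ge0.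
move=> s; rewrite qE; apply: le_trans (cnorm_sum _ _ _) _.
by apply: ler_sum => j _; rewrite cnormM cnorm_expi mulr1.
Qed.

Lemma trig_poly_uniform_continuity (e : R) : 0 < e -> exists2 h : R, 0 < h &
  forall s s', `|s - s'| <= h -> cnorm (q s - q s') <= e.
Proof.
move=> e0; have [n [w [th qE]]] := tq.
pose W := \sum_j cnorm (w j); pose H := \sum_j `|th j|.
have W0 : 0 < W + 1 by rewrite ltr_wpDl// sumr_ge0// => j _; exact: cnorm_ge0.
have H0 : 0 < H + 1 by rewrite ltr_wpDl// sumr_ge0.
have [k k0 kP] := expi_near1 (divr_gt0 e0 W0).
exists (k / (H + 1)); first by rewrite divr_gt0.
move=> s s' ss; rewrite !qE -sumrB.
apply: le_trans (cnorm_sum _ _ _) _.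
apply: (@le_trans _ _ (\sum_j cnorm (w j) * (e / (W + 1)))); last first.
  rewrite -mulr_suml -/W mulrCA -[leRHS]mulr1 ler_wpM2l ?(ltW e0)//.
  by rewrite ler_pdivrMr// mul1r lerDl.
apply: ler_sum => j _; rewrite -mulrBr cnormM ler_wpM2l ?cnorm_ge0//.
have -> : expi (th j * s) - expi (th j * s') =
    expi (th j * s') * (expi (th j * (s - s')) - 1).
  by rewrite mulrBr mulr1 -expiD -mulrDr subrKC.
rewrite cnormM cnorm_expi mul1r kP// normrM.
apply: (@le_trans _ _ ((H + 1) * `|s - s'|)); last by rewrite mulrC -ler_pdivlMr.
rewrite ler_wpM2r// /H (bigD1 j)//= -addrA lerDl addr_ge0// sumr_ge0//.
Qed.

End trigonometric_polynomials.

Section lattice_convergence.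
Context {d : measure_display} {T : measurableType d} {R : realType}.
Variable mu : {measure set T -> \bar R}.
Hypothesis mu0 : (0 < mu setT)%E.
Variable S : R -> (T -> R[i]) -> T -> R[i].
Hypothesis Ssg : ds_semigroup mu S.
Variables (g : T -> R[i]) (B h : R).
Hypotheses (B0 : 0 <= B) (Lg : L1b mu B g) (h0 : 0 < h).

Local Notation ncell t := (Num.truncn (t / h)).+1.

Lemma ncell_gt t : t < (ncell t)%:R * h.
Proof. by rewrite -ltr_pdivrMr// truncnS_gt. Qed.

Lemma au_cauchy_sum (n : nat) (u : 'I_n -> R -> T -> R[i]) :
  (forall j, au_cauchy mu (u j)) -> au_cauchy mu (fun t x => \sum_j u j t x).
Proof.
elim: n u => [|n ih] u wu.
  rewrite (_ : (fun t x => _) = fun _ _ => 0); first exact: au_cauchy0.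
  by apply/funext => t; apply/funext => x; rewrite big_ord0.
rewrite (_ : (fun t x => _) = fun t x => u ord0 t x + \sum_(j < n) u (lift ord0 j) t x).
  by apply: au_cauchyD => //; exact: (ih (fun j => u (lift ord0 j))).
by apply/funext => t; apply/funext => x; rewrite big_ord_recl.
Qed.

(** With [n] the integer part of [t / h], the first [n] cells have length [h]. Replacing [h / t] by
    [1 / n] and dropping the last cell each cost at most [B * h / t], and what remains is the
    discrete average of length [n]. *)
Lemma au_cauchy_monomial (th : R) :
  au_cauchy mu (fun t x => (t^-1)%:C%C * lsum S h t (ncell t) (fun s => expi (th * s)) g x).
Proof.
pose P n := S (n%:R * h); pose e n := expi (th * (n%:R * h)).
have Pds : ds_sequence mu P := semigroup_ds_sequence Ssg (ltW h0).
have e0 : e 0%N = 1 by rewrite /e mul0r mulr0 expi0.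
have eD m n : e (m + n)%N = e m * e n by rewrite /e natrD mulrDl mulrDr expiD.
have e1 n : cnorm (e n) = 1 by rewrite /e cnorm_expi.
apply: au_cauchy_approx => eps de eps0 de0.
(* The first summand guarantees [n >= 1], the second makes the error [2 * B * h / t] at most
   [de]. *)
exists (fun t x => ravg P e (Num.truncn (t / h)) g x), set0, (h + 2 * B * h / de).
split => //; last 2 first.
- by rewrite measure0 lee_fin ltW.
- move=> t tge.
  have d0 : 0 <= 2 * B * h / de by rewrite divr_ge0 ?mulr_ge0 ?(ltW de0)// ltW.
  have ht : h <= t by apply: le_trans tge; rewrite lerDl.
  have t0 : 0 < t by exact: lt_le_trans ht.
  have dt : 2 * B * h <= de * t.
    by rewrite [leRHS]mulrC -ler_pdivrMr//; apply: le_trans tge; rewrite lerDr ltW.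
  set n := Num.truncn (t / h).
  have /andP[nt tn] : n%:R <= t / h < n.+1%:R.
    by apply: truncn_itv; rewrite divr_ge0// ltW.
  have n0 : 0 < n%:R :> R.
    by rewrite ltr0n truncn_gt0 ler_pdivlMr// mul1r.
  have nh : n%:R * h <= t by rewrite -ler_pdivlMr.
  have tnh : t < n%:R * h + h by move: tn; rewrite ltr_pdivrMr// -natr1 mulrDl mul1r.
  have lenn : 0 <= cell_len h t n <= h.
    rewrite cell_len_ge0 ?(ltW t0)//= /cell_len -natr1 mulrDl mul1r.
    by rewrite (min_idPl nh) (min_idPr (ltW tnh)); lra.
  have lenj (j : 'I_n) : cell_len h t j = h.
    have j1 : j.+1%:R * h <= t.
      by apply: le_trans nh; rewrite ler_pM2r// ler_nat.
    rewrite /cell_len (min_idPl j1) (min_idPl _); first by rewrite -natr1; ring.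
    by apply: le_trans j1; rewrite ler_pM2r// ler_nat.
  apply: filterS (L1b_orbit mu0 Ssg (ltW h0) Lg) => x xB _.
  rewrite /lsum big_ord_recr/=.
  under eq_bigr do rewrite lenj.
  rewrite -mulr_sumr /ravg -/(e n) -/(P n).
  set s := \sum_(i < n) _; set z := e n * P n g x.
  have sB : cnorm s <= n%:R * B.
    apply: le_trans (cnorm_sum _ _ _) _.
    apply: (@le_trans _ _ (\sum_(j < n) B)).
      by apply: ler_sum => j _; rewrite cnormM cnorm_expi mul1r.
    by rewrite sumr_const card_ord -[leLHS]mulr_natl.
  have zB : cnorm z <= B by rewrite /z cnormM e1 mul1r; exact: xB.
  clearbody s z; move: (cell_len h t n) lenn => l lenn.
  rewrite (_ : _ - _ =
      (t^-1 * h - n%:R^-1)%:C%C * s + (t^-1 * l)%:C%C * z); last first.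
    by rewrite rmorphB !rmorphM/=; ring.
  apply: le_trans (cnormD _ _) _; rewrite !cnormM !cnorm_real.
  have ti : 0 < t^-1 by rewrite invr_gt0.
  have a1 : `|t^-1 * h - n%:R^-1| <= t^-1 * h / n%:R.
    rewrite ler0_norm; last first.
      by rewrite subr_le0 mulrC ler_pdivrMr// ler_pdivlMl.
    rewrite (_ : - _ = (t - n%:R * h) * (t^-1 / n%:R)); last by field; rewrite !gt_eqF.
    rewrite (_ : t^-1 * h / n%:R = h * (t^-1 / n%:R)); last by ring.
    by rewrite ler_wpM2r ?mulr_ge0 ?invr_ge0 ?(ltW n0) ?(ltW t0)//; lra.
  have a2 : `|t^-1 * l| <= t^-1 * h.
    have /andP[l1 l2] := lenn.
    by rewrite ger0_norm ?mulr_ge0 ?(ltW ti)// ler_wpM2l ?(ltW ti).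
  apply: (@le_trans _ _ (t^-1 * h / n%:R * (n%:R * B) + t^-1 * h * B)).
    by apply: lerD; [exact: (ler_pM (normr_ge0 _) (cnorm_ge0 _) a1 sB)|exact: (ler_pM (normr_ge0 _) (cnorm_ge0 _) a2 zB)].
  rewrite (_ : _ + _ = t^-1 * (2 * B * h)); last by field; rewrite !gt_eqF.
  by rewrite ler_pdivrMl// [leRHS]mulrC.
move=> eps' de' eps'0 de'0.
have [E [n0 [mE muE EP]]] := discrete_au_cauchy mu0 Pds e0 eD e1 B0 Lg eps'0 de'0.
exists E, (n0.+1%:R * h); split => //; first by rewrite mulr_gt0.
have n0P t : n0.+1%:R * h <= t -> (n0 <= Num.truncn (t / h))%N.
  by move=> tn; apply: ltnW; rewrite truncn_gt_nat ler_pdivlMr.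
move=> t t' tn tn'; apply: filterS EP => x EP nE.
by apply: EP => //; exact: n0P.
Qed.

Lemma au_cauchy_trig_poly q : trig_poly q ->
  au_cauchy mu (fun t x => (t^-1)%:C%C * lsum S h t (ncell t) q g x).
Proof.
move=> [n [w [th qE]]].
rewrite (_ : (fun t x => _) = fun t x => \sum_j w j *
    ((t^-1)%:C%C * lsum S h t (ncell t) (fun s => expi (th j * s)) g x)).
  by apply: (@au_cauchy_sum n (fun j t x => _)) => j; apply: au_cauchyZ; exact: au_cauchy_monomial.
apply/funext => t; apply/funext => x; rewrite /lsum mulr_sumr.
under eq_bigr do rewrite qE mulr_suml !mulr_sumr.
rewrite exchange_big/=; apply: eq_bigr => j _.
by rewrite !mulr_sumr; apply: eq_bigr => i _; ring.
Qed.

End lattice_convergence.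

(** * Besicovitch weights *)

Lemma pint_le_of_cLnorm d (T : measurableType d) (R : realType)
    (mu : {measure set T -> \bar R}) (p e : R) (f : T -> R[i]) : 0 < p ->
  (cLnorm mu p%:E f <= e%:E)%E -> (pint mu p f <= (e `^ p)%:E)%E.
Proof.
move=> p0 fe; have e0 := le_trans (cLnorm_ge0 mu p%:E f) fe.
rewrite pintE ?gt_eqF// -poweR_EFin; apply: gt0_ler_poweR; rewrite ?(ltW p0)//.
  by rewrite in_itv/= cLnorm_ge0 leey.
by rewrite in_itv/= e0 leey.
Qed.

Lemma limf_esup_pinfty_lt {R : realType} (F : R -> \bar R) (e : \bar R) :
  (limf_esup F (pinfty_nbhs R) < e)%E ->
  exists t0 : R, forall t, t0 < t -> (F t <= e)%E.
Proof.
move=> /ereal_inf_lt[_ [V [M [_ MV]] <-] Ve]; exists M => t Mt.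
apply: le_trans (ltW Ve); apply: ereal_sup_ubound; exists t => //.
exact: MV.
Qed.

Lemma besicovitch_admissible {R : realType} (b : R -> R[i]) (C : R) :
  bounded_besicovitch b -> (Rplus_norm b < C%:E)%E -> admissible b C.
Proof.
move=> [mb _ _] bC.
have leb0 : (0 < leb [set: lebesgueTypeR R])%E.
  apply: (@lt_le_trans _ _ (leb (`[0%R, 1%R]%classic : set (lebesgueTypeR R)))).
    by rewrite leb_cc// lte01.
  apply: le_measure; rewrite ?inE//; exact: leb_measurable_itv.
split => //.
  by rewrite -lee_fin; apply: le_trans (ltW bC); exact: cLnorm_ge0.
have := (cLnormooP leb0 _ _).1 (ltW bC).
apply: filterS => s + s0; rewrite indicE mem_set ?mulr1//.
by rewrite /= in_itv/= andbT.
Qed.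

Section besicovitch_averages.
Context {d : measure_display} {T : measurableType d} {R : realType}.
Variable mu : {measure set T -> \bar R}.
Hypothesis mu0 : (0 < mu setT)%E.
Variable S : R -> (T -> R[i]) -> T -> R[i].
Hypothesis Ssg : ds_semigroup mu S.
Hypothesis Scont : strongly_continuous_L1 mu S.
Variable p : R.
Hypothesis p1 : 1 <= p.
Variable K : R.
Hypotheses (K0 : 0 < K)
  (KP : forall A, dunford_schwartz mu A -> ds_extended mu A ->
    forall f, cLp mu p%:E f -> cLp mu p%:E (A f) /\
      (cLnorm mu p%:E (A f) <= K%:E * cLnorm mu p%:E f)%E).
Variables (b : R -> R[i]) (C : R).
Hypotheses (bb : bounded_besicovitch b) (ab : admissible b C).
Implicit Types (f g : T -> R[i]).

Local Notation L := (lebesgueTypeR R).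
Local Notation N f := (cLnorm mu p%:E f).

Lemma besicovitch_approx (e : R) : 0 < e -> exists q t0, [/\ trig_poly q, 0 < t0 &
  forall t, t0 <= t -> (\int[leb]_(s in (`[0%R, t] : set L))
    (cnorm (b s - q s)%R)%:E <= (e * t)%:E)%E].
Proof.
move=> e0; have [_ _ /(_ _ e0)[q tq /limf_esup_pinfty_lt[t0 t0P]]] := bb.
exists q, (`|t0| + 1); split => //.
move=> t t0t; have tt0 : t0 < t.
  by apply: lt_le_trans t0t; rewrite ltr_pwDr// ler_norm.
have t_0 : 0 < t by apply: lt_le_trans t0t; rewrite ltr_wpDl.
by have := t0P t tt0; rewrite lee_pdivrMl// muleC.
Qed.

Lemma au_cauchy_smooth g (B A : R) : cLp mu p%:E g -> 0 <= B -> L1b mu B g -> 0 <= A ->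
  (forall s, 0 <= s -> {ae mu, forall x, cnorm (S s g x - g x) <= A * s}) ->
  au_cauchy mu (fun t x => (t^-1)%:C%C * orbit_integral mu S p b g t x).
Proof.
move=> lg B0 Lg A0 lip; apply: au_cauchy_approx => eps de eps0 de0.
(* The three terms [2 * B * c / t], [3 * e * B] and [Q * A * h] each get a third of [de], whence the
   6, the 9 and the 3 below; adding 1 keeps the denominators nonzero. *)
have B10 : 0 < 6 * (B + 1) by rewrite mulr_gt0// ltr_wpDl.
have [q [t0 [tq t00 bq]]] := besicovitch_approx (divr_gt0 de0 B10).
have [Q Q0 qQ] := trig_poly_bounded tq.
have B90 : 0 < 9 * (B + 1) by rewrite mulr_gt0// ltr_wpDl.
have [h1 h10 qe] := trig_poly_uniform_continuity tq (divr_gt0 de0 B90).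
have QA0 : 0 <= Q * A by rewrite mulr_ge0.
have QA1 : 0 < 3 * (Q * A + 1) by rewrite mulr_gt0// ltr_wpDl.
pose h := Num.min h1 (de / (3 * (Q * A + 1))).
have h0 : 0 < h by rewrite lt_min h10 divr_gt0.
have hh1 : h <= h1 by rewrite ge_min lexx.
have hh2 : h * (3 * (Q * A + 1)) <= de by rewrite -ler_pdivlMr// ge_min lexx orbT.
exists (fun t x => (t^-1)%:C%C * lsum S h t (Num.truncn (t / h)).+1 q g x), set0, t0.
split => //.
- exact: (au_cauchy_trig_poly mu0 Ssg B0 Lg h0 tq).
- by rewrite measure0 lee_fin ltW.
move=> t t0t; have t_0 : 0 < t by exact: lt_le_trans t0t.
have qe' s s' : 0 <= s -> 0 <= s' -> `|s - s'| <= h ->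
    cnorm (q s - q s') <= de / (9 * (B + 1)).
  by move=> _ _ ss; apply: qe; exact: le_trans hh1.
have cmp := orbit_integral_lsum mu0 Ssg Scont p1 K0 KP ab (trig_poly_measurable tq) Q0
  (fun s _ => qQ s) (ltW (divr_gt0 de0 B90)) h0 qe' (ltW t_0) (bq t t0t) lg B0 Lg A0 lip
  (ncell_gt h0 t).
apply: filterS cmp => x cmp _; rewrite -mulrBr cnormM cnorm_real ger0_norm ?invr_ge0 ?(ltW t_0)//.
rewrite ler_pdivrMl//; apply: le_trans cmp _.
have B1 : B / (B + 1) <= 1 by rewrite ler_pdivrMr ?ltr_wpDl// mul1r lerDl.
have BB : B + 1 != 0 by rewrite gt_eqF// ltr_wpDl.
rewrite (_ : 2 * B * _ = (de / 3 * (B / (B + 1))) * t); last by field.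
rewrite (_ : 3 * _ * B = de / 3 * (B / (B + 1))); last by field.
rewrite -mulrDl mulrC ler_wpM2l ?(ltW t_0)//.
have dB : de / 3 * (B / (B + 1)) <= de / 3.
  by rewrite -[leRHS]mulr1 ler_wpM2l// divr_ge0// ltW.
have QAh : Q * A * h <= de / 3.
  rewrite ler_pdivlMr//; apply: le_trans hh2.
  by move: (ltW h0) QA0; move: (Q * A) => z; nra.
lra.
Qed.

(** Smoothing is controlled in L^1 only. As it keeps the bound [B], the difference is bounded by
    [2 * B], and interpolation turns L^1 closeness into L^p closeness. *)
Lemma smooth_dense f (e : R) : 0 < e -> cLp mu p%:E f -> exists g B A,
  [/\ cLp mu p%:E g, (N (fun x => (f x - g x)%R) <= e%:E)%E,
      0 <= B /\ L1b mu B g, 0 <= A &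
      forall s, 0 <= s -> {ae mu, forall x, cnorm (S s g x - g x) <= A * s}].
Proof.
move=> e0 lf; have e20 : 0 < e / 2 by rewrite divr_gt0.
have [g0 [B [lg0 B0 g0B fg0]]] := dense_L1_bounded p1 e20 lf.
have Lg0 : L1b mu B g0 by split => //; exact: aeW.
have BB0 : 0 < (B + B + 1) `^ (p - 1) by rewrite powR_gt0// ltr_wpDl// addr_ge0.
have ep0 : 0 < (e / 2) `^ p / (B + B + 1) `^ (p - 1) by rewrite divr_gt0// powR_gt0.
have [g [A [Lg gg0 A0 lip]]] := smoothing mu0 Ssg Scont B0 ep0 Lg0.
have [lg1 gB] := Lg.
have lg : cLp mu p%:E g by exact: cLp_interp gB.
have lg0p : cLp mu p%:E g0 by case: Lg0 => ? g0B'; exact: cLp_interp g0B'.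
exists g, B, A; split => //.
have [mf _] := lf; have [mg _] := lg; have [mg0 _] := lg0p.
apply: le_trans (cLnorm_triangle mu p1 mf mg mg0) _.
rewrite (splitr e) EFinD; apply: leeD => //; rewrite cLnorm_distC.
apply: cLnorm_le_of_pint; [exact: lt_le_trans p1|exact: ltW|].
have B10 : 0 <= B + B + 1 by rewrite addr_ge0// addr_ge0.
apply: le_trans (pint_interp p1 (cmeasurableB mg mg0) B10 _) _.
  case: (L1bB Lg Lg0) => _; apply: filterS => x /le_trans; apply.
  by rewrite lerDl.
apply: (@le_trans _ _ (((B + B + 1) `^ (p - 1))%:E *
    ((e / 2) `^ p / (B + B + 1) `^ (p - 1))%:E)%E).
  by rewrite lee_wpmul2l// lee_fin powR_ge0.
by rewrite -EFinM mulrC divfK// gt_eqF.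
Qed.

(** Banach's principle: the maximal inequality for [f] against a smooth [g] bounds the difference of
    their averages outside one set that is the same for all [t]. *)
Lemma au_cauchy_average f : cLp mu p%:E f ->
  au_cauchy mu (fun t x => (t^-1)%:C%C * orbit_integral mu S p b f t x).
Proof.
move=> lf; apply: au_cauchy_approx => eps de eps0 de0.
have C0 := adm_ge0 ab.
have p0 : 0 < p by exact: lt_le_trans p1.
pose l := de / (4 * (C + 1)).
have C10 : 0 < 4 * (C + 1) by rewrite mulr_gt0// ltr_wpDl.
have l0 : 0 < l by rewrite divr_gt0.
(* [l] is such that [4 * C * l <= de]; a distance [l * eps^(1/p)] from [f] to [g] makes the maximal
   inequality yield [mu E <= eps]. *)
have e0 : 0 < l * eps `^ p^-1 by rewrite mulr_gt0// powR_gt0.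
have [g [B [A [lg fg [B0 Lg] A0 lip]]]] := smooth_dense e0 lf.
have [E [mE muE EP]] := maximal_pair mu0 Ssg Scont p1 K0 KP lf lg l0.
exists (fun t x => (t^-1)%:C%C * orbit_integral mu S p b g t x), E, 1; split => //.
- exact: (au_cauchy_smooth lg B0 Lg A0 lip).
- have lp0 : 0 < l `^ p by rewrite powR_gt0.
  have -> : (mu E <= eps%:E)%E = ((l `^ p)%:E * mu E <= (l `^ p)%:E * eps%:E)%E.
    by rewrite lee_pmul2l.
  apply: le_trans muE _; apply: le_trans (pint_le_of_cLnorm p0 fg) _.
  rewrite powRM ?(ltW l0) ?powR_ge0// -powRrM mulVf ?gt_eqF// powRr1 ?(ltW eps0)//.
move=> t t1; have t0 : 0 < t by exact: lt_le_trans t1.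
apply: filterS (EP b C t ab (ltW t0)) => x fgx nE.
rewrite -mulrBr cnormM cnorm_real ger0_norm ?invr_ge0 ?(ltW t0)//.
rewrite ler_pdivrMl//; apply: le_trans (fgx nE) _.
rewrite mulrC ler_wpM2l ?(ltW t0)// /l.
rewrite (_ : 4 * C * _ = 4 * C / (4 * (C + 1)) * de); last by ring.
by rewrite -[leRHS]mul1r ler_wpM2r ?(ltW de0)// ler_pdivrMr// mul1r ler_wpM2l// lerDl.
Qed.

End besicovitch_averages.

Theorem theorem5p1 (R : realType) (d : measure_display) (Omega : measurableType d)
    (mu : {sigma_finite_measure set Omega -> \bar R})
    (muoo : mu [set: Omega] = +oo%E)
    (T : R -> (Omega -> R[i]) -> (Omega -> R[i]))
    (Tsg : ds_semigroup mu T) (Tcont : strongly_continuous_L1 mu T)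
    (beta : R -> R[i]) (C : R)
    (bbeta : bounded_besicovitch beta) (betaC : (Rplus_norm beta < C%:E)%E)
    (p : R) (p1 : 1 <= p) (f : Omega -> R[i]) (fLp : cLp mu p%:E f) :
  (forall t : R, 0 < t ->
     bochner_integrable mu p%:E t (fun s x => beta s * T s f x)) /\
  exists2 fhat : Omega -> R[i], cLp mu p%:E fhat &
    au_cvg mu (pinfty_nbhs R) (ergodic_average mu p%:E T beta f) fhat.
Proof.
have mu0 : (0 < mu setT)%E by rewrite muoo ltry.
have [K K0 KP] := op_bounded mu0 p1.
have ab := besicovitch_admissible bbeta betaC.
have p0 : 0 < p by exact: lt_le_trans p1.
have lG t : 0 < t -> cLp mu p%:E (orbit_integral mu T p beta f t).
  by move=> t0; exact: (cLp_orbit_integral mu0 Tsg Tcont p1 K0 KP ab fLp (ltW t0)).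
split=> [t t0|].
  exact: (orbit_integrable mu0 Tsg Tcont p1 K0 KP ab fLp (ltW t0)).
pose M := 2 * C * sbound mu p K f + C.
apply: (@au_cauchy_cvg _ _ _ mu _ p (M `^ p)) => //.
- move=> t t0; apply: cmeasurableZ; exact: (cLp_measurable (lG t t0)).
- move=> t t0; apply: pint_le_of_cLnorm => //.
  rewrite /ergodic_average cLnormZ//; last exact: (cLp_measurable (lG t t0)).
  rewrite cnorm_real ger0_norm ?invr_ge0 ?(ltW t0)// lee_pdivrMl//.
  apply: le_trans (orbit_integral_norm mu0 Tsg Tcont p1 K0 KP ab fLp t0) _.
  by rewrite -EFinM lee_fin mulrC.
exact: (au_cauchy_average mu0 Tsg Tcont p1 K0 KP bbeta ab fLp).
Qed.
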